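(* Let $\mathcal C$ be a pre-modular $\mathsf G$-category relative to $(\mathsf Z,\mathsf X)$ (in the sense of the context). (1) If $\mathcal C$ is relative modular, then $S_g$ is non-degenerate for some $g\in\mathsf G\setminus\mathsf X$. (2) If $\mathcal C$ is unimodular, $S_g$ is non-degenerate for some $g\in\mathsf G\setminus\mathsf X$, and $\mathcal C_0$ has $\mathsf Z$-trivial Müger center, then $\mathcal C$ is relative modular.
   Context: Let $\Bbbk$ be a field. A linear ribbon category over $\Bbbk$ is a ribbon category $\mathcal{C}$ with unit $\mathds{1}$ whose Hom-sets are $\Bbbk$-vector spaces, with $\Bbbk$-bilinear composition and tensor product of morphisms, and such that $\Bbbk\to\mathrm{End}(\mathds 1)$, $x\mapsto x\,\mathrm{Id}_{\mathds 1}$, is an isomorphism. The braiding is $c_{V,W}:V\otimes W\to W\otimes V$, the twist is $\theta_V$, the duality morphisms are $\overrightarrow{\mathrm{ev}}_V:V^*\otimes V\to\mathds 1$, $\overrightarrow{\mathrm{coev}}_V:\mathds 1\to V\otimes V^*$, $\overleftarrow{\mathrm{ev}}_V:V\otimes V^*\to\mathds 1$, $\overleftarrow{\mathrm{coev}}_V:\mathds 1\to V^*\otimes V$. An object $V$ is simple if $\mathrm{End}(V)=\Bbbk\,\mathrm{Id}_V$, and regular if its evaluation is an epimorphism. Ideals and m-traces: an ideal $\mathcal I$ of $\mathcal C$ is a full subcategory stable under retracts and such that $U\otimes V\in\mathcal I$ for all $U\in\mathcal I$, $V\in\mathcal C$. An m-trace on $\mathcal I$ is a family of linear maps $\mathsf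 t_V:\mathrm{End}(V)\to\Bbbk$ ($V\in\mathcal I$) with $\mathsf t_V(fg)=\mathsf t_U(gf)$ for $g:V\to U$, $f:U\to V$, $U,V\in\mathcal I$, and $\mathsf t_{U\otimes V}(f)=\mathsf t_U(\mathrm{ptr}_V(f))$ for $U\in\mathcal I$, $V\in\mathcal C$, $f\in\mathrm{End}(U\otimes V)$, where $\mathrm{ptr}_V$ is the right partial trace. The modified dimension of $V\in\mathcal I$ is $\mathsf d(V)=\mathsf t_V(\mathrm{Id}_V)$. Dominating sets: a set of objects $\{V_i\}_{i\in J}$ of a linear category is dominating if every $\mathrm{Id}_V$ is a finite sum $\sum_k \iota_k s_k$ with $s_k:V\to V_{i_k}$, $\iota_k:V_{i_k}\to V$; it is completely reduced if $\dim\mathrm{Hom}(V_i,V_j)=\delta_{i,j}$. Free realisation: for a commutative group $\mathsf Z$ (additive), a free realisation of $\mathsf Z$ in $\mathcal C$ is a set of objects $\{\sigma(k)\}_{k\in\mathsf Z}$ with $\sigma(0)=\mathds 1$, $\sigma(j)\otimes\sigma(k)=\sigma(j+k)$, quantum dimension of $\sigma(k)$ equal to $\pm1$, $\theta_{\sigma(k)}=\mathrm{Id}$, and, for every simple $V\in\mathcal C$, $V\otimes\sigma(k)\cong V$ iff $k=0$. Grading: for a commutative group $\mathsf G$, a $\mathsf G$-grading is an equivalence $\mathcal C\cong\bigoplus_{g\in\mathsf G}\mathcal C_g$ with full subcategories $\mathcal C_g$ such that $\mathds 1\in\mathcal C_0$; $V\in\mathcal C_g\Rightarrow V^*\in\mathcal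 C_{-g}$; $\mathcal C_g\otimes\mathcal C_{g'}\subset\mathcal C_{g+g'}$; and $\mathrm{Hom}(V,V')\ne0$ with $V\in\mathcal C_g,V'\in\mathcal C_{g'}$ implies $g=g'$. Each $\mathcal C_g$ is assumed to contain an object $V$ with $\mathrm{Id}_V\neq0$. A subset $\mathsf X\subset\mathsf G$ is symmetric if $\mathsf X=-\mathsf X$ and small if $\bigcup_{i=1}^n(g_i+\mathsf X)\ne\mathsf G$ for all $g_1,\dots,g_n\in\mathsf G$. Pre-modular: let $\mathsf X\subset\mathsf G$ be small symmetric. A pre-modular $\mathsf G$-category relative to $(\mathsf Z,\mathsf X)$ is a linear ribbon category $\mathcal C$ with a $\mathsf G$-grading, a free realisation $\{\sigma(k)\}_{k\in\mathsf Z}$ in $\mathcal C_0$, and a non-zero m-trace $\mathsf t$ on the ideal of projective objects, such that: (Generic semisimplicity) for every $g\in\mathsf G\setminus\mathsf X$ there is a finite set of regular simple objects $\Theta(g)=\{V_i\mid i\in I_g\}$ such that $\{V_i\otimes\sigma(k)\mid i\in I_g,k\in\mathsf Z\}$ is a completely reduced dominating set for $\mathcal C_g$; (Compatibility) there is a bilinear map $\psi:\mathsf G\times\mathsf Z\to\Bbbk^*$ with $c_{\sigma(k),V}\circ c_{V,\sigma(k)}=\psi(g,k)\,\mathrm{Id}_{V\otimes\sigma(k)}$ for $V\in\mathcal C_g$, $k\in\mathsf Z$. $S$-matrix: for $U,V\in\mathcal C$ let $\Phi_{U,V}=\mathrm{ptr}_U(c_{U,V}\circ c_{V,U})\in\mathrm{End}(V)$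 (the strand $V$ encircled by a closed component coloured $U$). For $g\in\mathsf G\setminus\mathsf X$ and $i,j\in I_g$ define $S'_{ij}\in\Bbbk$ by $\Phi_{V_i,V_j}=S'_{ij}\mathrm{Id}_{V_j}$ and $S_{ij}=\mathsf d(V_j)S'_{ij}$; $S_g=(S_{ij})_{i,j\in I_g}$. Non-degenerate means invertible. Relative modular: the pre-modular category $\mathcal C$ is relative modular if there is $\zeta_\Omega\in\Bbbk^*$ such that for all $g,h\in\mathsf G\setminus\mathsf X$ and $i,j\in I_g$, $$\mathsf d(V_i)\sum_{k\in I_h}\mathsf d(V_k)\,\Phi_{V_k,\,V_i\otimes V_j^*}=\delta_{i,j}\,\zeta_\Omega\,\overrightarrow{\mathrm{coev}}_{V_i}\circ\overleftarrow{\mathrm{ev}}_{V_i}$$ as endomorphisms of $V_i\otimes V_j^*$. Müger center: the Müger center of $\mathcal C_0$ is the full subcategory of objects $V\in\mathcal C_0$ with $c_{V,U}\circ c_{U,V}=\mathrm{Id}_{U\otimes V}$ for all $U\in\mathcal C_0$. The $\mathsf Z$-orbit of $V$ is the class of objects isomorphic to $V\otimes\sigma(k)$ for some $k\in\mathsf Z$. An object is $\mathsf Z$-trivial if it is a (finite) direct sum of objects in the $\mathsf Z$-orbit of $\mathds 1$. The Müger center of $\mathcal C_0$ is $\mathsf Z$-trivial if all its objects are. Unimodular: $\mathcal C$ is abelian, $\mathds 1$ has a projective cover $P_0$, and $P_0\cong P_0^*$ (so that $\dim\mathrm{Hom}(\mathds 1,P_0)=1$). *)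

(* Defs.v *)
From HB Require Import structures.
From mathcomp Require Import all_boot all_order all_algebra.
From mathcomp Require Import boolp classical_sets.

Set Implicit Arguments.
Unset Strict Implicit.
Unset Printing Implicit Defensive.

Import GRing.Theory.
Local Open Scope ring_scope.

Declare Scope cat_scope.
Delimit Scope cat_scope with C.
Open Scope cat_scope.


Record linCat (K : fieldType) := LinCat {
  Ob :> Type;
  Hom : Ob -> Ob -> lmodType K;
  idm : forall A : Ob, Hom A A;
  comp : forall A B D : Ob, Hom B D -> Hom A B -> Hom A D;
  compA : forall (A B D E : Ob) (h : Hom D E) (g : Hom B D) (f : Hom A B),
    comp h (comp g f) = comp (comp h g) f;
  compIm : forall (A B : Ob) (f : Hom A B), comp (idm B) f = f;
  compmI : forall (A B : Ob) (f : Hom A B), comp f (idm A) = f;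
  comp_linl : forall (A B D : Ob) (f : Hom A B) (a : K) (g g' : Hom B D),
    comp (a *: g + g') f = a *: comp g f + comp g' f;
  comp_linr : forall (A B D : Ob) (g : Hom B D) (a : K) (f f' : Hom A B),
    comp g (a *: f + f') = a *: comp g f + comp g f' }.

Arguments Hom {K l} A B.
Arguments idm {K l} A.
Arguments comp {K l A B D} g f.

Notation "g ∘ f" := (comp g f) (at level 40, left associativity) : cat_scope.

Section LinCat.
Variables (K : fieldType) (C : linCat K).

Definition is_iso (A B : C) (f : Hom A B) : Prop :=
  exists g : Hom B A, g ∘ f = idm A /\ f ∘ g = idm B.

Definition isomorphic (A B : C) : Prop := exists f : Hom A B, is_iso f.

Definition is_epi (A B : C) (p : Hom A B) : Prop :=
  forall (T : C) (f g : Hom B T), f ∘ p = g ∘ p -> f = g.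

Definition is_mono (A B : C) (i : Hom A B) : Prop :=
  forall (T : C) (f g : Hom T A), i ∘ f = i ∘ g -> f = g.

(* End(V) = K Id_V is read as a one-dimensional space: zero objects are not
   simple. *)
Definition is_simple (V : C) : Prop :=
  idm V <> 0 /\ forall f : Hom V V, exists a : K, f = a *: idm V.

Definition is_projective (P : C) : Prop :=
  forall (A B : C) (p : Hom A B) (f : Hom P B), is_epi p ->
    exists g : Hom P A, p ∘ g = f.

Definition is_direct_sum (I : finType) (W : I -> C) (V : C) : Prop :=
  exists (i : forall a, Hom (W a) V) (p : forall a, Hom V (W a)),
    [/\ forall a, p a ∘ i a = idm (W a),
        forall a b, a != b -> p b ∘ i a = 0
      & \sum_a (i a ∘ p a) = idm V].

Definition is_zero_object (V : C) : Prop := idm V = 0.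

Definition is_kernel (A B N : C) (f : Hom A B) (k : Hom N A) : Prop :=
  f ∘ k = 0 /\
  forall (T : C) (g : Hom T A), f ∘ g = 0 -> exists! u : Hom T N, k ∘ u = g.

Definition is_cokernel (A B Q : C) (f : Hom A B) (q : Hom B Q) : Prop :=
  q ∘ f = 0 /\
  forall (T : C) (g : Hom B T), g ∘ f = 0 -> exists! u : Hom Q T, u ∘ q = g.

Record is_abelian : Prop := IsAbelian {
  ab_zero : exists O : C, is_zero_object O;
  ab_biproduct : forall A B : C, exists S : C,
    is_direct_sum (fun b : bool => if b then A else B) S;
  ab_kernel : forall (A B : C) (f : Hom A B),
    exists (N : C) (k : Hom N A), is_kernel f k;
  ab_cokernel : forall (A B : C) (f : Hom A B),
    exists (Q : C) (q : Hom B Q), is_cokernel f q;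
  ab_mono : forall (N A : C) (k : Hom N A), is_mono k ->
    exists (B : C) (f : Hom A B), is_kernel f k;
  ab_epi : forall (B Q : C) (q : Hom B Q), is_epi q ->
    exists (A : C) (f : Hom A B), is_cokernel f q }.

(* The second condition says that the epimorphism e is essential. *)
Definition is_projective_cover (A P : C) (e : Hom P A) : Prop :=
  [/\ is_projective P, is_epi e
    & forall (T : C) (g : Hom T P), is_epi (e ∘ g) -> is_epi g].

Definition has_dim (V : lmodType K) (n : nat) : Prop :=
  exists b : 'I_n -> V, forall v : V,
    exists! a : 'rV[K]_n, v = \sum_i a 0 i *: b i.

Definition dominating (D : C -> Prop) (J : Type) (W : J -> C) : Prop :=
  (forall j, D (W j)) /\
  forall V : C, D V ->
    exists (n : nat) (j : 'I_n -> J)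
           (s : forall k, Hom V (W (j k))) (i : forall k, Hom (W (j k)) V),
      idm V = \sum_(k < n) (i k ∘ s k).

Definition completely_reduced (J : eqType) (W : J -> C) : Prop :=
  forall i j : J, has_dim (Hom (W i) (W j)) (i == j).

(* The a with f = a Id_V; unique when Id_V <> 0, and 0 if there is none. *)
Definition scalar_of (V : C) (f : Hom V V) : K :=
  xget 0 [set a : K | f = a *: idm V].

End LinCat.


(* The monoidal structure is not assumed to be strict. *)
Record monCat (K : fieldType) := MonCat {
  mon_lin :> linCat K;
  one : mon_lin;
  tens : mon_lin -> mon_lin -> mon_lin;
  tensm : forall A A' B B' : mon_lin,
    Hom A A' -> Hom B B' -> Hom (tens A B) (tens A' B');
  tensm_id : forall A B : mon_lin, tensm (idm A) (idm B) = idm (tens A B);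
  tensm_comp : forall (A A' A'' B B' B'' : mon_lin)
      (f' : Hom A' A'') (f : Hom A A') (g' : Hom B' B'') (g : Hom B B'),
    tensm (f' ∘ f) (g' ∘ g) = tensm f' g' ∘ tensm f g;
  tensm_linl : forall (A A' B B' : mon_lin) (a : K) (f f' : Hom A A')
      (g : Hom B B'),
    tensm (a *: f + f') g = a *: tensm f g + tensm f' g;
  tensm_linr : forall (A A' B B' : mon_lin) (a : K) (f : Hom A A')
      (g g' : Hom B B'),
    tensm f (a *: g + g') = a *: tensm f g + tensm f g';
  assoc : forall A B D : mon_lin,
    Hom (tens (tens A B) D) (tens A (tens B D));
  assocV : forall A B D : mon_lin,
    Hom (tens A (tens B D)) (tens (tens A B) D);
  lunit : forall A : mon_lin, Hom (tens one A) A;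
  lunitV : forall A : mon_lin, Hom A (tens one A);
  runit : forall A : mon_lin, Hom (tens A one) A;
  runitV : forall A : mon_lin, Hom A (tens A one);
  assocK : forall A B D, assocV A B D ∘ assoc A B D = idm _;
  assocVK : forall A B D, assoc A B D ∘ assocV A B D = idm _;
  lunitK : forall A, lunitV A ∘ lunit A = idm _;
  lunitVK : forall A, lunit A ∘ lunitV A = idm _;
  runitK : forall A, runitV A ∘ runit A = idm _;
  runitVK : forall A, runit A ∘ runitV A = idm _;
  assoc_nat : forall (A A' B B' D D' : mon_lin)
      (f : Hom A A') (g : Hom B B') (h : Hom D D'),
    assoc A' B' D' ∘ tensm (tensm f g) h = tensm f (tensm g h) ∘ assoc A B D;
  lunit_nat : forall (A A' : mon_lin) (f : Hom A A'),
    lunit A' ∘ tensm (idm one) f = f ∘ lunit A;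
  runit_nat : forall (A A' : mon_lin) (f : Hom A A'),
    runit A' ∘ tensm f (idm one) = f ∘ runit A;
  triangle : forall A B : mon_lin,
    tensm (idm A) (lunit B) ∘ assoc A one B = tensm (runit A) (idm B);
  pentagon : forall A B D E : mon_lin,
    assoc A B (tens D E) ∘ assoc (tens A B) D E =
    tensm (idm A) (assoc B D E) ∘ assoc A (tens B D) E
      ∘ tensm (assoc A B D) (idm E) }.

Arguments one {K m}.
Arguments tens {K m} A B.
Arguments tensm {K m A A' B B'} f g.
Arguments assoc {K m} A B D.
Arguments assocV {K m} A B D.
Arguments lunit {K m} A.
Arguments lunitV {K m} A.
Arguments runit {K m} A.
Arguments runitV {K m} A.

Notation "A ⊗ B" := (tens A B) (at level 38, left associativity) : cat_scope.
Notation "f ⊠ g" := (tensm f g) (at level 38, left associativity) : cat_scope.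

Record braidCat (K : fieldType) := BraidCat {
  braid_mon :> monCat K;
  braid : forall A B : braid_mon, Hom (A ⊗ B) (B ⊗ A);
  braid_iso : forall A B : braid_mon, is_iso (braid A B);
  braid_nat : forall (A A' B B' : braid_mon) (f : Hom A A') (g : Hom B B'),
    braid A' B' ∘ (f ⊠ g) = (g ⊠ f) ∘ braid A B;
  hexagonl : forall A B D : braid_mon,
    assoc B D A ∘ braid A (B ⊗ D) ∘ assoc A B D =
    (idm B ⊠ braid A D) ∘ assoc B A D ∘ (braid A B ⊠ idm D);
  hexagonr : forall A B D : braid_mon,
    assocV D A B ∘ braid (A ⊗ B) D ∘ assocV A B D =
    (braid A D ⊠ idm B) ∘ assocV A D B ∘ (idm A ⊠ braid B D) }.

Arguments braid {K b} A B.

(* evr, coevr (arrows pointing right) are primitive; evl, coevl below are derived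
   from them, the braiding and the twist. *)
Record ribbonCat (K : fieldType) := RibbonCat {
  rib_braid :> braidCat K;
  dual : rib_braid -> rib_braid;
  evr : forall V : rib_braid, Hom (dual V ⊗ V) one;
  coevr : forall V : rib_braid, Hom one (V ⊗ dual V);
  zigzagl : forall V : rib_braid,
    runit V ∘ (idm V ⊠ evr V) ∘ assoc V (dual V) V
      ∘ (coevr V ⊠ idm V) ∘ lunitV V = idm V;
  zigzagr : forall V : rib_braid,
    lunit (dual V) ∘ (evr V ⊠ idm (dual V)) ∘ assocV (dual V) V (dual V)
      ∘ (idm (dual V) ⊠ coevr V) ∘ runitV (dual V) = idm (dual V);
  twist : forall V : rib_braid, Hom V V;
  twist_iso : forall V : rib_braid, is_iso (twist V);
  twist_nat : forall (V W : rib_braid) (f : Hom V W),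
    twist W ∘ f = f ∘ twist V;
  twist_tens : forall V W : rib_braid,
    twist (V ⊗ W) = braid W V ∘ braid V W ∘ (twist V ⊠ twist W);
  twist_dual : forall V : rib_braid,
    (twist V ⊠ idm (dual V)) ∘ coevr V = (idm V ⊠ twist (dual V)) ∘ coevr V;
  scalar_bij : bijective (fun x : K => x *: idm (one : rib_braid)) }.

Arguments dual {K r} V.
Arguments evr {K r} V.
Arguments coevr {K r} V.
Arguments twist {K r} V.

Section Ribbon.
Variables (K : fieldType) (C : ribbonCat K).

Definition evl (V : C) : Hom (V ⊗ dual V) one :=
  evr V ∘ braid V (dual V) ∘ (twist V ⊠ idm (dual V)).

Definition coevl (V : C) : Hom one (dual V ⊗ V) :=
  (idm (dual V) ⊠ twist V) ∘ braid V (dual V) ∘ coevr V.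

Definition is_regular (V : C) : Prop := is_epi (evr V).

(* The quantum dimension, an element of End(1) = K. *)
Definition qdim (V : C) : Hom (one : C) one := evl V ∘ coevr V.

Definition ptr (U V : C) (f : Hom (U ⊗ V) (U ⊗ V)) : Hom U U :=
  runit U ∘ (idm U ⊠ evl V) ∘ assoc U V (dual V) ∘ (f ⊠ idm (dual V))
    ∘ assocV U V (dual V) ∘ (idm U ⊠ coevr V) ∘ runitV U.

Definition Phi (U V : C) : Hom V V := ptr (braid U V ∘ braid V U).

(* Only the values of t on objects of the ideal I are relevant. *)
Record is_mtrace (I : C -> Prop) (t : forall V : C, {scalar Hom V V}) : Prop :=
  IsMtrace {
    mtrace_cyclic : forall (U V : C) (f : Hom U V) (g : Hom V U),
      I U -> I V -> t V (f ∘ g) = t U (g ∘ f);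
    mtrace_ptr : forall (U V : C) (f : Hom (U ⊗ V) (U ⊗ V)),
      I U -> t (U ⊗ V) f = t U (ptr f) }.

Definition is_unimodular : Prop :=
  is_abelian C /\
  exists (P0 : C) (e : Hom P0 one),
    is_projective_cover e /\ isomorphic P0 (dual P0).

Record is_free_realisation (Z : zmodType) (sigma : Z -> C) : Prop :=
  IsFreeRealisation {
    sigma0 : sigma 0 = one;
    sigmaD : forall j k : Z, sigma j ⊗ sigma k = sigma (j + k);
    sigma_qdim : forall k : Z,
      qdim (sigma k) = idm one \/ qdim (sigma k) = - idm one;
    sigma_twist : forall k : Z, twist (sigma k) = idm (sigma k);
    sigma_free : forall (V : C) (k : Z), is_simple V ->
      (isomorphic (V ⊗ sigma k) V <-> k = 0) }.

(* The last three conditions on D say that the direct sum functor from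
   \bigoplus_g D g (whose objects are the finite formal sums of objects of the
   D g, for distinct g) to C is well defined, full and faithful, and essentially
   surjective. *)
Record is_grading (G : zmodType) (D : G -> C -> Prop) : Prop := IsGrading {
  grading_nonzero : forall g : G, exists V : C, D g V /\ idm V <> 0;
  grading_one : D 0 one;
  grading_dual : forall (g : G) (V : C), D g V -> D (- g) (dual V);
  grading_tens : forall (g h : G) (V W : C),
    D g V -> D h W -> D (g + h) (V ⊗ W);
  grading_sum : forall (n : nat) (g : 'I_n -> G) (W : 'I_n -> C),
    injective g -> (forall i, D (g i) (W i)) ->
    exists V : C, is_direct_sum W V;
  grading_hom : forall (g h : G) (V W : C), D g V -> D h W ->
    (exists f : Hom V W, f <> 0) -> g = h;
  grading_decomp : forall V : C,
    exists (n : nat) (g : 'I_n -> G) (W : 'I_n -> C),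
      [/\ injective g, forall i, D (g i) (W i) & is_direct_sum W V] }.

End Ribbon.


Section Subsets.
Local Open Scope classical_set_scope.
Variable G : zmodType.

Definition symmetric_set (X : set G) : Prop := X = [set - x | x in X].

Definition small_set (X : set G) : Prop :=
  forall (n : nat) (g : 'I_n -> G),
    \bigcup_(i in [set: 'I_n]) [set g i + x | x in X] <> [set: G].

End Subsets.

(* The sets pm_I g and families pm_V g are irrelevant for g in X. *)
Record premodular (K : fieldType) (G Z : zmodType) (X : set G) := Premodular {
  pm_small : small_set X;
  pm_sym : symmetric_set X;
  pm_cat :> ribbonCat K;
  pm_deg : G -> pm_cat -> Prop;
  pm_grading : is_grading pm_deg;
  sigma : Z -> pm_cat;
  pm_free : is_free_realisation sigma;
  sigma_deg : forall k : Z, pm_deg 0 (sigma k);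
  pm_trace : forall V : pm_cat, {scalar Hom V V};
  pm_mtrace : is_mtrace (@is_projective K pm_cat) pm_trace;
  pm_trace_neq0 : exists (V : pm_cat) (f : Hom V V),
    is_projective V /\ pm_trace V f <> 0;
  pm_I : G -> finType;
  pm_V : forall g : G, pm_I g -> pm_cat;
  pm_V_deg : forall (g : G) (i : pm_I g), ~ X g -> pm_deg g (pm_V i);
  pm_V_simple : forall (g : G) (i : pm_I g), ~ X g -> is_simple (pm_V i);
  pm_V_regular : forall (g : G) (i : pm_I g), ~ X g -> is_regular (pm_V i);
  pm_dominating : forall g : G, ~ X g ->
    dominating (pm_deg g) (fun ik : pm_I g * Z => pm_V ik.1 ⊗ sigma ik.2);
  pm_reduced : forall g : G, ~ X g ->
    completely_reduced (fun ik : pm_I g * Z => pm_V ik.1 ⊗ sigma ik.2);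
  pm_compat : exists psi : G -> Z -> K,
    [/\ forall g k, psi g k != 0,
        forall g h k, psi (g + h) k = psi g k * psi h k,
        forall g k l, psi g (k + l) = psi g k * psi g l
      & forall (g : G) (k : Z) (V : pm_cat), pm_deg g V ->
          braid (sigma k) V ∘ braid V (sigma k)
          = psi g k *: idm (V ⊗ sigma k)] }.

Section Premodular.
Variables (K : fieldType) (G Z : zmodType) (X : set G).
Variable C : premodular K Z X.

Definition mdim (V : C) : K := pm_trace V (idm V).

Definition Sprime (g : G) (i j : pm_I C g) : K :=
  scalar_of (Phi (pm_V i) (pm_V j)).

Definition Smatrix (g : G) : 'M[K]_#|pm_I C g| :=
  \matrix_(i, j) (mdim (pm_V (enum_val j)) * Sprime (enum_val i) (enum_val j)).

Definition S_nondegenerate (g : G) : Prop := Smatrix g \in unitmx.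

(* The right-hand side delta_(i,j) zeta coev_(V_i) ev_(V_i) is only typed as an
   endomorphism of V_i ⊗ V_j^* when i = j, whence the two equations. *)
Definition relative_modular : Prop :=
  exists zeta : K, zeta != 0 /\
    forall g h : G, ~ X g -> ~ X h ->
      (forall i : pm_I C g,
         mdim (pm_V i) *: (\sum_(k : pm_I C h)
           mdim (pm_V k) *: Phi (pm_V k) (pm_V i ⊗ dual (pm_V i)))
         = zeta *: (coevr (pm_V i) ∘ evl (pm_V i))) /\
      (forall i j : pm_I C g, i != j ->
         mdim (pm_V i) *: (\sum_(k : pm_I C h)
           mdim (pm_V k) *: Phi (pm_V k) (pm_V i ⊗ dual (pm_V j)))
         = 0).

Definition in_muger_center0 (V : C) : Prop :=
  pm_deg 0 V /\
  forall U : C, pm_deg 0 U -> braid V U ∘ braid U V = idm (U ⊗ V).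

Definition in_orbit (V W : C) : Prop :=
  exists k : Z, isomorphic W (V ⊗ sigma C k).

Definition Z_trivial (V : C) : Prop :=
  exists (n : nat) (W : 'I_n -> C),
    (forall i, in_orbit one (W i)) /\ is_direct_sum W V.

Definition Z_trivial_muger_center0 : Prop :=
  forall V : C, in_muger_center0 V -> Z_trivial V.

End Premodular.

(* Main.v *)
From mathcomp Require Import all_boot all_order all_algebra.
From mathcomp Require Import boolp classical_sets.
Require Import Defs.

Set Implicit Arguments.
Unset Strict Implicit.
Unset Printing Implicit Defensive.

Import GRing.Theory.
Local Open Scope ring_scope.

(** Write d for the modified dimension and, for g outside X, let the Kirby
    morphism kirby g V be the sum of d(V_k) Phi_(V_k, V) over k in I_g: a strand
    V encircled by the Kirby colour of degree g.

    Relative modularity makes every S_g invertible. Apply the modified trace to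
    the defining relation on V_i ⊗ V_j^*. The trace of Phi_(V_k, V_i ⊗ V_j^* )
    equals that of Phi_(V_i ⊗ V_j^*, V_k) (trace_PhiC), which is d(V_k) times
    the scalars by which V_i and V_j^* encircle V_k (trace_Phi_tens), while
    coev_(V_i) ev_(V_i) has trace d(V_i). The relation thus becomes an equation
    S_g M = zeta Id (relative_modular_nondegenerate).

    For the converse, objects of generic degree are sums of simple projective
    objects, the d(V_i) are nonzero, and the modified trace pairs Hom(P, B) and
    Hom(B, P) without kernel when P is projective (trace_nondeg). The proof
    has four steps.

    - Slide (kirby_slide). If U has degree a and V is projective of degree 0,
      then pulling U across V turns the Kirby colour of degree g around V into
      that of degree g + a. Both sides are compared by pairing them with an
      arbitrary endomorphism of U ⊗ V: there V_k ⊗ U is decomposed into simple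
      objects V_l, and bending U turns these decompositions into decompositions
      of the objects V_l ⊗ U^*.

    - Transparency (kirby_sigma). For a = 0 the slide shows that the image of
      kirby h V lies in the Mueger center of C_0, so that kirby h V factors
      through a sum of objects sigma(k). On V = V_i ⊗ V_j^* there are no maps to
      sigma(k) unless i = j and k = 0, when the evaluation spans them; hence
      kirby h V is zero for i <> j and a multiple lambda of coev ev for i = j.

    - Independence. The product d(V_i) lambda depends neither on V_i, because
      the evaluation of V_i lifts through that of V_j (kirby_scalar_colour), nor
      on h, by the slide (kirby_scalar_degree).

    - Non-vanishing (nondegenerate_kirby_contra). If d(V_i) lambda = 0, then
      kirby g vanishes on the whole of C_0 (kirby_vanish), and hence so does the
      sum over k of d(V_k)^2 c_k for every closed diagram of total degree 0
      winding around V_k with value c_k (encircling_sum). Let a be the double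
      braiding of V_i^* with V_k, and kappa the closure of the strand V_i^*.
      For n >= 1, kappa(a^n) has degree - n g; together with n loops of degree g
      it falls under the previous remark, and the invertibility of S_g yields
      kappa(a^n) = 0 (wound0). But kappa(a^-1) is Phi_(V_i, V_k) (trL_ccV), and
      the powers of a are linearly dependent. So Phi_(V_i, V_k) = 0 for all i
      and k, against the invertibility of S_g. *)

(** * Bilinear composition *)

Section LinearComposition.
Variables (K : fieldType) (C : linCat K).
Implicit Types A B D E : C.

Lemma compDl A B D (f : Hom A B) (g g' : Hom B D) :
  (g + g') ∘ f = g ∘ f + g' ∘ f.
Proof. by rewrite -[g in LHS]scale1r comp_linl scale1r. Qed.

Lemma comp0l A B D (f : Hom A B) : (0 : Hom B D) ∘ f = 0.
Proof. by apply: (addrI (0 ∘ f)); rewrite -compDl !addr0. Qed.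

Lemma compZl A B D (f : Hom A B) a (g : Hom B D) :
  (a *: g) ∘ f = a *: (g ∘ f).
Proof. by rewrite -[a *: g]addr0 comp_linl comp0l addr0. Qed.

Lemma compDr A B D (g : Hom B D) (f f' : Hom A B) :
  g ∘ (f + f') = g ∘ f + g ∘ f'.
Proof. by rewrite -[f in LHS]scale1r comp_linr scale1r. Qed.

Lemma comp0r A B D (g : Hom B D) : g ∘ (0 : Hom A B) = 0.
Proof. by apply: (addrI (g ∘ 0)); rewrite -compDr !addr0. Qed.

Lemma compZr A B D (g : Hom B D) a (f : Hom A B) :
  g ∘ (a *: f) = a *: (g ∘ f).
Proof. by rewrite -[a *: f]addr0 comp_linr comp0r addr0. Qed.

Lemma comp_suml A B D (I : Type) (r : seq I) (P : pred I)
    (F : I -> Hom B D) (f : Hom A B) :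
  (\sum_(i <- r | P i) F i) ∘ f = \sum_(i <- r | P i) (F i ∘ f).
Proof. by apply: (big_morph (fun g => g ∘ f)) => [g g'|]; rewrite ?compDl ?comp0l. Qed.

Lemma comp_sumr A B D (I : Type) (r : seq I) (P : pred I)
    (g : Hom B D) (F : I -> Hom A B) :
  g ∘ (\sum_(i <- r | P i) F i) = \sum_(i <- r | P i) (g ∘ F i).
Proof. by apply: (big_morph (comp g)) => [f f'|]; rewrite ?compDr ?comp0r. Qed.

(** Reassociated form of an equation between composites, for rewriting inside
    a right-nested composite. *)
Lemma ra A B B' D (a : Hom B D) (b : Hom A B) (a' : Hom B' D) (b' : Hom A B') :
  a ∘ b = a' ∘ b' -> forall E (x : Hom E A), a ∘ (b ∘ x) = a' ∘ (b' ∘ x).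
Proof. by move=> e E x; rewrite !compA e. Qed.

Lemma ra1 A B D (a : Hom B D) (b : Hom A B) (c : Hom A D) :
  a ∘ b = c -> forall E (x : Hom E A), a ∘ (b ∘ x) = c ∘ x.
Proof. by move=> e E x; rewrite !compA e. Qed.

Lemma ra0 A B (a : Hom B A) (b : Hom A B) :
  a ∘ b = idm A -> forall E (x : Hom E A), a ∘ (b ∘ x) = x.
Proof. by move=> e E x; rewrite !compA e compIm. Qed.

Lemma ra3 A B B'' D D' (a : Hom B'' D) (b : Hom B B'') (c : Hom A B)
    (d : Hom D' D) (e : Hom A D') :
  a ∘ (b ∘ c) = d ∘ e -> forall E (x : Hom E A), a ∘ (b ∘ (c ∘ x)) = d ∘ (e ∘ x).
Proof. by move=> h E x; rewrite !compA -h !compA. Qed.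

Lemma ra33 A B B' B1 B2 D (a : Hom B' D) (b : Hom B B') (c : Hom A B)
    (d : Hom B2 D) (e : Hom B1 B2) (f : Hom A B1) :
  a ∘ (b ∘ c) = d ∘ (e ∘ f) ->
  forall E (x : Hom E A), a ∘ (b ∘ (c ∘ x)) = d ∘ (e ∘ (f ∘ x)).
Proof. by move=> h E x; rewrite ![in LHS]compA -[a ∘ b ∘ c]compA h -!compA. Qed.

Lemma ra4 A B B1 B2 D D' (a : Hom B2 D) (b : Hom B1 B2) (c : Hom B B1)
    (d : Hom A B) (e : Hom D' D) (f : Hom A D') :
  a ∘ (b ∘ (c ∘ d)) = e ∘ f ->
  forall E (x : Hom E A), a ∘ (b ∘ (c ∘ (d ∘ x))) = e ∘ (f ∘ x).
Proof. by move=> h E x; rewrite !compA -h !compA. Qed.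

Lemma iso_comp A B D (g : Hom B D) (f : Hom A B) :
  is_iso g -> is_iso f -> is_iso (g ∘ f).
Proof.
move=> [g' [g1 g2]] [f' [f1 f2]]; exists (f' ∘ g').
by rewrite -?compA (ra0 g1) (ra0 f2) f1 g2.
Qed.

Lemma iso_epi A B (f : Hom A B) : is_iso f -> is_epi f.
Proof.
move=> [g [_ fg]] T u v e.
by rewrite -[u]compmI -[v]compmI -fg !compA e.
Qed.

Lemma iso_mono A B (f : Hom A B) : is_iso f -> is_mono f.
Proof.
move=> [g [gf _]] T u v e.
by rewrite -[u]compIm -[v]compIm -gf -?compA e.
Qed.

Lemma epi_comp A B D (g : Hom B D) (f : Hom A B) :
  is_epi g -> is_epi f -> is_epi (g ∘ f).
Proof. by move=> eg ef T u v; rewrite !compA => /ef /eg. Qed.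

Lemma mono_comp A B D (g : Hom B D) (f : Hom A B) :
  is_mono g -> is_mono f -> is_mono (g ∘ f).
Proof. by move=> mg mf T u v; rewrite -!compA => /mg /mf. Qed.

End LinearComposition.

(** * Whiskering and the coherence of the unit *)

Notation "A ◃ f" := (idm A ⊠ f) (at level 36, right associativity) : cat_scope.
Notation "f ▹ T" := (f ⊠ idm T) (at level 37, left associativity) : cat_scope.

Section Monoidal.
Variables (K : fieldType) (C : monCat K).
Implicit Types A B D E T U V X Y : C.

Lemma whL A B D E (g : Hom D E) (f : Hom B D) : A ◃ (g ∘ f) = (A ◃ g) ∘ (A ◃ f).
Proof. by rewrite -tensm_comp compIm. Qed.

Lemma whR A B D E (g : Hom D E) (f : Hom B D) : (g ∘ f) ▹ A = (g ▹ A) ∘ (f ▹ A).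
Proof. by rewrite -tensm_comp compIm. Qed.

Lemma whI A B : A ◃ idm B = idm (A ⊗ B).
Proof. exact: tensm_id. Qed.

Lemma xch A A' B B' (f : Hom A A') (g : Hom B B') :
  (f ▹ B') ∘ (A ◃ g) = (A' ◃ g) ∘ (f ▹ B).
Proof. by rewrite -!tensm_comp !compIm !compmI. Qed.

Lemma tensmE A A' B B' (f : Hom A A') (g : Hom B B') :
  f ⊠ g = (f ▹ B') ∘ (A ◃ g).
Proof. by rewrite -!tensm_comp !compIm !compmI. Qed.

Lemma tensmE' A A' B B' (f : Hom A A') (g : Hom B B') :
  f ⊠ g = (A' ◃ g) ∘ (f ▹ B).
Proof. by rewrite -!tensm_comp !compIm !compmI. Qed.

Lemma tensDl A A' B B' (f f' : Hom A A') (g : Hom B B') :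
  (f + f') ⊠ g = f ⊠ g + f' ⊠ g.
Proof. by rewrite -[f in LHS]scale1r tensm_linl scale1r. Qed.

Lemma tens0l A A' B B' (g : Hom B B') : (0 : Hom A A') ⊠ g = 0.
Proof. by apply: (addrI (0 ⊠ g)); rewrite -tensDl !addr0. Qed.

Lemma tensZl A A' B B' a (f : Hom A A') (g : Hom B B') :
  (a *: f) ⊠ g = a *: (f ⊠ g).
Proof. by rewrite -[a *: f]addr0 tensm_linl tens0l addr0. Qed.

Lemma tensDr A A' B B' (f : Hom A A') (g g' : Hom B B') :
  f ⊠ (g + g') = f ⊠ g + f ⊠ g'.
Proof. by rewrite -[g in LHS]scale1r tensm_linr scale1r. Qed.

Lemma tens0r A A' B B' (f : Hom A A') : f ⊠ (0 : Hom B B') = 0.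
Proof. by apply: (addrI (f ⊠ 0)); rewrite -tensDr !addr0. Qed.

Lemma tensZr A A' B B' a (f : Hom A A') (g : Hom B B') :
  f ⊠ (a *: g) = a *: (f ⊠ g).
Proof. by rewrite -[a *: g]addr0 tensm_linr tens0r addr0. Qed.

Lemma tens_suml A A' B B' (I : Type) (r : seq I) (P : pred I)
    (F : I -> Hom A A') (g : Hom B B') :
  (\sum_(i <- r | P i) F i) ⊠ g = \sum_(i <- r | P i) (F i ⊠ g).
Proof. by apply: (big_morph (fun f => f ⊠ g)) => [f f'|]; rewrite ?tensDl ?tens0l. Qed.

Lemma tens_sumr A A' B B' (I : Type) (r : seq I) (P : pred I)
    (f : Hom A A') (F : I -> Hom B B') :
  f ⊠ (\sum_(i <- r | P i) F i) = \sum_(i <- r | P i) (f ⊠ F i).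
Proof. by apply: (big_morph (tensm f)) => [g g'|]; rewrite ?tensDr ?tens0r. Qed.

Lemma assocV_nat A A' B B' D D' (f : Hom A A') (g : Hom B B') (h : Hom D D') :
  assocV A' B' D' ∘ (f ⊠ (g ⊠ h)) = ((f ⊠ g) ⊠ h) ∘ assocV A B D.
Proof.
rewrite -[LHS]compmI -(assocVK A B D) -compA (ra (esym (assoc_nat f g h))).
by rewrite (ra0 (assocK _ _ _)).
Qed.

Lemma lunitV_nat A A' (f : Hom A A') : lunitV A' ∘ f = (one ◃ f) ∘ lunitV A.
Proof.
rewrite -[f in LHS]compmI -(lunitVK A) (ra (esym (lunit_nat f))).
by rewrite (ra0 (lunitK _)).
Qed.

Lemma runitV_nat A A' (f : Hom A A') : runitV A' ∘ f = (f ▹ one) ∘ runitV A.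
Proof.
rewrite -[f in LHS]compmI -(runitVK A) (ra (esym (runit_nat f))).
by rewrite (ra0 (runitK _)).
Qed.

Lemma whL1_inj A B (f g : Hom A B) : one ◃ f = one ◃ g -> f = g.
Proof.
by move=> e; rewrite -[f]compmI -[g]compmI -(lunitVK A) !(ra (esym (lunit_nat _))) e.
Qed.

Lemma whR1_inj A B (f g : Hom A B) : f ▹ one = g ▹ one -> f = g.
Proof.
by move=> e; rewrite -[f]compmI -[g]compmI -(runitVK A) !(ra (esym (runit_nat _))) e.
Qed.

Lemma assoc_iso A B D : is_iso (assoc A B D).
Proof. by exists (assocV A B D); rewrite assocK assocVK. Qed.

Lemma assocV_iso A B D : is_iso (assocV A B D).
Proof. by exists (assoc A B D); rewrite assocK assocVK. Qed.

Lemma lunit_iso A : is_iso (lunit A).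
Proof. by exists (lunitV A); rewrite lunitK lunitVK. Qed.

Lemma runit_iso A : is_iso (runit A).
Proof. by exists (runitV A); rewrite runitK runitVK. Qed.

Lemma whL_iso A B D (f : Hom B D) : is_iso f -> is_iso (A ◃ f).
Proof. by move=> [g [gf fg]]; exists (A ◃ g); rewrite -!whL gf fg !whI. Qed.

Lemma whR_iso A B D (f : Hom B D) : is_iso f -> is_iso (f ▹ A).
Proof. by move=> [g [gf fg]]; exists (g ▹ A); rewrite -!whR gf fg !whI. Qed.

Lemma assoc_natL A A' B D (f : Hom A A') :
  assoc A' B D ∘ (f ▹ B ▹ D) = (f ▹ (B ⊗ D)) ∘ assoc A B D.
Proof. by rewrite assoc_nat whI. Qed.

Lemma assoc_natR A B D D' (f : Hom D D') :
  assoc A B D' ∘ ((A ⊗ B) ◃ f) = (A ◃ B ◃ f) ∘ assoc A B D.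
Proof. by rewrite -whI assoc_nat. Qed.

Lemma assocV_natL A A' B D (f : Hom A A') :
  assocV A' B D ∘ (f ▹ (B ⊗ D)) = (f ▹ B ▹ D) ∘ assocV A B D.
Proof. by rewrite -whI assocV_nat. Qed.

Lemma assocV_natR A B D D' (f : Hom D D') :
  assocV A B D' ∘ (A ◃ B ◃ f) = ((A ⊗ B) ◃ f) ∘ assocV A B D.
Proof. by rewrite assocV_nat whI. Qed.

(** Kelly's coherences for the unit, which follow from the triangle and the
    pentagon because tensoring with the unit is faithful. *)
Lemma lunit_assoc A B : lunit (A ⊗ B) ∘ assoc one A B = lunit A ▹ B.
Proof.
apply: whL1_inj.
have ie : is_epi (assoc (one : C) (one ⊗ A) B ∘ (assoc (one : C) one A ▹ B)).
  by apply: iso_epi; apply: iso_comp (assoc_iso _ _ _) (whR_iso _ (assoc_iso _ _ _)).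
apply: ie; have E := pentagon (one : C) one A B; rewrite -?compA in E.
rewrite whL -?compA -E (ra1 (triangle _ _)).
by rewrite (ra (esym (assoc_nat _ _ _))) -whR triangle assoc_natL.
Qed.

Lemma runit_assoc A B : (A ◃ runit B) ∘ assoc A B one = runit (A ⊗ B).
Proof.
apply: whR1_inj; apply: (iso_mono (assoc_iso A B one)).
rewrite whR (ra (assoc_nat _ _ _)) -(triangle B one) whL -?compA.
have E := pentagon A B (one : C) one; rewrite -?compA in E.
by rewrite -E -(triangle (A ⊗ B)) !compA assoc_natR.
Qed.

Lemma lunit_one : lunit (one : C) = runit one.
Proof.
apply: whR1_inj; rewrite -triangle -lunit_assoc; congr (_ ∘ _).
by apply: (iso_mono (lunit_iso one)); rewrite lunit_nat.
Qed.

End Monoidal.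

(** * Diagrams with a tail *)

Section Tails.
Variables (K : fieldType) (C : monCat K).
Implicit Types A B D E T U V X Y : C.

Fact coupon_key : unit. Proof. by []. Qed.

(** A coupon bmn f T applies f, with m inputs and n outputs, to the first strands
    of an object whose tensor factors are nested to the right, with tail T. The
    associativity isomorphisms are hidden in the coupons, so that equations
    between diagrams with a tail are rewritten as in a strict category; the case
    of the tail 1 recovers the equation without a tail. The bodies are locked
    because unification would otherwise unfold them. *)
Definition b22 A B A' B' (f : Hom (A ⊗ B) (A' ⊗ B')) T :
    Hom (A ⊗ (B ⊗ T)) (A' ⊗ (B' ⊗ T)) :=
  locked_with coupon_key (assoc A' B' T ∘ ((f ▹ T) ∘ assocV A B T)).
Definition b21 A B D (f : Hom (A ⊗ B) D) T : Hom (A ⊗ (B ⊗ T)) (D ⊗ T) :=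
  locked_with coupon_key ((f ▹ T) ∘ assocV A B T).
Definition b12 A B D (f : Hom D (A ⊗ B)) T : Hom (D ⊗ T) (A ⊗ (B ⊗ T)) :=
  locked_with coupon_key (assoc A B T ∘ (f ▹ T)).
Definition b20 A B (f : Hom (A ⊗ B) one) T : Hom (A ⊗ (B ⊗ T)) T :=
  locked_with coupon_key (lunit T ∘ ((f ▹ T) ∘ assocV A B T)).
Definition b02 A B (f : Hom one (A ⊗ B)) T : Hom T (A ⊗ (B ⊗ T)) :=
  locked_with coupon_key (assoc A B T ∘ ((f ▹ T) ∘ lunitV T)).

Lemma b22E A B A' B' (f : Hom (A ⊗ B) (A' ⊗ B')) T :
  b22 f T = assoc A' B' T ∘ ((f ▹ T) ∘ assocV A B T).
Proof. by rewrite /b22 unlock. Qed.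
Lemma b21E A B D (f : Hom (A ⊗ B) D) T : b21 f T = (f ▹ T) ∘ assocV A B T.
Proof. by rewrite /b21 unlock. Qed.
Lemma b12E A B D (f : Hom D (A ⊗ B)) T : b12 f T = assoc A B T ∘ (f ▹ T).
Proof. by rewrite /b12 unlock. Qed.
Lemma b20E A B (f : Hom (A ⊗ B) one) T :
  b20 f T = lunit T ∘ ((f ▹ T) ∘ assocV A B T).
Proof. by rewrite /b20 unlock. Qed.
Lemma b02E A B (f : Hom one (A ⊗ B)) T :
  b02 f T = assoc A B T ∘ ((f ▹ T) ∘ lunitV T).
Proof. by rewrite /b02 unlock. Qed.

Lemma wh1 A B D E (a : Hom D E) (b : Hom B D) (c : Hom B E) :
  a ∘ b = c -> (A ◃ a) ∘ (A ◃ b) = A ◃ c.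
Proof. by move=> e; rewrite -!whL e. Qed.

Lemma wh0 A B D (a : Hom D B) (b : Hom B D) :
  a ∘ b = idm B -> (A ◃ a) ∘ (A ◃ b) = idm (A ⊗ B).
Proof. by move=> e; rewrite -!whL e whI. Qed.

Lemma wh3 A B B1 B2 D (a : Hom B2 D) (b : Hom B1 B2) (c : Hom B B1)
    (d : Hom B D) : a ∘ (b ∘ c) = d ->
  forall E (x : Hom E (A ⊗ B)),
  (A ◃ a) ∘ ((A ◃ b) ∘ ((A ◃ c) ∘ x)) = (A ◃ d) ∘ x.
Proof. by move=> <- E x; rewrite !whL -?compA. Qed.

Lemma b22_nat A B A' B' (f : Hom (A ⊗ B) (A' ⊗ B')) T T' (t : Hom T T') :
  b22 f T' ∘ (A ◃ B ◃ t) = (A' ◃ B' ◃ t) ∘ b22 f T.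
Proof.
by rewrite !b22E -?compA assocV_natR (ra (xch _ _)) (ra (assoc_natR _ _ _)).
Qed.

Lemma b21_nat A B D (f : Hom (A ⊗ B) D) T T' (t : Hom T T') :
  b21 f T' ∘ (A ◃ B ◃ t) = (D ◃ t) ∘ b21 f T.
Proof. by rewrite !b21E -?compA assocV_natR (ra (xch _ _)). Qed.

Lemma b12_nat A B D (f : Hom D (A ⊗ B)) T T' (t : Hom T T') :
  b12 f T' ∘ (D ◃ t) = (A ◃ B ◃ t) ∘ b12 f T.
Proof. by rewrite !b12E -?compA xch (ra (assoc_natR _ _ _)). Qed.

Lemma b20_nat A B (f : Hom (A ⊗ B) one) T T' (t : Hom T T') :
  b20 f T' ∘ (A ◃ B ◃ t) = t ∘ b20 f T.
Proof.
by rewrite !b20E -?compA assocV_natR (ra (xch _ _)) (ra (lunit_nat _)).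
Qed.

Lemma b02_nat A B (f : Hom one (A ⊗ B)) T T' (t : Hom T T') :
  b02 f T' ∘ t = (A ◃ B ◃ t) ∘ b02 f T.
Proof.
by rewrite !b02E -?compA lunitV_nat (ra (xch _ _)) (ra (assoc_natR _ _ _)).
Qed.

Lemma b22_comp A B A' B' A'' B'' (g : Hom (A' ⊗ B') (A'' ⊗ B''))
  (f : Hom (A ⊗ B) (A' ⊗ B')) T : b22 (g ∘ f) T = b22 g T ∘ b22 f T.
Proof. by rewrite !b22E -?compA (ra0 (assocK _ _ _)) whR -?compA. Qed.

Lemma b20_comp A B A' B' (g : Hom (A' ⊗ B') one)
  (f : Hom (A ⊗ B) (A' ⊗ B')) T : b20 (g ∘ f) T = b20 g T ∘ b22 f T.
Proof. by rewrite !b20E !b22E -?compA (ra0 (assocK _ _ _)) whR -?compA. Qed.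

Lemma b02_comp A B A' B' (g : Hom (A ⊗ B) (A' ⊗ B'))
  (f : Hom one (A ⊗ B)) T : b02 (g ∘ f) T = b22 g T ∘ b02 f T.
Proof. by rewrite !b02E !b22E -?compA (ra0 (assocK _ _ _)) whR -?compA. Qed.

Lemma b22_split1 A B A' B' D (g : Hom D (A' ⊗ B')) (f : Hom (A ⊗ B) D) T :
  b22 (g ∘ f) T = b12 g T ∘ b21 f T.
Proof. by rewrite !b22E !b12E !b21E -?compA whR -?compA. Qed.

Lemma b22_split0 A B A' B' (g : Hom one (A' ⊗ B')) (f : Hom (A ⊗ B) one) T :
  b22 (g ∘ f) T = b02 g T ∘ b20 f T.
Proof. by rewrite !b22E !b02E !b20E -?compA (ra0 (lunitK _)) whR -?compA. Qed.

Lemma b11_split2 A B D D' (g : Hom (A ⊗ B) D') (f : Hom D (A ⊗ B)) T :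
  (g ∘ f) ▹ T = b21 g T ∘ b12 f T.
Proof. by rewrite !b21E !b12E -?compA (ra0 (assocK _ _ _)) whR -?compA. Qed.

Lemma b12_compr A B D D' (f : Hom D (A ⊗ B)) (g : Hom D' D) T :
  b12 (f ∘ g) T = b12 f T ∘ (g ▹ T).
Proof. by rewrite !b12E whR -?compA. Qed.

Lemma b22_id A B T : b22 (idm (A ⊗ B)) T = idm _.
Proof. by rewrite !b22E whI compIm assocVK. Qed.

Lemma b22_whR A A' B (f : Hom A A') T : b22 (f ▹ B) T = f ▹ (B ⊗ T).
Proof. by rewrite !b22E (ra (assoc_natL _ _ _)) assocVK compmI. Qed.

Lemma b22_whL A B B' (f : Hom B B') T : b22 (A ◃ f) T = A ◃ (f ▹ T).
Proof. by rewrite !b22E (ra (assoc_nat _ _ _)) assocVK compmI. Qed.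

Lemma b12_inj A B D (f g : Hom D (A ⊗ B)) : b12 f one = b12 g one -> f = g.
Proof. by rewrite !b12E => /(iso_mono (assoc_iso _ _ _)) /whR1_inj. Qed.

Lemma b21_inj A B D (f g : Hom (A ⊗ B) D) : b21 f one = b21 g one -> f = g.
Proof. by rewrite !b21E => /(iso_epi (assocV_iso _ _ _)) /whR1_inj. Qed.

Lemma pentagonV A B D E :
  assocV (A ⊗ B) D E ∘ assocV A B (D ⊗ E) =
  (assocV A B D ▹ E) ∘ (assocV A (B ⊗ D) E ∘ (A ◃ assocV B D E)).
Proof.
apply: (iso_mono (iso_comp (assoc_iso A B (D ⊗ E)) (assoc_iso (A ⊗ B) D E))).
rewrite [in RHS](pentagon A B D E) -?compA (ra0 (assocVK _ _ _)) assocVK.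
rewrite (ra1 (esym (whR _ _ _))) assocVK whI compIm (ra0 (assocVK _ _ _)).
by rewrite -whL assocVK whI.
Qed.

End Tails.

(** * Crossings *)

Section Braided.
Variables (K : fieldType) (C : braidCat K).
Implicit Types A B D E T U V X Y : C.

Definition braidV A B : Hom (B ⊗ A) (A ⊗ B) := sval (cid (braid_iso A B)).

Lemma braidK A B : braidV A B ∘ braid A B = idm _.
Proof. by case: (svalP (cid (braid_iso A B))). Qed.

Lemma braidVK A B : braid A B ∘ braidV A B = idm _.
Proof. by case: (svalP (cid (braid_iso A B))). Qed.

Fact crossing_key : unit. Proof. by []. Qed.

(** The positive and the negative crossing in front of a tail. *)
Definition cT A B T := locked_with crossing_key (b22 (braid A B) T).
Definition cV A B T := locked_with crossing_key (b22 (braidV A B) T).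

Lemma cTE A B T : cT A B T = b22 (braid A B) T.
Proof. by rewrite /cT unlock. Qed.

Lemma cVE A B T : cV A B T = b22 (braidV A B) T.
Proof. by rewrite /cV unlock. Qed.

Lemma cTK A B T : cV A B T ∘ cT A B T = idm _.
Proof. by rewrite cVE cTE -b22_comp braidK b22_id. Qed.

Lemma cVK A B T : cT A B T ∘ cV A B T = idm _.
Proof. by rewrite cVE cTE -b22_comp braidVK b22_id. Qed.

Lemma cT_nat A B T T' (t : Hom T T') :
  cT A B T' ∘ (A ◃ B ◃ t) = (B ◃ A ◃ t) ∘ cT A B T.
Proof. by rewrite !cTE b22_nat. Qed.

Lemma cT_natr A B B' (f : Hom B B') T :
  cT A B' T ∘ (A ◃ (f ▹ T)) = (f ▹ (A ⊗ T)) ∘ cT A B T.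
Proof. by rewrite !cTE -b22_whL -b22_whR -!b22_comp braid_nat. Qed.

Lemma cT_natl A A' B (f : Hom A A') T :
  cT A' B T ∘ (f ▹ (B ⊗ T)) = (B ◃ (f ▹ T)) ∘ cT A B T.
Proof. by rewrite !cTE -b22_whL -b22_whR -!b22_comp braid_nat. Qed.

Lemma cV_natl A A' B (f : Hom A A') T :
  cV A' B T ∘ (B ◃ (f ▹ T)) = (f ▹ (B ⊗ T)) ∘ cV A B T.
Proof.
rewrite -[LHS]compmI -(cVK A B T) -?compA (ra (esym (cT_natl _ _ _))).
by rewrite (ra0 (cTK _ _ _)).
Qed.

Lemma cV_natr A B B' (f : Hom B B') T :
  cV A B' T ∘ (f ▹ (A ⊗ T)) = (A ◃ (f ▹ T)) ∘ cV A B T.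
Proof.
rewrite -[LHS]compmI -(cVK A B T) -?compA (ra (esym (cT_natr _ _ _))).
by rewrite (ra0 (cTK _ _ _)).
Qed.

(** Both unit constraints for the braiding follow from a hexagon with two strands
    equal to the unit, where one of the three braidings cancels. *)
Lemma braid_one_r X : lunit X ∘ braid X one = runit X.
Proof.
apply: whR1_inj; rewrite whR.
apply: (iso_mono (braid_iso X one)).
have E := hexagonl X (one : C) one; rewrite -?compA in E.
have E2 := congr1 (comp (lunit (one ⊗ X))) E.
rewrite (ra1 (lunit_assoc _ _)) in E2.
rewrite (ra (lunit_nat _)) (ra1 (lunit_assoc _ _)) in E2.
by rewrite -E2 (ra (esym (braid_nat _ _))) triangle.
Qed.

Lemma braid_one_l X : runit X ∘ braid one X = lunit X.
Proof.
apply: whL1_inj; rewrite whL.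
apply: (iso_mono (braid_iso one X)).
have E := hexagonr (one : C) one X; rewrite -?compA in E.
have E2 := congr1 (comp (runit (X ⊗ one))) E.
have e1 : runit (X ⊗ one) ∘ assocV X one one = X ◃ runit one.
  by rewrite -runit_assoc -compA assocVK compmI.
rewrite (ra1 e1) (ra (runit_nat _)) in E2.
have e2 : runit (one ⊗ X) ∘ assocV one X one = one ◃ runit X.
  by rewrite -runit_assoc -compA assocVK compmI.
rewrite (ra1 e2) in E2.
rewrite -E2 (ra (esym (braid_nat _ _))) -(triangle one X) -compA assocVK.
by rewrite compmI.
Qed.

Lemma cT_one_r X T : lunit (X ⊗ T) ∘ cT X one T = X ◃ lunit T.
Proof.
rewrite !cTE !b22E (ra1 (lunit_assoc _ _)) (ra1 (esym (whR _ _ _))) braid_one_r.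
by rewrite -triangle -compA assocVK compmI.
Qed.

Lemma cT_one_l X T : (X ◃ lunit T) ∘ cT one X T = lunit (X ⊗ T).
Proof.
rewrite !cTE !b22E (ra1 (triangle _ _)) (ra1 (esym (whR _ _ _))) braid_one_l.
by rewrite -lunit_assoc -compA assocVK compmI.
Qed.

Lemma braid_tensr X A B : braid X (A ⊗ B) =
  assocV A B X ∘ ((A ◃ braid X B) ∘ (assoc A X B ∘ ((braid X A ▹ B) ∘ assocV X A B))).
Proof.
have E := hexagonl X A B; rewrite -?compA in E.
apply: (iso_mono (assoc_iso _ _ _)); apply: (iso_epi (assoc_iso _ _ _)).
by rewrite -?compA assocK compmI (ra0 (assocVK _ _ _)) E.
Qed.

Lemma braid_tensl A B X : braid (A ⊗ B) X =
  assoc X A B ∘ ((braid A X ▹ B) ∘ (assocV A X B ∘ ((A ◃ braid B X) ∘ assoc A B X))).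
Proof.
have E := hexagonr A B X; rewrite -?compA in E.
apply: (iso_mono (assocV_iso _ _ _)); apply: (iso_epi (assocV_iso _ _ _)).
by rewrite -?compA assocVK compmI (ra0 (assocK _ _ _)) E.
Qed.

(** The hexagon axioms, where the tail absorbs the associativities between the
    three strands. *)
Lemma cT_tensr X A B T :
  assoc A B (X ⊗ T) ∘ (cT X (A ⊗ B) T ∘ (X ◃ assocV A B T)) =
  (A ◃ cT X B T) ∘ cT X A (B ⊗ T).
Proof.
rewrite !cTE !b22E braid_tensr !whR !whL -?compA.
have P1 : assoc A B (X ⊗ T) ∘ (assoc (A ⊗ B) X T ∘ (assocV A B X ▹ T)) =
    (A ◃ assoc B X T) ∘ assoc A (B ⊗ X) T.
  by rewrite compA pentagon -?compA -whR assocVK whI compmI.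
have P2 : assoc A (X ⊗ B) T ∘ (assoc A X B ▹ T) =
    (A ◃ assocV X B T) ∘ (assoc A X (B ⊗ T) ∘ assoc (A ⊗ X) B T).
  by rewrite pentagon -?compA (ra1 (esym (whL _ _ _))) assocK whI compIm.
have P3 := pentagonV X A B T.
rewrite (ra3 P1) (ra (assoc_nat _ _ _)) (ra P2) -?compA.
by rewrite (ra (assoc_natL _ _ _)) -P3 (ra0 (assocVK _ _ _)).
Qed.

Lemma cT_tensl X A B T :
  (X ◃ assoc A B T) ∘ (cT (A ⊗ B) X T ∘ assocV A B (X ⊗ T)) =
  cT A X (B ⊗ T) ∘ (A ◃ cT B X T).
Proof.
rewrite !cTE !b22E braid_tensl !whR !whL -?compA.
have P1 : assocV (A ⊗ B) X T ∘ assocV A B (X ⊗ T) =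
    (assocV A B X ▹ T) ∘ (assocV A (B ⊗ X) T ∘ (A ◃ assocV B X T)).
  exact: pentagonV.
have P2 : (X ◃ assoc A B T) ∘ (assoc X (A ⊗ B) T ∘ (assoc X A B ▹ T)) =
    assoc X A (B ⊗ T) ∘ assoc (X ⊗ A) B T.
  by rewrite pentagon -?compA.
have P4 : (assocV A X B ▹ T) ∘ assocV A (X ⊗ B) T =
    assocV (A ⊗ X) B T ∘ (assocV A X (B ⊗ T) ∘ (A ◃ assoc X B T)).
  by rewrite compA pentagonV -?compA -whL assocK whI compmI.
rewrite P1 (ra3 P2) (ra1 (esym (whR T (assoc A B X) (assocV A B X)))).
rewrite assocVK whI compIm (ra (esym (assocV_nat _ _ _))) (ra P4) -?compA.
by rewrite (ra (esym (assocV_natL _ _ _))) (ra0 (assocVK _ _ _)).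
Qed.

(** Naturality of the braiding for a coupon: in slL the strand X comes from the
    left of the coupon, in slR from its right; the digits count the strands
    below and above the coupon. *)
Lemma slL22 X A B A' B' (f : Hom (A ⊗ B) (A' ⊗ B')) T :
  b22 f (X ⊗ T) ∘ ((A ◃ cT X B T) ∘ cT X A (B ⊗ T)) =
  (A' ◃ cT X B' T) ∘ (cT X A' (B' ⊗ T) ∘ (X ◃ b22 f T)).
Proof.
rewrite -cT_tensr [RHS]compA -(cT_tensr X A' B') !b22E -?compA (ra0 (assocK _ _ _)).
by rewrite !whL (ra0 (wh0 X (assocK A' B' T))) (ra (esym (cT_natr _ _ _))).
Qed.

Lemma slL20 X A B (f : Hom (A ⊗ B) one) T :
  b20 f (X ⊗ T) ∘ ((A ◃ cT X B T) ∘ cT X A (B ⊗ T)) = X ◃ b20 f T.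
Proof.
rewrite -cT_tensr !b20E -?compA (ra0 (assocK _ _ _)) !whL.
by rewrite (ra (esym (cT_natr _ _ _))) (ra1 (cT_one_r _ _)).
Qed.

Lemma cT_oneV_r X T : cT X one T ∘ (X ◃ lunitV T) = lunitV (X ⊗ T).
Proof.
apply: (iso_mono (lunit_iso _)).
by rewrite (ra1 (cT_one_r _ _)) -whL !lunitVK whI.
Qed.

Lemma cT_oneV_l X T : cT one X T ∘ lunitV (X ⊗ T) = X ◃ lunitV T.
Proof.
apply: (iso_mono (whL_iso X (lunit_iso T))).
by rewrite (ra1 (cT_one_l _ _)) -whL !lunitVK whI.
Qed.

Lemma slL02 X A B (f : Hom one (A ⊗ B)) T :
  (A ◃ cT X B T) ∘ (cT X A (B ⊗ T) ∘ (X ◃ b02 f T)) = b02 f (X ⊗ T).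
Proof.
rewrite compA -(cT_tensr X A B) !b02E -?compA !whL (ra0 (wh0 X (assocK A B T))).
by rewrite (ra (cT_natr _ _ _)) cT_oneV_r.
Qed.

Lemma slR22 X A B A' B' (f : Hom (A ⊗ B) (A' ⊗ B')) T :
  (X ◃ b22 f T) ∘ (cT A X (B ⊗ T) ∘ (A ◃ cT B X T)) =
  cT A' X (B' ⊗ T) ∘ ((A' ◃ cT B' X T) ∘ b22 f (X ⊗ T)).
Proof.
rewrite -cT_tensl [RHS]compA -(cT_tensl X A' B') !b22E -?compA (ra0 (assocK _ _ _)).
by rewrite !whL -?compA (ra0 (wh0 X (assocK A B T))) (ra (esym (cT_natl _ _ _))).
Qed.

Lemma slR20 X A B (f : Hom (A ⊗ B) one) T :
  (X ◃ b20 f T) ∘ (cT A X (B ⊗ T) ∘ (A ◃ cT B X T)) = b20 f (X ⊗ T).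
Proof.
rewrite -cT_tensl !b20E !whL -?compA (ra0 (wh0 X (assocK A B T))).
by rewrite (ra (esym (cT_natl _ _ _))) (ra1 (cT_one_l _ _)).
Qed.

Lemma slR02 X A B (f : Hom one (A ⊗ B)) T :
  cT A X (B ⊗ T) ∘ ((A ◃ cT B X T) ∘ b02 f (X ⊗ T)) = X ◃ b02 f T.
Proof.
rewrite compA -cT_tensl !b02E !whL -?compA (ra0 (assocK _ _ _)).
by rewrite (ra (cT_natl _ _ _)) cT_oneV_l.
Qed.

End Braided.

(** * Partial traces on the left *)

Section LeftTrace.
Variables (K : fieldType) (C : monCat K).
Implicit Types A B D E T U V X Y : C.

Lemma lunitV_tail S T : lunitV (S ⊗ T) = assoc one S T ∘ (lunitV S ▹ T).
Proof.
apply: (iso_mono (lunit_iso _)).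
by rewrite lunitVK (ra1 (lunit_assoc _ _)) -whR lunitVK whI.
Qed.

Lemma runitV_tail A T : runitV A ▹ T = assocV A one T ∘ (A ◃ lunitV T).
Proof.
apply: (iso_mono (whR_iso T (runit_iso A))).
rewrite -whR runitVK -triangle -?compA (ra0 (assocVK _ _ _)).
by rewrite -whL lunitVK !whI.
Qed.

(** The pentagon, solved for the composites that arise when a diagram with a tail
    is itself put in front of a tail. *)
Lemma pentagonA A B D E :
  assocV A B (D ⊗ E) ∘ (A ◃ assoc B D E) =
  assoc (A ⊗ B) D E ∘ ((assocV A B D ▹ E) ∘ assocV A (B ⊗ D) E).
Proof.
apply: (iso_mono (assocV_iso (A ⊗ B) D E)).
by rewrite (ra0 (assocK _ _ _)) compA pentagonV -?compA -whL assocK whI compmI.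
Qed.

Lemma pentagonB A B D E :
  (A ◃ assocV B D E) ∘ (assoc A B (D ⊗ E) ∘ assoc (A ⊗ B) D E) =
  assoc A (B ⊗ D) E ∘ (assoc A B D ▹ E).
Proof.
by rewrite pentagon -?compA (ra1 (esym (whL _ _ _))) assocK whI compIm.
Qed.

Lemma pentagonC A B D E :
  (assoc A B D ▹ E) ∘ assocV (A ⊗ B) D E =
  assocV A (B ⊗ D) E ∘ ((A ◃ assocV B D E) ∘ assoc A B (D ⊗ E)).
Proof.
apply: (iso_mono (assoc_iso A (B ⊗ D) E)).
rewrite (ra0 (assocVK _ _ _)).
apply: (iso_epi (assoc_iso (A ⊗ B) D E)).
by rewrite -?compA assocK compmI pentagonB.
Qed.

Lemma pentagonD A B D E :
  assoc (A ⊗ B) D E ∘ (assocV A B D ▹ E) =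
  assocV A B (D ⊗ E) ∘ ((A ◃ assoc B D E) ∘ assoc A (B ⊗ D) E).
Proof.
apply: (iso_mono (assoc_iso A B (D ⊗ E))).
rewrite (ra0 (assocVK _ _ _)) compA pentagon -?compA -whR assocVK.
by rewrite whI compmI.
Qed.

Lemma b02_tail A B S (f : Hom one (A ⊗ B)) T :
  (A ◃ assocV B S T) ∘ b02 f (S ⊗ T) = assoc A (B ⊗ S) T ∘ (b02 f S ▹ T).
Proof.
rewrite !b02E !whR.
by rewrite lunitV_tail (ra (esym (assoc_natL _ _ _))) (ra3 (pentagonB _ _ _ _)).
Qed.

Lemma b20_tail A B S (f : Hom (A ⊗ B) one) T :
  b20 f (S ⊗ T) ∘ (A ◃ assoc B S T) = (b20 f S ▹ T) ∘ assocV A (B ⊗ S) T.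
Proof.
rewrite !b20E !whR -?compA pentagonA (ra (esym (assoc_natL _ _ _))).
by rewrite (ra1 (lunit_assoc _ _)).
Qed.

(** Left partial trace. The closing maps are arbitrary, because the closures
    along the two dualities of an object are both needed. *)
Definition trL A B X (e : Hom (A ⊗ B) one) (c : Hom one (A ⊗ B))
  (g : Hom (B ⊗ X) (B ⊗ X)) : Hom X X := b20 e X ∘ ((A ◃ g) ∘ b02 c X).

Lemma trL_compl A B X (e : Hom (A ⊗ B) one) (c : Hom one (A ⊗ B))
    (f : Hom X X) g : trL e c ((B ◃ f) ∘ g) = f ∘ trL e c g.
Proof. by rewrite /trL whL -?compA (ra (b20_nat _ _)). Qed.

Lemma trL_compr A B X (e : Hom (A ⊗ B) one) (c : Hom one (A ⊗ B))
    (f : Hom X X) g : trL e c (g ∘ (B ◃ f)) = trL e c g ∘ f.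
Proof. by rewrite /trL whL -?compA b02_nat. Qed.

Lemma trL_id A B X (e : Hom (A ⊗ B) one) (c : Hom one (A ⊗ B)) a :
  e ∘ c = a *: idm one -> trL e c (idm (B ⊗ X)) = a *: idm X.
Proof.
move=> ec; rewrite /trL whI compIm b20E b02E -?compA (ra0 (assocK _ _ _)).
by rewrite (ra1 (esym (whR _ _ _))) ec tensZl whI compZl compIm compZr lunitVK.
Qed.

Lemma trL_tail A B X (e : Hom (A ⊗ B) one) (c : Hom one (A ⊗ B)) g T :
  trL e c g ▹ T = b20 e (X ⊗ T) ∘ ((A ◃ b22 g T) ∘ b02 c (X ⊗ T)).
Proof.
rewrite /trL !whR [b22 g T]b22E !whL -?compA b02_tail (ra (b20_tail _ _ _)).
by rewrite (ra (esym (assoc_nat _ _ _))) (ra0 (assocK _ _ _)).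
Qed.

End LeftTrace.

(** * Duality in a ribbon category *)

Section RibbonCalculus.
Variables (K : fieldType) (C : ribbonCat K).
Implicit Types A B D E T U V X Y : C.

Lemma snakeL V T : (V ◃ b20 (evr V) T) ∘ b02 (coevr V) (V ⊗ T) = idm (V ⊗ T).
Proof.
rewrite !b02E !b20E lunitV_tail (ra (esym (assoc_natL _ _ _))) !whL -?compA.
rewrite (ra3 (pentagonB _ _ _ _)) (ra (esym (assoc_nat _ _ _))).
rewrite (ra1 (triangle _ _)) -whI -!whR.
by have := zigzagl V; rewrite -?compA => ->.
Qed.

Lemma snakeR V T :
  b20 (evr V) (dual V ⊗ T) ∘ (dual V ◃ b02 (coevr V) T) = idm (dual V ⊗ T).
Proof.
rewrite !b02E !b20E !whL -?compA (ra (pentagonA _ _ _ _)) -?compA.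
rewrite (ra (assocV_nat _ _ _)) -runitV_tail (ra (esym (assoc_natL _ _ _))).
rewrite (ra1 (lunit_assoc _ _)) -!whR -whI.
by have := zigzagr V; rewrite -?compA => ->.
Qed.

Lemma ptr_tail U V (f : Hom (U ⊗ V) (U ⊗ V)) T :
  ptr f ▹ T =
  (U ◃ b20 (evl V) T) ∘ (b22 f (dual V ⊗ T) ∘ (U ◃ b02 (coevr V) T)).
Proof.
rewrite !b20E !b02E !b22E /ptr; move: (evl V) => ev; rewrite !whR !whL -?compA.
rewrite runitV_tail (ra (esym (assocV_nat _ _ _))) (ra (pentagonA _ _ _ _)) -?compA.
rewrite (ra (esym (assoc_natL _ _ _))) (ra3 (pentagonB _ _ _ _)).
by rewrite (ra (esym (assoc_nat _ _ _))) (ra1 (triangle _ _)).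
Qed.

Definition twistV V : Hom V V := sval (cid (twist_iso V)).

Lemma twistK V : twistV V ∘ twist V = idm V.
Proof. by case: (svalP (cid (twist_iso V))). Qed.

Lemma twistVK V : twist V ∘ twistV V = idm V.
Proof. by case: (svalP (cid (twist_iso V))). Qed.

Lemma braid_one_one : braid one one = idm (one ⊗ one : C).
Proof.
apply: (iso_mono (lunit_iso _)).
by rewrite braid_one_r compmI lunit_one.
Qed.

Lemma twist_one : twist (one : C) = idm one.
Proof.
apply: (iso_mono (twist_iso one)); apply: (iso_epi (lunit_iso one)).
have E : lunit one ∘ (twist one ⊠ twist one) = twist one ∘ lunit (one : C).
  by rewrite twist_nat twist_tens braid_one_one !compIm.
rewrite compmI -E tensmE' (ra (lunit_nat _)) lunit_one -?compA runit_nat.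
by rewrite !compA.
Qed.

Lemma evlT V T : b20 (evl V) T =
  b20 (evr V) T ∘ (cT V (dual V) T ∘ (twist V ▹ (dual V ⊗ T))).
Proof.
by rewrite /evl !b20_comp cTE b22_whR -?compA.
Qed.

Lemma coevlT V T : b02 (coevl V) T =
  (dual V ◃ (twist V ▹ T)) ∘ (cT V (dual V) T ∘ b02 (coevr V) T).
Proof.
by rewrite /coevl -?compA !b02_comp cTE b22_whL.
Qed.

(** The full curl on a coevaluation: since the twist of the unit is trivial, the
    double braiding undoes the two twists. *)
Lemma coevr_curl V : braid (dual V) V ∘ (braid V (dual V) ∘
  (((twist V ∘ twist V) ▹ dual V) ∘ coevr V)) = coevr V.
Proof.
have := twist_nat (coevr V).
rewrite twist_one compmI twist_tens tensmE -?compA -twist_dual => E.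
by rewrite whR -?compA.
Qed.

Lemma coevr_curlT V T : cT V (dual V) T ∘
  (((twist V ∘ twist V) ▹ (dual V ⊗ T)) ∘ b02 (coevr V) T) =
  cV (dual V) V T ∘ b02 (coevr V) T.
Proof.
rewrite -{2}coevr_curl !b02_comp -cTE (ra0 (cTK _ _ _)).
by rewrite b22_whR cTE.
Qed.

(** The maps evl and coevl each contain a crossing and a twist. The two twists
    cancel against two crossings by coevr_curl, and sliding what remains leads
    back to the snake identity of evr and coevr. *)
Lemma snakelR V T :
  (dual V ◃ b20 (evl V) T) ∘ b02 (coevl V) (dual V ⊗ T) = idm (dual V ⊗ T).
Proof.
rewrite evlT coevlT !whL -?compA.
rewrite (ra1 (wh1 (dual V) (esym (whR (dual V ⊗ T) (twist V) (twist V))))).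
rewrite (ra (esym (cT_natl _ _ _))) coevr_curlT.
have E1 : dual V ◃ b20 (evr V) T = b20 (evr V) (dual V ⊗ T) ∘
    ((dual V ◃ cT (dual V) V T) ∘ cT (dual V) (dual V) (V ⊗ T)).
  by rewrite slL20.
have E2 := slL22 (dual V) (braid V (dual V)) T; rewrite -!cTE in E2.
rewrite E1 -?compA (ra3 (esym E2)) -?compA (ra0 (cVK _ _ _)).
have E3 : (V ◃ cT (dual V) (dual V) T) ∘ b02 (coevr V) (dual V ⊗ T) =
    cV V (dual V) (dual V ⊗ T) ∘ (dual V ◃ b02 (coevr V) T).
  by rewrite -(slR02 (dual V) (coevr V)) (ra0 (cTK _ _ _)).
by rewrite E3 (ra0 (cVK _ _ _)) snakeR.
Qed.

(** The diagram M is the composite without its twists. It is a curl on the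
    strand V; after the duality strands have been slid off each other it undoes
    two twists. *)
Lemma snakelL V T :
  b20 (evl V) (V ⊗ T) ∘ (V ◃ b02 (coevl V) T) = idm (V ⊗ T).
Proof.
pose M := b20 (evr V) (V ⊗ T) ∘ (cT V (dual V) (V ⊗ T) ∘
  ((V ◃ cT V (dual V) T) ∘ (V ◃ b02 (coevr V) T))).
have EM : M = (V ◃ b20 (evr V) T) ∘ (cT (dual V) V (V ⊗ T) ∘
    (cT V (dual V) (V ⊗ T) ∘ b02 (coevr V) (V ⊗ T))).
  have E1 : V ◃ b02 (coevr V) T = cV V V (dual V ⊗ T) ∘
      ((V ◃ cV V (dual V) T) ∘ b02 (coevr V) (V ⊗ T)).
    by rewrite -slL02 (ra0 (wh0 V (cTK _ _ _))) (ra0 (cTK _ _ _)).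
  have E2 := slR22 (dual V) (braidV V V) T; rewrite -!cVE in E2.
  have E3 : b20 (evr V) (V ⊗ T) ∘ (dual V ◃ cV V V T) =
      (V ◃ b20 (evr V) T) ∘ cT (dual V) V (V ⊗ T).
    by rewrite -slR20 -?compA (wh0 (dual V) (cVK _ _ _)) compmI.
  rewrite /M E1 (ra3 (esym E2)) -?compA (ra E3) -?compA.
  by rewrite (ra0 (wh0 V (cVK _ _ _))).
have tM : (twist V ▹ T) ∘ ((twist V ▹ T) ∘ M) = idm (V ⊗ T).
  rewrite (ra1 (esym (whR _ _ _))) EM (ra (xch _ _)) (ra (esym (cT_natr _ _ _))).
  rewrite (ra (esym (cT_natl _ _ _))) coevr_curlT (ra0 (cVK _ _ _)).
  exact: snakeL.
rewrite evlT coevlT !whL -?compA.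
rewrite (ra (xch _ _)) (ra (xch _ _)) xch (ra (cT_nat _ _ _)) (ra (b20_nat _ _)).
have -> : b20 (evr V) (V ⊗ T) ∘ (cT V (dual V) (V ⊗ T) ∘
  ((V ◃ cT V (dual V) T) ∘ ((V ◃ b02 (coevr V) T) ∘ (twist V ▹ T)))) =
  M ∘ (twist V ▹ T) by rewrite /M -?compA.
apply: (iso_mono (whR_iso T (twist_iso V))).
by rewrite compmI [X in _ ∘ X = _]compA compA tM compIm.
Qed.

(** The strand U closed on the left of V is pulled across V to its right; this
    conjugates g by a braiding, and the curl that appears is a twist. *)
Lemma trL_ptr U V (g : Hom (U ⊗ V) (U ⊗ V)) :
  trL (evr U) (coevl U) g =
  ptr ((V ◃ twistV U) ∘ (braidV V U ∘ (g ∘ (braid V U ∘ (V ◃ twist U))))).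
Proof.
apply: whR1_inj; move: one => T; rewrite trL_tail ptr_tail.
have E1 : dual U ◃ b22 g T = cT U (dual U) (V ⊗ T) ∘ ((U ◃ cT V (dual U) T) ∘
    (b22 g (dual U ⊗ T) ∘ ((U ◃ cV V (dual U) T) ∘ cV U (dual U) (V ⊗ T)))).
  rewrite -(ra33 (slR22 (dual U) g T)).
  by rewrite (ra0 (wh0 U (cVK _ _ _))) cVK compmI.
have R : (U ◃ cV V (dual U) T) ∘ (cV U (dual U) (V ⊗ T) ∘ b02 (coevl U) (V ⊗ T))
    = cT V U (dual U ⊗ T) ∘ ((V ◃ (twist U ▹ (dual U ⊗ T))) ∘
       (V ◃ b02 (coevr U) T)).
  rewrite coevlT (ra (cV_natl _ _ _)) (ra0 (cTK _ _ _)) (ra (esym (xch _ _))).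
  rewrite -(slL02 V (coevr U)) (ra0 (wh0 U (cTK _ _ _))).
  by rewrite (ra (cT_natr _ _ _)).
have L : b20 (evr U) (V ⊗ T) ∘ (cT U (dual U) (V ⊗ T) ∘ (U ◃ cT V (dual U) T)) =
    (V ◃ b20 (evl U) T) ∘ ((V ◃ (twistV U ▹ (dual U ⊗ T))) ∘
      cV V U (dual U ⊗ T)).
  have e : b20 (evr U) (V ⊗ T) ∘ cT U (dual U) (V ⊗ T) =
      b20 (evl U) (V ⊗ T) ∘ (twistV U ▹ (dual U ⊗ (V ⊗ T))).
    by rewrite evlT -?compA -whR twistVK whI compmI.
  rewrite (ra e) xch -cV_natr -slL20 -?compA.
  by rewrite (ra0 (cVK _ _ _)).
by rewrite E1 -?compA (ra3 L) R !b22_comp !b22_whL -cTE -cVE -?compA.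
Qed.

End RibbonCalculus.

(** * Bending strands *)

Section Adjunction.
Variables (K : fieldType) (C : monCat K) (V W : C).
Variables (e : Hom (W ⊗ V) one) (c : Hom one (V ⊗ W)).
Hypothesis snake1 : forall T,
  (V ◃ b20 e T) ∘ b02 c (V ⊗ T) = idm (V ⊗ T).
Hypothesis snake2 : forall T,
  b20 e (W ⊗ T) ∘ (W ◃ b02 c T) = idm (W ⊗ T).
Implicit Types A B D T : C.

(** Transposition along a duality between V and W. The duality is a parameter
    because each object has two of them, (evr, coevr) and (evl, coevl). *)
Definition curry A B (f : Hom (A ⊗ V) B) : Hom A (B ⊗ W) :=
  b21 f W ∘ ((A ◃ c) ∘ runitV A).

Definition uncurry A B (g : Hom A (B ⊗ W)) : Hom (A ⊗ V) B :=
  runit B ∘ ((B ◃ e) ∘ b12 g V).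

Lemma curryT A B (f : Hom (A ⊗ V) B) T :
  b12 (curry f) T = b21 f (W ⊗ T) ∘ (A ◃ b02 c T).
Proof.
rewrite /curry b12E !b21E b02E !whR !whL -?compA.
rewrite runitV_tail (ra (esym (assocV_nat _ _ _))) (ra (pentagonA _ _ _ _)) -?compA.
by rewrite (ra (assoc_natL _ _ _)).
Qed.

Lemma uncurryT A B (g : Hom A (B ⊗ W)) T :
  b21 (uncurry g) T = (B ◃ b20 e T) ∘ b12 g (V ⊗ T).
Proof.
rewrite /uncurry !b12E b21E b20E !whR !whL -?compA.
have h : (g ▹ V ▹ T) ∘ assocV A V T = assocV (B ⊗ W) V T ∘ (g ▹ (V ⊗ T)).
  by rewrite assocV_natL.
have p : (assoc B W V ▹ T) ∘ assocV (B ⊗ W) V T =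
    assocV B (W ⊗ V) T ∘ ((B ◃ assocV W V T) ∘ assoc B W (V ⊗ T)).
  apply: (iso_mono (assoc_iso B (W ⊗ V) T)).
  rewrite (ra0 (assocVK _ _ _)); apply: (iso_epi (assoc_iso (B ⊗ W) V T)).
  by rewrite -?compA assocK compmI pentagonB.
rewrite h (ra p) -?compA (ra (esym (assocV_nat _ _ _))).
by rewrite -triangle -?compA (ra0 (assocVK _ _ _)).
Qed.

Lemma curryK A B (f : Hom (A ⊗ V) B) : uncurry (curry f) = f.
Proof.
apply: b21_inj; rewrite uncurryT curryT (ra (esym (b21_nat _ _))).
by rewrite (wh0 A (snake1 _)) compmI.
Qed.

Lemma uncurryK A B (g : Hom A (B ⊗ W)) : curry (uncurry g) = g.
Proof.
apply: b12_inj; rewrite curryT uncurryT -?compA b12_nat.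
by rewrite (ra0 (wh0 B (snake2 _))).
Qed.

Lemma curry_natr A A' B (f : Hom (A ⊗ V) B) (p : Hom A' A) :
  curry (f ∘ (p ▹ V)) = curry f ∘ p.
Proof.
rewrite /curry !b21E whR -?compA runitV_nat (ra (esym (xch _ _))).
by rewrite (ra (assocV_natL _ _ _)).
Qed.

Lemma uncurry_natl A B B' (g : Hom A (B ⊗ W)) (p : Hom B B') :
  uncurry ((p ▹ W) ∘ g) = p ∘ uncurry g.
Proof.
rewrite /uncurry !b12E whR -?compA (ra (esym (runit_nat _))).
by rewrite (ra (xch _ _)) (ra (assoc_natL _ _ _)).
Qed.

Lemma curry_inj A B (f f' : Hom (A ⊗ V) B) : curry f = curry f' -> f = f'.
Proof. by move=> h; rewrite -[f]curryK h curryK. Qed.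

Lemma uncurry_inj A B (g g' : Hom A (B ⊗ W)) : uncurry g = uncurry g' -> g = g'.
Proof. by move=> h; rewrite -[g]uncurryK h uncurryK. Qed.

Lemma curry0 A B : curry (0 : Hom (A ⊗ V) B) = 0.
Proof. by rewrite /curry b21E tens0l !comp0l. Qed.

Lemma uncurry0 A B : uncurry (0 : Hom A (B ⊗ W)) = 0.
Proof. by rewrite /uncurry b12E tens0l !comp0r. Qed.

Lemma curryZ A B a (f : Hom (A ⊗ V) B) : curry (a *: f) = a *: curry f.
Proof. by rewrite /curry !b21E tensZl !compZl. Qed.

Lemma curry_sum A B (I : Type) (r : seq I) (P : pred I) (F : I -> Hom (A ⊗ V) B) :
  curry (\sum_(i <- r | P i) F i) = \sum_(i <- r | P i) curry (F i).
Proof.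
rewrite /curry b21E tens_suml !comp_suml.
by apply: eq_bigr => i _; rewrite b21E.
Qed.

Lemma whR_epi A B (p : Hom A B) : is_epi p -> is_epi (p ▹ V).
Proof.
move=> ep T u v h; apply: curry_inj; apply: ep.
by rewrite -!curry_natr h.
Qed.

Lemma whR_mono A B (p : Hom A B) : is_mono p -> is_mono (p ▹ W).
Proof.
move=> mp T u v h; apply: uncurry_inj; apply: mp.
by rewrite -!uncurry_natl h.
Qed.

End Adjunction.

(** * Partial traces and encircling *)

Section PartialTrace.
Variables (K : fieldType) (C : ribbonCat K).
Implicit Types A B D E T U V X Y Z : C.

Lemma ptr_natural U U' V (f : Hom U U') (g : Hom (U ⊗ V) (U ⊗ V))
    (g' : Hom (U' ⊗ V) (U' ⊗ V)) :
  (f ▹ V) ∘ g = g' ∘ (f ▹ V) -> f ∘ ptr g = ptr g' ∘ f.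
Proof.
move=> h; apply: whR1_inj.
rewrite (whR _ f (ptr g)) (whR _ (ptr g') f) !ptr_tail; move: one => T.
rewrite (ra (xch _ _)) -?compA -xch -[f ▹ (V ⊗ (dual V ⊗ T))]b22_whR.
by rewrite (ra1 (esym (b22_comp _ _ _))) h b22_comp -?compA b22_whR.
Qed.

Lemma ptr_compl U V (f : Hom U U) (g : Hom (U ⊗ V) (U ⊗ V)) :
  ptr ((f ▹ V) ∘ g) = f ∘ ptr g.
Proof.
apply: whR1_inj; rewrite (whR _ f (ptr g)) !ptr_tail b22_comp b22_whR.
by move: one => T; rewrite (ra (xch _ _)) -?compA.
Qed.

Lemma ptr_compr U V (f : Hom U U) (g : Hom (U ⊗ V) (U ⊗ V)) :
  ptr (g ∘ (f ▹ V)) = ptr g ∘ f.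
Proof.
apply: whR1_inj; rewrite (whR _ (ptr g) f) !ptr_tail b22_comp b22_whR.
by move: one => T; rewrite -?compA xch.
Qed.

(** The coupon of Z ◃ f, in which Z ⊗ U counts as one strand. *)
Lemma b22_assoc Z U V (f : Hom (U ⊗ V) (U ⊗ V)) T :
  assoc Z U (V ⊗ T) ∘ b22 (assocV Z U V ∘ ((Z ◃ f) ∘ assoc Z U V)) T =
  (Z ◃ b22 f T) ∘ assoc Z U (V ⊗ T).
Proof.
have p : assoc Z U (V ⊗ T) ∘ (assoc (Z ⊗ U) V T ∘ (assocV Z U V ▹ T)) =
    (Z ◃ assoc U V T) ∘ assoc Z (U ⊗ V) T.
  by rewrite compA pentagon -?compA -whR assocVK whI compmI.
rewrite !b22E !whR !whL -?compA (ra3 p) (ra (assoc_nat _ _ _)).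
by rewrite (ra (esym (pentagonB _ _ _ _))) -?compA assocVK compmI.
Qed.

Lemma ptr_whL Z U V (f : Hom (U ⊗ V) (U ⊗ V)) :
  ptr (assocV Z U V ∘ ((Z ◃ f) ∘ assoc Z U V)) = Z ◃ ptr f.
Proof.
apply: whR1_inj; move: one => T.
apply: (iso_mono (assoc_iso Z U T)).
rewrite (assoc_nat (idm Z) (ptr f) (idm T)) !ptr_tail !whL.
rewrite (ra (assoc_natR _ _ _)) (ra (b22_assoc _ _ _)) -?compA.
by rewrite assoc_natR.
Qed.

Lemma evl_curl V :
  evl V ∘ (braid (dual V) V ∘ (twist (dual V) ▹ V)) = evr V.
Proof.
rewrite /evl -?compA (ra (esym (braid_nat _ _))).
have := twist_nat (evr V); rewrite twist_one compIm twist_tens => h.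
by rewrite [in RHS]h (tensmE' (twist (dual V)) (twist V)) -?compA.
Qed.

(** The pivotal isomorphism from V to its bidual, in front of a tail. *)
Definition pivT V T : Hom (V ⊗ T) (dual (dual V) ⊗ T) :=
  b20 (evl V) (dual (dual V) ⊗ T) ∘ (V ◃ b02 (coevr (dual V)) T).

Lemma cT_pivT V T : cT (dual V) (dual (dual V)) T ∘ (dual V ◃ pivT V T) =
  pivT V (dual V ⊗ T) ∘ cT (dual V) V T.
Proof.
rewrite /pivT !whL -slL20 -?compA (ra (esym (b20_nat _ _))).
rewrite (cT_nat (dual V) V (b02 (coevr (dual V)) T)).
by rewrite (wh3 (slL02 (dual V) (coevr (dual V)) T)).
Qed.

Lemma evl_pivT V T :
  b20 (evl (dual V)) T ∘ (dual V ◃ pivT V T) = b20 (evr V) T.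
Proof.
rewrite evlT -?compA xch (ra (cT_pivT V T)).
have -> : b20 (evr (dual V)) T ∘ (pivT V (dual V ⊗ T) ∘ (cT (dual V) V T ∘
   (twist (dual V) ▹ (V ⊗ T)))) =
   b20 (evl V) T ∘ (cT (dual V) V T ∘ (twist (dual V) ▹ (V ⊗ T))).
  rewrite /pivT -?compA (ra (esym (b20_nat _ _))).
  by rewrite (ra0 (wh0 V (snakeL (dual V) T))).
by rewrite -(evl_curl V) (b20_comp (evl V)) b22_comp b22_whR -cTE.
Qed.

(** Closing the strand V^* leaves the pivotal map followed by an evaluation of
    V^*, which is the evaluation of V (evl_pivT), and a snake remains. *)
Lemma ptr_coevr_evl V : ptr (coevr V ∘ evl V) = idm V.
Proof.
suff H T : ptr (coevr V ∘ evl V) ▹ T = idm V ▹ T by apply: whR1_inj.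
rewrite ptr_tail b22_split0 -?compA.
have -> : b20 (evl V) (dual (dual V) ⊗ T) ∘ (V ◃ b02 (coevr (dual V)) T) =
  pivT V T by [].
rewrite b02_nat.
by rewrite (ra1 (wh1 V (evl_pivT V T))) snakeL whI.
Qed.

Fact double_braiding_key : unit. Proof. by []. Qed.
Definition cc A X : Hom (A ⊗ X) (A ⊗ X) :=
  locked_with double_braiding_key (braid X A ∘ braid A X).

Lemma ccE A X : cc A X = braid X A ∘ braid A X.
Proof. by rewrite /cc unlock. Qed.

Lemma PhiE U V : Phi U V = ptr (cc V U).
Proof. by rewrite ccE. Qed.

Lemma cc_natr A X X' (f : Hom X X') : cc A X' ∘ (A ◃ f) = (A ◃ f) ∘ cc A X.
Proof. by rewrite !ccE -?compA braid_nat (ra (braid_nat _ _)). Qed.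

Lemma cc_natl A A' X (f : Hom A A') : cc A' X ∘ (f ▹ X) = (f ▹ X) ∘ cc A X.
Proof. by rewrite !ccE -?compA braid_nat (ra (braid_nat _ _)). Qed.

Lemma Phi_nat U V V' (f : Hom V V') : f ∘ Phi U V = Phi U V' ∘ f.
Proof. by rewrite !PhiE; apply: ptr_natural; rewrite cc_natl. Qed.

Lemma cc_swap A X : braid A X ∘ cc A X = cc X A ∘ braid A X.
Proof. by rewrite !ccE -?compA. Qed.

(** The dual strand winding once around X in the negative sense is the strand V
    winding once in the positive sense. *)
Lemma trL_ccV V X :
  trL (evl V) (coevr V) (braidV (dual V) X ∘ braidV X (dual V)) = Phi V X.
Proof.
apply: whR1_inj; move: one => T; rewrite PhiE ccE trL_tail ptr_tail.
rewrite !b22_comp -!cTE -!cVE !whL -?compA.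
have e1 : (V ◃ cV X (dual V) T) ∘ b02 (coevr V) (X ⊗ T) =
    cT X V (dual V ⊗ T) ∘ (X ◃ b02 (coevr V) T).
  by rewrite -slL02 (ra0 (wh0 V (cTK _ _ _))).
have e2 : b20 (evl V) (X ⊗ T) ∘ (V ◃ cV (dual V) X T) =
    (X ◃ b20 (evl V) T) ∘ cT V X (dual V ⊗ T).
  by rewrite -slR20 -?compA (wh0 V (cVK _ _ _)) compmI.
by rewrite e1 (ra e2) -?compA.
Qed.

(** Winding around a tensor product is winding around its factors one after the
    other. *)
Lemma cc_tensl X U V :
  assoc X U V ∘ (cc (X ⊗ U) V ∘ assocV X U V) =
  (X ◃ braid V U) ∘ (b22 (cc X V) U ∘ (X ◃ braid U V)).
Proof.
rewrite !ccE b22_comp !b22E braid_tensl braid_tensr -?compA.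
by rewrite assocVK compmI (ra0 (assocVK _ _ _)) !(ra0 (assocK _ _ _)).
Qed.

Lemma cc_tensr X A B :
  assocV X A B ∘ (cc X (A ⊗ B) ∘ assoc X A B) =
  (braid A X ▹ B) ∘ (assocV A X B ∘
    ((A ◃ cc X B) ∘ (assoc A X B ∘ (braid X A ▹ B)))).
Proof.
rewrite !ccE braid_tensl braid_tensr !whL -?compA.
by rewrite assocK compmI (ra0 (assocK _ _ _)) (ra0 (assocVK _ _ _)).
Qed.

(** The arc that closes the strand U is a cup below s, which bends s, and a cap
    above io, which bends io. *)
Lemma ptr_bend A B U (io : Hom B (A ⊗ U)) (s : Hom (A ⊗ U) B) :
  ptr (io ∘ s) = uncurry (evl U) io ∘ curry (coevr U) s.
Proof.
suff H T : ptr (io ∘ s) ▹ T = (uncurry (evl U) io ∘ curry (coevr U) s) ▹ T.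
  by apply: whR1_inj.
by rewrite ptr_tail b22_split1 b11_split2 uncurryT curryT -?compA.
Qed.

Lemma ptrZ U V a (f : Hom (U ⊗ V) (U ⊗ V)) : ptr (a *: f) = a *: ptr f.
Proof.
by rewrite /ptr tensZl !(compZr, compZl).
Qed.

End PartialTrace.

(** * Strands that wind around a fixed strand *)

Section Winding.
Variables (K : fieldType) (C : ribbonCat K).
Implicit Types A B D E T U V X Y Z : C.

(** A diagram in which a strand B, born and absorbed by coupons on the left,
    makes one turn around the strand X. *)
Definition turn Y Z B (al : Hom Y (Z ⊗ B)) (be : Hom (Z ⊗ B) one) X :
    Hom (Y ⊗ X) X :=
  b20 be X ∘ ((Z ◃ cc B X) ∘ b12 al X).

Section Product.
Variables (Y1 Y2 Z1 Z2 B1 B2 : C).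
Variables (al1 : Hom Y1 (Z1 ⊗ B1)) (be1 : Hom (Z1 ⊗ B1) one).
Variables (al2 : Hom Y2 (Z2 ⊗ B2)) (be2 : Hom (Z2 ⊗ B2) one).

(** The coupons of two consecutive turns, merged: the strands B1 and B2 are both
    born before the first of them starts to turn, and cross so that the tensor
    product B1 ⊗ B2 can turn around X as a single strand. *)
Definition turn2_al Y (ga : Hom Y (Y1 ⊗ Y2)) :
    Hom Y ((Z1 ⊗ Z2) ⊗ (B1 ⊗ B2)) :=
  assocV Z1 Z2 (B1 ⊗ B2) ∘ ((Z1 ◃ cT B1 Z2 B2) ∘
    (b12 al1 (Z2 ⊗ B2) ∘ ((Y1 ◃ al2) ∘ ga))).

Definition turn2_be : Hom ((Z1 ⊗ Z2) ⊗ (B1 ⊗ B2)) one :=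
  be1 ∘ ((Z1 ◃ (b20 be2 B1 ∘ (Z2 ◃ braid B1 B2))) ∘ assoc Z1 Z2 (B1 ⊗ B2)).

Definition unpack X : Hom ((Z1 ⊗ Z2) ⊗ ((B1 ⊗ B2) ⊗ X)) (Z1 ⊗ (Z2 ⊗ (B1 ⊗ (B2 ⊗ X)))) :=
  locked_with coupon_key
    ((Z1 ◃ Z2 ◃ assoc B1 B2 X) ∘ assoc Z1 Z2 ((B1 ⊗ B2) ⊗ X)).

Lemma unpackE X : unpack X =
  (Z1 ◃ Z2 ◃ assoc B1 B2 X) ∘ assoc Z1 Z2 ((B1 ⊗ B2) ⊗ X).
Proof. by rewrite /unpack unlock. Qed.

Lemma unpack_al Y (ga : Hom Y (Y1 ⊗ Y2)) X :
  unpack X ∘ b12 (turn2_al ga) X =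
  (Z1 ◃ cT B1 Z2 (B2 ⊗ X)) ∘ (b12 al1 (Z2 ⊗ (B2 ⊗ X)) ∘
    ((Y1 ◃ b12 al2 X) ∘ b12 ga X)).
Proof.
have p : assoc Z1 Z2 ((B1 ⊗ B2) ⊗ X) ∘ (assoc (Z1 ⊗ Z2) (B1 ⊗ B2) X ∘
    (assocV Z1 Z2 (B1 ⊗ B2) ▹ X)) =
    (Z1 ◃ assoc Z2 (B1 ⊗ B2) X) ∘ assoc Z1 (Z2 ⊗ (B1 ⊗ B2)) X.
  by rewrite compA pentagon -?compA -whR assocVK whI compmI.
have e22 : (Z2 ◃ assoc B1 B2 X) ∘ (assoc Z2 (B1 ⊗ B2) X ∘ (cT B1 Z2 B2 ▹ X)) =
    cT B1 Z2 (B2 ⊗ X) ∘ ((B1 ◃ assoc Z2 B2 X) ∘ assoc B1 (Z2 ⊗ B2) X).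
  rewrite !cTE !b22E !whR -?compA.
  have q := pentagon Z2 B1 B2 X; rewrite -?compA in q.
  rewrite (ra3 (esym q)) (ra (assoc_natL _ _ _)) (ra (pentagonA _ _ _ _)) -?compA.
  by rewrite assocK compmI.
have e12 : (Z1 ◃ (B1 ◃ assoc Z2 B2 X)) ∘ ((Z1 ◃ assoc B1 (Z2 ⊗ B2) X) ∘
    (assoc Z1 (B1 ⊗ (Z2 ⊗ B2)) X ∘ (b12 al1 (Z2 ⊗ B2) ▹ X))) =
    b12 al1 (Z2 ⊗ (B2 ⊗ X)) ∘ ((Y1 ◃ assoc Z2 B2 X) ∘ assoc Y1 (Z2 ⊗ B2) X).
  rewrite (ra (b12_nat _ _)) !b12E !whR -?compA.
  have q := pentagon Z1 B1 (Z2 ⊗ B2) X; rewrite -?compA in q.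
  by rewrite (ra3 (esym q)) (assoc_natL _ _ _).
rewrite unpackE /turn2_al [b12 (assocV _ _ _ ∘ _) X]b12E.
rewrite (whR X (assocV Z1 Z2 (B1 ⊗ B2))) (whR X (Z1 ◃ cT B1 Z2 B2)).
rewrite (whR X (b12 al1 (Z2 ⊗ B2))) (whR X (Y1 ◃ al2)) -?compA (ra3 p).
rewrite (ra (assoc_nat _ _ _)) (wh3 e22) !whL -?compA (ra4 e12) -?compA.
by rewrite (ra (assoc_nat _ _ _)) [b12 al2 X]b12E whL [b12 ga X]b12E -?compA.
Qed.

Lemma unpack_be X :
  b20 turn2_be X =
  b20 be1 X ∘ ((Z1 ◃ (b20 be2 (B1 ⊗ X) ∘ (Z2 ◃ cT B1 B2 X))) ∘ unpack X).
Proof.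
rewrite /turn2_be unpackE.
have p := pentagonC Z1 Z2 (B1 ⊗ B2) X.
set h := b20 be2 B1 ∘ (Z2 ◃ braid B1 B2).
have eh : (h ▹ X) ∘ assocV Z2 (B1 ⊗ B2) X =
    b20 be2 (B1 ⊗ X) ∘ ((Z2 ◃ cT B1 B2 X) ∘ (Z2 ◃ assoc B1 B2 X)).
  rewrite /h (whR X (b20 be2 B1)) -?compA -assocV_nat (ra (esym (b20_tail _ _ _))).
  rewrite -!whL; congr (_ ∘ (_ ◃ _)).
  by rewrite !cTE b22E -?compA assocK compmI.
rewrite b20E (whR X be1) (whR X (Z1 ◃ h)) -?compA p.
rewrite (ra (esym (assocV_nat _ _ _))) (ra1 (wh1 Z1 eh)) !whL -?compA.
by rewrite [b20 be1 X]b20E -?compA.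
Qed.

(** B2 closes after its turn before B1 starts its own; delaying the closure past
    the turn of B1 makes B1 and B2 cross and turn together. *)
Lemma turn_cross X :
  cc B1 X ∘ ((B1 ◃ b20 be2 X) ∘ (B1 ◃ Z2 ◃ cc B2 X)) =
  b20 be2 (B1 ⊗ X) ∘ ((Z2 ◃ cT B1 B2 X) ∘
    ((Z2 ◃ (assoc B1 B2 X ∘ (cc (B1 ⊗ B2) X ∘ assocV B1 B2 X))) ∘
      cT B1 Z2 (B2 ⊗ X))).
Proof.
rewrite -slL20 -?compA (ra (esym (b20_nat _ _))) cT_nat.
congr (_ ∘ _); rewrite !compA; congr (_ ∘ _); rewrite -!whL; congr (_ ◃ _).
rewrite -?compA cc_tensl.
have e : cT B1 B2 X ∘ (B1 ◃ braid X B2) =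
    braid (B1 ⊗ X) B2 ∘ assocV B1 X B2.
  rewrite braid_tensl -?compA assocVK compmI.
  by rewrite cTE b22E -?compA.
rewrite (ra e) -?compA [cc B2 X]ccE whL.
rewrite [in LHS](ra e) -?compA (ra (esym (braid_nat _ _))).
by rewrite b22E -?compA (ra0 (assocK _ _ _)).
Qed.

(** Hence diagrams with a turning strand are closed under composition. *)
Lemma turn2E Y (ga : Hom Y (Y1 ⊗ Y2)) X :
  turn (turn2_al ga) turn2_be X =
  turn al1 be1 X ∘ ((Y1 ◃ turn al2 be2 X) ∘ b12 ga X).
Proof.
rewrite /turn unpack_be -?compA.
have e : unpack X ∘ ((Z1 ⊗ Z2) ◃ cc (B1 ⊗ B2) X) =
    (Z1 ◃ Z2 ◃ (assoc B1 B2 X ∘ (cc (B1 ⊗ B2) X ∘ assocV B1 B2 X))) ∘ unpack X.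
  rewrite !unpackE -?compA assoc_natR !whL -?compA.
  by rewrite (ra0 (wh0 Z1 (wh0 Z2 (assocK _ _ _)))).
rewrite (ra e) unpack_al !(whL Y1) -?compA !(ra (b12_nat _ _)).
congr (_ ∘ _); rewrite !compA; congr (_ ∘ _ ∘ _ ∘ _).
by rewrite -!whL -?compA -turn_cross.
Qed.

End Product.

Lemma turn_prec Y Y' Z B (al : Hom Y (Z ⊗ B)) (be : Hom (Z ⊗ B) one)
    (ga : Hom Y' Y) X : turn (al ∘ ga) be X = turn al be X ∘ (ga ▹ X).
Proof. by rewrite /turn b12_compr -?compA. Qed.

(** The braiding and the twist by which trL_ptr compares the two closures commute
    with the double braiding, so they cancel. *)
Lemma trL_cc V X : trL (evr V) (coevl V) (cc V X) = Phi V X.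
Proof.
rewrite trL_ptr PhiE; congr ptr.
rewrite (ra (esym (cc_swap X V))) (ra0 (braidK _ _)) cc_natr.
by rewrite (ra0 (wh0 X (twistK _))).
Qed.

Lemma turn_loop V X :
  turn (coevl V) (evr V) X ∘ lunitV X = Phi V X.
Proof. by rewrite -trL_cc /turn /trL -?compA b02E b12E -?compA. Qed.

Fixpoint cc_pow A X n : Hom (A ⊗ X) (A ⊗ X) :=
  if n is n'.+1 then cc A X ∘ cc_pow A X n' else idm _.

(** The strand V^* winds n times around X, with both of its ends on the left. *)
Definition wind V X n : Hom ((V ⊗ dual V) ⊗ X) X :=
  b20 (evl V) X ∘ ((V ◃ cc_pow (dual V) X n) ∘ assoc V (dual V) X).

Lemma wind1 V X : wind V X 1 = turn (idm (V ⊗ dual V)) (evl V) X.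
Proof. by rewrite /wind /turn /= compmI b12E whI compmI. Qed.

Definition wind_split V : Hom (V ⊗ dual V) ((V ⊗ dual V) ⊗ (V ⊗ dual V)) :=
  assocV V (dual V) (V ⊗ dual V) ∘ (V ◃ b02 (coevl V) (dual V)).

(** A cap and a cup of V inserted between two windings, by a snake identity,
    separate a strand that winds n + 1 times into one that turns once and one
    that winds n times. *)
Lemma windS V X n : wind V X n.+1 =
  turn (idm (V ⊗ dual V)) (evl V) X ∘
   (((V ⊗ dual V) ◃ wind V X n) ∘ b12 (wind_split V) X).
Proof.
have p : assoc V (dual V) ((V ⊗ dual V) ⊗ X) ∘
   (assoc (V ⊗ dual V) (V ⊗ dual V) X ∘ (assocV V (dual V) (V ⊗ dual V) ▹ X)) =
    (V ◃ assoc (dual V) (V ⊗ dual V) X) ∘ assoc V (dual V ⊗ (V ⊗ dual V)) X.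
  by rewrite compA pentagon -?compA -whR assocVK whI compmI.
have q : (dual V ◃ wind V X n) ∘ (assoc (dual V) (V ⊗ dual V) X ∘
    (b02 (coevl V) (dual V) ▹ X)) = cc_pow (dual V) X n.
  rewrite /wind !whL -?compA -b02_tail (ra0 (wh0 _ (assocVK _ _ _))).
  by rewrite -b02_nat (ra0 (snakelR _ _)).
rewrite -wind1 {1 2}/wind /= compmI -?compA (ra (assoc_natR _ _ _)) [b12 _ X]b12E.
rewrite /wind_split (whR X (assocV V (dual V) (V ⊗ dual V))) (ra3 p) -?compA.
by rewrite (assoc_nat _ _ _) (wh3 q) whL -?compA.
Qed.

End Winding.

(** * Linear algebra *)

Section LinearAlgebra.
Variable K : fieldType.

Lemma has_dim0 (V : lmodType K) : has_dim V 0 -> forall v : V, v = 0.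
Proof. by move=> [b bP] v; have [a [-> _]] := bP v; rewrite big_ord0. Qed.

Lemma has_dim1 (V : lmodType K) : has_dim V 1 ->
  exists2 b : V, b != 0 & forall v : V, exists a : K, v = a *: b.
Proof.
move=> [b bP]; exists (b ord0).
  apply/eqP => b0; have [a [_ ua]] := bP 0.
  have h (c : 'rV[K]_1) : 0 = \sum_i c 0 i *: b i by rewrite big_ord1 b0 scaler0.
  have e1 := ua (const_mx 1) (h _); have e0 := ua (const_mx 0) (h _).
  have /matrixP /(_ 0 0) : const_mx 1 = const_mx 0 :> 'rV[K]_1 by rewrite -e1 -e0.
  by rewrite !mxE => /eqP; rewrite oner_eq0.
by move=> v; have [a [-> _]] := bP v; exists (a 0 ord0); rewrite big_ord1.
Qed.

(** The subspace is only given as a predicate, so a matrix of maximal rank with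
    rows in it is chosen first; the form comes from the cokernel of this matrix. *)
Lemma separation n (L : 'rV[K]_n -> Prop) (v : 'rV[K]_n) :
  (forall a u w, L u -> L w -> L (a *: u + w)) -> L 0 -> ~ L v ->
  exists u : 'cV[K]_n, (forall w, L w -> w *m u = 0) /\ v *m u <> 0.
Proof.
move=> Ll L0 Lv.
pose P r := exists M : 'M[K]_n,
  (forall w : 'rV_n, (w <= M)%MS -> L w) /\ \rank M = r.
have exP : exists r, `[< P r >].
  exists 0; apply/asboolP; exists 0; rewrite mxrank0; split=> // w.
  by rewrite submx0 => /eqP ->.
have leP r : `[< P r >] -> (r <= n)%N.
  by move=> /asboolP [M [_ <-]]; exact: rank_leq_row.
case: (ex_maxnP exP leP) => r /asboolP [M [ML rM]] rmax.
have LM w : L w -> (w <= M)%MS.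
  move=> Lw; apply/negPn/negP => wM.
  have /rmax : `[< P (\rank (M + w)%MS) >].
    apply/asboolP; exists (M + w)%MS; split=> // u /sub_addsmxP [[u1 u2] /= ->].
    rewrite addrC [u2]mx11_scalar mul_scalar_mx; apply: Ll => //.
    by apply: ML; rewrite submxMl.
  rewrite -rM leqNgt => /negP; apply.
  have := ltmxErank M (M + w)%MS; rewrite /ltmx addsmxSl /= => <-.
  by apply: contra wM; apply: submx_trans; rewrite addsmxSr.
have vM : ~~ (v <= M)%MS by apply/negP => /ML.
rewrite submxE in vM; have /matrix0Pn [i [j ij]] := vM.
exists (cokermx M *m delta_mx j 0); split.
  by move=> w /LM; rewrite submxE mulmxA => /eqP ->; rewrite mul0mx.
rewrite mulmxA -colE => /matrixP /(_ i 0); rewrite [LHS]mxE [RHS]mxE => e.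
by move: ij; rewrite e eqxx.
Qed.

End LinearAlgebra.

(** * Projective objects *)

Section Projectives.
Variables (K : fieldType) (C : ribbonCat K).
Implicit Types A B P U V : C.

Lemma proj_retract P P' (s : Hom P' P) (r : Hom P P') :
  r ∘ s = idm P' -> is_projective P -> is_projective P'.
Proof.
move=> rs pP A B p f ep; have [g pg] := pP _ _ p (f ∘ r) ep.
by exists (g ∘ s); rewrite compA pg -compA rs compmI.
Qed.

Lemma proj_iso P P' (s : Hom P' P) : is_iso s -> is_projective P -> is_projective P'.
Proof. by move=> [r [rs _]]; apply: proj_retract rs. Qed.

Lemma whR_epiR A B U (p : Hom A B) : is_epi p -> is_epi (p ▹ U).
Proof. exact: (whR_epi (@snakeL _ _ U)). Qed.

Lemma whR_monoR A B U (p : Hom A B) : is_mono p -> is_mono (p ▹ U).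
Proof. exact: (whR_mono (@snakelL _ _ U)). Qed.

Lemma braidV_iso A B : is_iso (braidV A B).
Proof. by exists (braid A B); rewrite braidK braidVK. Qed.

Lemma whL_braid A B U (p : Hom A B) : U ◃ p = braid B U ∘ ((p ▹ U) ∘ braidV A U).
Proof. by rewrite (ra (braid_nat _ _)) braidVK compmI. Qed.

Lemma whL_epiR A B U (p : Hom A B) : is_epi p -> is_epi (U ◃ p).
Proof.
move=> ep; rewrite whL_braid.
apply: (epi_comp (iso_epi (braid_iso B U))).
exact: (epi_comp (@whR_epiR _ _ U _ ep) (iso_epi (braidV_iso A U))).
Qed.

Lemma whL_monoR A B U (p : Hom A B) : is_mono p -> is_mono (U ◃ p).
Proof.
move=> ep; rewrite whL_braid.
apply: (mono_comp (iso_mono (braid_iso B U))).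
exact: (mono_comp (@whR_monoR _ _ U _ ep) (iso_mono (braidV_iso A U))).
Qed.

Lemma proj_tensR P V : is_projective P -> is_projective (P ⊗ V).
Proof.
move=> pP A B p f ep.
have [g pg] := pP _ _ _ (curry (coevr V) f) (@whR_epiR _ _ (dual V) _ ep).
exists (uncurry (evr V) g).
by rewrite -uncurry_natl pg (curryK (@snakeL _ _ V)).
Qed.

Lemma proj_tensL P V : is_projective P -> is_projective (V ⊗ P).
Proof. by move=> pP; exact: proj_iso (braid_iso V P) (@proj_tensR P V pP). Qed.

Lemma evl_epi V : is_regular V -> is_epi (evl V).
Proof.
move=> rV; rewrite /evl.
apply: epi_comp (iso_epi (whR_iso (dual V) (twist_iso V))).
exact: epi_comp rV (iso_epi (braid_iso _ _)).
Qed.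

(** Tensoring with a regular object and its dual covers every object. *)
Definition cover V U : Hom (V ⊗ (dual V ⊗ U)) U := b20 (evl V) U.

Lemma cover_epi V U : is_regular V -> is_epi (cover V U).
Proof.
move=> rV; rewrite /cover b20E; apply: (epi_comp (iso_epi (lunit_iso _))).
exact: (epi_comp (@whR_epiR _ _ U _ (evl_epi rV)) (iso_epi (assocV_iso _ _ _))).
Qed.

End Projectives.

(** * Generic semisimplicity *)

Section Semisimple.
Variables (K : fieldType) (G Z : zmodType) (X : set G).
Variable C : premodular K Z X.
Implicit Types A B P U V : C.

Let deg := @pm_deg K G Z X C.
Let grad := pm_grading C.

(** The shift is on the left, so that tensoring with sigma on the left, which
    leaves all other strands in place, only changes the shift. *)
Definition simpleW (g : G) (x : pm_I C g * Z) : C := sigma C x.2 ⊗ pm_V x.1.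

Lemma simpleW_iso g (x : pm_I C g * Z) :
  exists (f : Hom (simpleW x) (pm_V x.1 ⊗ sigma C x.2))
         (f' : Hom (pm_V x.1 ⊗ sigma C x.2) (simpleW x)),
    f' ∘ f = idm _ /\ f ∘ f' = idm _.
Proof.
by exists (braid _ _), (braidV _ _); rewrite braidK braidVK.
Qed.

Lemma deg_simpleW g (x : pm_I C g * Z) : ~ X g -> deg g (simpleW x).
Proof.
move=> Xg.
by have := grading_tens grad (sigma_deg C x.2) (pm_V_deg x.1 Xg); rewrite add0r.
Qed.

Lemma simpleW_hom0 g (x y : pm_I C g * Z) (f : Hom (simpleW x) (simpleW y)) :
  ~ X g -> x != y -> f = 0.
Proof.
move=> Xg xy; have := pm_reduced Xg x y; rewrite (negbTE xy) => /has_dim0 h.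
have [u [u' [u'u _]]] := simpleW_iso x; have [v [v' [v'v _]]] := simpleW_iso y.
have -> : f = v' ∘ ((v ∘ (f ∘ u')) ∘ u).
  by rewrite -?compA u'u compmI (ra0 v'v).
by rewrite [v ∘ _]h comp0l comp0r.
Qed.

Lemma simpleW_neq0 g (x : pm_I C g * Z) : ~ X g -> idm (simpleW x) <> 0.
Proof.
move=> Xg i0; have := pm_reduced Xg x x; rewrite eqxx => /has_dim1 [b b0 _].
have [u [u' [u'u uu']]] := simpleW_iso x; move/eqP: b0; apply.
by rewrite -[b]compIm -uu' -[u]compmI i0 comp0r !comp0l.
Qed.

Lemma simpleW_end g (x : pm_I C g * Z) (f : Hom (simpleW x) (simpleW x)) :
  ~ X g -> exists a : K, f = a *: idm _.
Proof.
move=> Xg; have := pm_reduced Xg x x; rewrite eqxx => /has_dim1 [b b0 bP].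
have [u [u' [u'u uu']]] := simpleW_iso x.
have [c ec] := bP (idm _); have [a ea] := bP (u ∘ (f ∘ u')).
have c0 : c != 0.
  apply/eqP => c0; move/eqP: b0; apply.
  by rewrite -[b]compIm ec c0 scale0r comp0l.
exists (a / c).
have -> : f = u' ∘ ((u ∘ (f ∘ u')) ∘ u).
  by rewrite -?compA u'u compmI (ra0 u'u).
have eb : b = c^-1 *: idm _ by rewrite ec scalerA mulVf ?scale1r.
by rewrite ea eb scalerA compZl compIm compZr u'u.
Qed.

Lemma simpleW_dom g A : ~ X g -> deg g A ->
  exists (n : nat) (x : 'I_n -> pm_I C g * Z)
    (s : forall k, Hom A (simpleW (x k))) (i : forall k, Hom (simpleW (x k)) A),
    idm A = \sum_(k < n) (i k ∘ s k).
Proof.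
move=> Xg dA; have [n [x [s [i e]]]] := (pm_dominating C Xg).2 A dA.
exists n, x, (fun k => braidV _ _ ∘ s k), (fun k => i k ∘ braid _ _).
rewrite e; apply: eq_bigr => k _.
by rewrite -compA (ra0 (braidVK _ _)).
Qed.

(** A general object is a finite sum of homogeneous ones, so the piece of
    degree g of its identity is spanned by maps through the simple objects. *)
Lemma degree_piece g A : ~ X g ->
  exists (n : nat) (x : 'I_n -> pm_I C g * Z)
    (s : forall k, Hom A (simpleW (x k))) (i : forall k, Hom (simpleW (x k)) A),
    (forall B (f : Hom B A), deg g B -> f = \sum_(k < n) (i k ∘ (s k ∘ f))) /\
    (forall B (f : Hom A B), deg g B -> f = \sum_(k < n) ((f ∘ i k) ∘ s k)).
Proof.
move=> Xg; have [m [gs [Ws [ginj dW [i [p [pi pi0 ip]]]]]]] := grading_decomp grad A.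
have [[a ga]|nog] := pselect (exists a, gs a = g); last first.
  have e0 (k : 'I_0) : False by case: k.
  exists 0, (fun k => False_rect _ (e0 k)), (fun k => False_rect _ (e0 k)).
  exists (fun k => False_rect _ (e0 k)).
  split=> B f dB; rewrite big_ord0.
    rewrite -[f]compIm -ip comp_suml big1 // => a _; rewrite -compA.
    have [->|/eqP h] := eqVneq (p a ∘ f) 0; first by rewrite comp0r.
    by case: nog; exists a; apply/esym/(grading_hom grad dB (dW a)); exists (p a ∘ f).
  rewrite -[f]compmI -ip comp_sumr big1 // => a _; rewrite compA.
  have [->|/eqP h] := eqVneq (f ∘ i a) 0; first by rewrite comp0l.
  by case: nog; exists a; apply/(grading_hom grad (dW a) dB); exists (f ∘ i a).
have dWa : deg g (Ws a) by rewrite -ga; apply: dW.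
have [n [x [s [j e]]]] := simpleW_dom Xg dWa.
exists n, x, (fun k => s k ∘ p a), (fun k => i a ∘ j k); split=> B f dB.
  have -> : f = i a ∘ (p a ∘ f).
    rewrite -{1}[f]compIm -ip comp_suml (bigD1 a) //= big1 ?addr0 ?compA // => b ba.
    rewrite -compA; have [->|/eqP h] := eqVneq (p b ∘ f) 0; first by rewrite comp0r.
    case/eqP: ba; apply: ginj; rewrite ga; apply/esym.
    by apply/(grading_hom grad dB (dW b)); exists (p b ∘ f).
  rewrite -{1}[p a ∘ f]compIm e comp_suml comp_sumr; apply: eq_bigr => k _.
  by rewrite -!compA (ra0 (pi a)).
have -> : f = (f ∘ i a) ∘ p a.
  rewrite -{1}[f]compmI -ip comp_sumr (bigD1 a) //= big1 ?addr0 ?compA // => b ba.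
  rewrite compA; have [->|/eqP h] := eqVneq (f ∘ i b) 0; first by rewrite comp0l.
  case/eqP: ba; apply: ginj; rewrite ga.
  by apply/(grading_hom grad (dW b) dB); exists (f ∘ i b).
rewrite -{1}[p a]compIm e comp_suml comp_sumr; apply: eq_bigr => k _.
by rewrite -!compA (ra0 (pi a)).
Qed.

Lemma simpleW_split_mono g (x : pm_I C g * Z) A (f : Hom (simpleW x) A) :
  ~ X g -> f <> 0 -> exists r : Hom A (simpleW x), r ∘ f = idm _.
Proof.
move=> Xg f0; have [n [y [s [i [e _]]]]] := degree_piece A Xg.
have [[k kf]|h] := pselect (exists k, s k ∘ f <> 0); last first.
  case: f0; rewrite (e _ f (deg_simpleW x Xg)) big1 // => k _.
  by rewrite (contrapT (fun q => h (ex_intro _ k q))) comp0r.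
have yx : y k = x.
  by apply/eqP; apply: contra_notT kf => yx; apply: simpleW_hom0; rewrite // eq_sym.
move: (s k) kf; rewrite yx => r rf; have [a ra] := simpleW_end (r ∘ f) Xg.
have a0 : a != 0 by apply: contra_notN rf => /eqP a0; rewrite ra a0 scale0r.
by exists (a^-1 *: r); rewrite compZl ra scalerA mulVf // scale1r.
Qed.

Lemma simpleW_split_epi g (x : pm_I C g * Z) A (f : Hom A (simpleW x)) :
  ~ X g -> f <> 0 -> exists s : Hom (simpleW x) A, f ∘ s = idm _.
Proof.
move=> Xg f0; have [n [y [s [i [_ e]]]]] := degree_piece A Xg.
have [[k kf]|h] := pselect (exists k, f ∘ i k <> 0); last first.
  case: f0; rewrite (e _ f (deg_simpleW x Xg)) big1 // => k _.
  by rewrite (contrapT (fun q => h (ex_intro _ k q))) comp0l.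
have yx : y k = x.
  by apply/eqP; apply: contra_notT kf => yx; apply: simpleW_hom0; rewrite // eq_sym.
move: (i k) kf; rewrite yx => r rf; have [a ra] := simpleW_end (f ∘ r) Xg.
have a0 : a != 0 by apply: contra_notN rf => /eqP a0; rewrite ra a0 scale0r.
by exists (a^-1 *: r); rewrite compZr ra scalerA mulVf // scale1r.
Qed.

Definition coefW g (x : pm_I C g * Z) (f : Hom (simpleW x) (simpleW x)) : K :=
  scalar_of f.

Lemma coefWE g (x : pm_I C g * Z) f : ~ X g -> f = coefW f *: idm (simpleW x).
Proof.
by move=> Xg; rewrite /coefW /scalar_of; case: xgetP => // h; have [a /h] := simpleW_end f Xg.
Qed.

Lemma coefW_uniq g (x : pm_I C g * Z) f a :
  ~ X g -> f = a *: idm (simpleW x) -> coefW f = a.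
Proof.
move=> Xg fa; apply/eqP; rewrite -subr_eq0; apply/negPn/negP => h.
apply: (@simpleW_neq0 _ x Xg); apply: (scalerI h).
by rewrite scaler0 scalerBl -coefWE // -fa subrr.
Qed.

(** Maps from and to a simple object have finitely many coordinates, which makes
    the separation of vectors from subspaces applicable to them. *)
Lemma isotypic_piece g (x : pm_I C g * Z) A : ~ X g ->
  exists (n : nat) (s : 'I_n -> Hom A (simpleW x)) (i : 'I_n -> Hom (simpleW x) A),
    (forall f : Hom (simpleW x) A, f = \sum_(k < n) coefW (s k ∘ f) *: i k) /\
    (forall f : Hom A (simpleW x), f = \sum_(k < n) coefW (f ∘ i k) *: s k).
Proof.
move=> Xg; have [n [y [s [i [e1 e2]]]]] := degree_piece A Xg.
have h k : exists (s' : Hom A (simpleW x)) (i' : Hom (simpleW x) A),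
    (forall f : Hom (simpleW x) A, i k ∘ (s k ∘ f) = i' ∘ (s' ∘ f)) /\
    (forall f : Hom A (simpleW x), (f ∘ i k) ∘ s k = (f ∘ i') ∘ s').
  have [yx|yx] := eqVneq (y k) x.
    by move: (s k) (i k); rewrite yx => s' i'; exists s', i'.
  exists 0, 0; split=> f.
    by rewrite (simpleW_hom0 (s k ∘ f)) 1?eq_sym // comp0l !comp0r.
  by rewrite (simpleW_hom0 (f ∘ i k)) // comp0r !comp0l.
have [s' /choice [i' h']] := choice h.
exists n, s', i'; split=> f.
  rewrite {1}(e1 _ f (deg_simpleW x Xg)); apply: eq_bigr => k _.
  by rewrite (h' k).1 {1}(coefWE (s' k ∘ f) Xg) compZr compmI.
rewrite {1}(e2 _ f (deg_simpleW x Xg)); apply: eq_bigr => k _.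
by rewrite (h' k).2 {1}(coefWE (f ∘ i' k) Xg) compZl compIm.
Qed.

Lemma coefW_linear g (x : pm_I C g * Z) a (f h : Hom (simpleW x) (simpleW x)) :
  ~ X g -> coefW (a *: f + h) = a * coefW f + coefW h.
Proof.
move=> Xg; apply: coefW_uniq => //.
by rewrite {1}(coefWE f Xg) {1}(coefWE h Xg) scalerA scalerDl.
Qed.

Lemma coefW0 g (x : pm_I C g * Z) : ~ X g -> coefW (0 : Hom (simpleW x) (simpleW x)) = 0.
Proof. by move=> Xg; apply: coefW_uniq; rewrite ?scale0r. Qed.

(** An epimorphism induces a surjection on maps from a simple object of generic
    degree: a linear form on maps to B that vanishes on the image is composition
    with a map from B to this simple object, which is killed by the epimorphism
    and therefore zero. *)
Lemma simpleW_projective g (x : pm_I C g * Z) : ~ X g -> is_projective (simpleW x).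
Proof.
move=> Xg A B p f ep; have [n [s [i [e1 e2]]]] := isotypic_piece x B Xg.
pose co (h : Hom (simpleW x) B) : 'rV[K]_n := \row_k coefW (s k ∘ h).
pose L v := exists h : Hom (simpleW x) A, v = co (p ∘ h).
have [[h fh]|nL] := pselect (L (co f)).
  exists h; rewrite [LHS]e1 [RHS]e1; apply: eq_bigr => k _.
  by move/rowP/(_ k): fh; rewrite !mxE => ->.
have [|| u [uL []]] := separation _ _ nL.
- move=> a _ _ [h1 ->] [h2 ->]; exists (a *: h1 + h2); apply/rowP => k.
  by rewrite !mxE !comp_linr coefW_linear.
- by exists 0; apply/rowP => k; rewrite !mxE !comp0r coefW0.
pose r := \sum_k u k 0 *: s k.
have rE h : r ∘ h = (co h *m u) 0 0 *: idm _.
  rewrite mxE scaler_suml comp_suml; apply: eq_bigr => k _.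
  by rewrite compZl {1}(coefWE (s k ∘ h) Xg) !mxE scalerA mulrC.
have rp : r ∘ p = 0.
  apply: contrapT => /(simpleW_split_epi Xg) [h]; rewrite -compA rE uL; last by exists h.
  by rewrite mxE scale0r => /esym; exact: simpleW_neq0.
have r0 : r = 0 by apply: ep; rewrite rp comp0l.
apply/rowP => k; rewrite ord1 [RHS]mxE; apply: contrapT => /eqP c0.
apply: (@simpleW_neq0 _ x Xg); apply: (scalerI c0).
by rewrite -rE r0 comp0l scaler0.
Qed.

Lemma generic_projective g A : ~ X g -> deg g A -> is_projective A.
Proof.
move=> Xg dA M N p f ep; have [n [x [s [i e]]]] := simpleW_dom Xg dA.
have h k : exists q : Hom (simpleW (x k)) M, p ∘ q = f ∘ i k.
  exact: simpleW_projective ep.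
pose q k := sval (cid (h k)).
have qP k : p ∘ q k = f ∘ i k := svalP (cid (h k)).
exists (\sum_k (q k ∘ s k)); rewrite comp_sumr -[f]compmI e comp_sumr.
by apply: eq_bigr => k _; rewrite !compA qP.
Qed.

(** * Nondegeneracy of the modified trace *)

Let mt := pm_mtrace C.

Lemma trace_cyc U V (f : Hom U V) (g : Hom V U) :
  is_projective U -> is_projective V -> pm_trace V (f ∘ g) = pm_trace U (g ∘ f).
Proof. exact: (mtrace_cyclic mt). Qed.

Lemma trace_ptr U V (f : Hom (U ⊗ V) (U ⊗ V)) :
  is_projective U -> pm_trace (U ⊗ V) f = pm_trace U (ptr f).
Proof. exact: (mtrace_ptr mt). Qed.

(** Cyclicity removes the braiding and the twist that separate the left partial
    trace from the right one. *)
Lemma trace_trL U V (f : Hom (U ⊗ V) (U ⊗ V)) :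
  is_projective V ->
  pm_trace (U ⊗ V) f = pm_trace V (trL (evr U) (coevl U) f).
Proof.
move=> pV; rewrite trL_ptr -trace_ptr //.
have pVU := @proj_tensR _ _ V U pV; have pUV := @proj_tensL _ _ V U pV.
rewrite trace_cyc // -?compA -whL twistVK whI compmI trace_cyc // -?compA.
by rewrite braidVK compmI.
Qed.

Lemma trace_sum (V : C) (I : Type) (r : seq I) (P : pred I) (F : I -> Hom V V) :
  pm_trace V (\sum_(i <- r | P i) F i) = \sum_(i <- r | P i) pm_trace V (F i).
Proof. exact: raddf_sum. Qed.

Lemma traceZ (V : C) a (f : Hom V V) : pm_trace V (a *: f) = a * pm_trace V f.
Proof. exact: linearZ. Qed.

Lemma trace0 (V : C) : pm_trace V 0 = 0.
Proof. exact: raddf0. Qed.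

Lemma trace_simple g (i : pm_I C g) (f : Hom (pm_V i) (pm_V i)) a :
  f = a *: idm _ -> pm_trace (pm_V i) f = a * mdim (pm_V i).
Proof. by move=> ->; rewrite traceZ. Qed.

Lemma generic_exists : exists g : G, ~ X g.
Proof.
apply: contrapT => h; apply: (pm_small C (n := 1) (g := fun=> 0)).
apply/seteqP; split=> // g _; exists ord0 => //; exists g; last by rewrite add0r.
by apply: contrapT => Xg; apply: h; exists g.
Qed.

Lemma generic_opp g : ~ X g -> ~ X (- g).
Proof.
move=> Xg Xng; apply: Xg; rewrite -[g]opprK.
by rewrite (pm_sym C); exists (- g); rewrite ?opprK.
Qed.

Lemma generic_index g : ~ X g -> exists i : pm_I C g, True.
Proof.
move=> Xg; have [V [dV iV]] := grading_nonzero grad g.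
have [[|n] [x [s [i e]]]] := simpleW_dom Xg dV; last by exists (x ord0).1.
by case: iV; rewrite e big_ord0.
Qed.

Lemma pm_V_projective g (i : pm_I C g) : ~ X g -> is_projective (pm_V i).
Proof. by move=> Xg; apply: (@generic_projective g) => //; apply: pm_V_deg. Qed.

Lemma pm_V_scalar g (i : pm_I C g) (f : Hom (pm_V i) (pm_V i)) :
  ~ X g -> f = scalar_of f *: idm _.
Proof.
move=> Xg; rewrite /scalar_of; case: xgetP => // h.
by have [_ /(_ f) [a /h]] := pm_V_simple i Xg.
Qed.

Lemma pm_V_scalar_uniq g (i : pm_I C g) (f : Hom (pm_V i) (pm_V i)) a :
  ~ X g -> f = a *: idm _ -> scalar_of f = a.
Proof.
move=> Xg fa; apply/eqP; rewrite -subr_eq0; apply/negPn/negP => h.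
have [i0 _] := pm_V_simple i Xg; apply: i0; apply: (scalerI h).
by rewrite scaler0 scalerBl -pm_V_scalar // -fa subrr.
Qed.

(** This reduces modified traces to endomorphisms of V_i, which are scalars. *)
Lemma projective_retract g (i : pm_I C g) P : ~ X g -> is_projective P ->
  exists s : Hom P (pm_V i ⊗ (dual (pm_V i) ⊗ P)), cover (pm_V i) P ∘ s = idm P.
Proof.
move=> Xg pP; have [s es] := pP _ _ _ (idm P) (@cover_epi _ _ _ P (@pm_V_regular _ _ _ _ C g i Xg)).
by exists s.
Qed.

(** Otherwise the modified trace would vanish on all retracts of objects V_i ⊗ N. *)
Lemma mdim_neq0 g (i : pm_I C g) : ~ X g -> mdim (pm_V i) != 0.
Proof.
move=> Xg; apply/eqP => d0; have [P [f [pP]]] := pm_trace_neq0 C; apply.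
have [s es] := projective_retract i Xg pP.
have pV := @pm_V_projective _ i Xg; set N := dual (pm_V i) ⊗ P in s es.
have pVN := @proj_tensR _ _ (pm_V i) N pV.
rewrite -[f]compmI -es compA trace_cyc // trace_ptr //.
by rewrite (trace_simple (pm_V_scalar _ Xg)) d0 mulr0.
Qed.

Lemma sigma0_iso g (i : pm_I C g) : isomorphic (pm_V i) (simpleW (i, 0)).
Proof.
rewrite /simpleW /= (sigma0 (pm_free C)).
exists (lunitV _), (lunit _); by rewrite lunitK lunitVK.
Qed.

Lemma pm_V_split_mono g (i : pm_I C g) A (f : Hom (pm_V i) A) :
  ~ X g -> f <> 0 -> exists r : Hom A (pm_V i), r ∘ f = idm _.
Proof.
move=> Xg f0; have [u [u' [u'u uu']]] := sigma0_iso i.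
have [|r rf] := simpleW_split_mono (f := f ∘ u') Xg.
  by move=> h; apply: f0; rewrite -[f]compmI -u'u compA h comp0l.
exists (u' ∘ r).
by rewrite -[f]compmI -u'u [f ∘ _]compA -compA [r ∘ _]compA rf compIm.
Qed.

(** P is a retract of an object V_i ⊗ N, and a nonzero map out of V_i ⊗ N bends to
    a nonzero map out of V_i, which splits. *)
Lemma trace_nondeg P B (f : Hom P B) : is_projective P ->
  (forall g : Hom B P, pm_trace P (g ∘ f) = 0) -> f = 0.
Proof.
move=> pP h; apply: contrapT => f0.
have [g Xg] := generic_exists; have [i _] := generic_index Xg.
have [s es] := projective_retract i Xg pP.
have pV := @pm_V_projective _ i Xg; set N := dual (pm_V i) ⊗ P in s es.
have pVN := @proj_tensR _ _ (pm_V i) N pV.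
pose f' := f ∘ cover (pm_V i) P.
have f'0 : curry (coevr N) f' <> 0.
  move=> e; apply: f0; rewrite -[f]compmI -es compA -/f'.
  by rewrite -(curryK (@snakeL _ _ N) f') e uncurry0 comp0l.
have [r rf] := pm_V_split_mono Xg f'0.
have := h (cover (pm_V i) P ∘ curry (coevl N) r).
rewrite -compA trace_cyc // -compA -/f' trace_ptr // ptr_bend.
rewrite (curryK (@snakelR _ _ N)) rf; apply/eqP.
exact: (mdim_neq0 i Xg).
Qed.

Lemma trace_nondeg_eq P (f f' : Hom P P) : is_projective P ->
  (forall g : Hom P P, pm_trace P (g ∘ f) = pm_trace P (g ∘ f')) -> f = f'.
Proof.
move=> pP h; apply/eqP; rewrite -subr_eq0; apply/eqP; apply: trace_nondeg => // g.
by rewrite -scaleN1r addrC comp_linr raddfD /= traceZ h mulN1r addrC subrr.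
Qed.

End Semisimple.

(** * Relative modularity makes every S-matrix invertible *)

Section PartOne.
Variables (K : fieldType) (G Z : zmodType) (X : set G).
Variable C : premodular K Z X.
Implicit Types A B P U V : C.

Lemma trace_conj U V (f : Hom U V) (x : Hom U U) (y : Hom V V) :
  is_projective U -> is_iso f -> f ∘ x = y ∘ f -> pm_trace U x = pm_trace V y.
Proof.
move=> pU [f' [f'f ff']] xy.
have pV : is_projective V by apply: proj_retract ff' pU.
rewrite -[x]compIm -f'f -compA xy trace_cyc // -compA.
by rewrite ff' compmI.
Qed.

Lemma trace_encircle U V (f : Hom V V) : is_projective V ->
  pm_trace (U ⊗ V) ((U ◃ f) ∘ cc U V) = pm_trace V (f ∘ Phi U V).
Proof.
move=> pV; rewrite PhiE -ptr_compl -trace_ptr //.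
apply: (trace_conj (@proj_tensL _ _ V U pV) (braid_iso U V)).
by rewrite compA braid_nat -compA cc_swap compA.
Qed.

(** Both sides are the modified trace of the double braiding of U and V. *)
Lemma trace_PhiC U V : is_projective U -> is_projective V ->
  pm_trace V (Phi U V) = pm_trace U (Phi V U).
Proof.
move=> pU pV; rewrite -[Phi U V]compIm -trace_encircle // whI compIm.
by rewrite PhiE -trace_ptr.
Qed.

(** On the closed strand V, the loop A ⊗ B splits into the loops A and B; the
    loop B contributes its scalar. *)
Lemma trace_Phi_tens A B V b : is_projective V -> Phi B V = b *: idm V ->
  pm_trace V (Phi (A ⊗ B) V) = b * pm_trace V (Phi A V).
Proof.
move=> pV eB; have pVX Y : is_projective (V ⊗ Y) := @proj_tensR _ _ V Y pV.
have pYV Y : is_projective (Y ⊗ V) := @proj_tensL _ _ V Y pV.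
have pVAB : is_projective ((V ⊗ A) ⊗ B) := @proj_tensR _ _ _ B (pVX A).
have pAVB : is_projective ((A ⊗ V) ⊗ B) := @proj_tensR _ _ _ B (pYV A).
rewrite PhiE -trace_ptr //.
rewrite PhiE -trace_ptr //.
pose y := (braid A V ▹ B) ∘ (assocV A V B ∘
    ((A ◃ cc V B) ∘ (assoc A V B ∘ (braid V A ▹ B)))).
rewrite (trace_conj (y := y) _ (assocV_iso V A B)) //; last first.
  by rewrite /y -cc_tensr -?compA assocVK compmI.
rewrite /y trace_cyc // -?compA -whR -ccE.
rewrite (_ : assocV A V B ∘ _ =
   (assocV A V B ∘ ((A ◃ cc V B) ∘ assoc A V B)) ∘ (cc A V ▹ B));
  last by rewrite -?compA.
rewrite trace_ptr // ptr_compr ptr_whL -PhiE eB tensZr whI compZl compIm traceZ.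
congr (_ * _).
by rewrite -[cc A V]compIm -(whI A V) trace_encircle // compIm PhiE -trace_ptr.
Qed.

Lemma trace_coevr_evl V : is_projective V ->
  pm_trace (V ⊗ dual V) (coevr V ∘ evl V) = mdim V.
Proof. by move=> pV; rewrite trace_ptr // ptr_coevr_evl. Qed.

(** The inverse of S_g is, up to zeta, the matrix M of the scalars N by which the
    dual objects V_j^* encircle V_k, weighted by d(V_k). *)
Lemma relative_modular_nondegenerate g :
  relative_modular C -> ~ X g -> S_nondegenerate C g.
Proof.
move=> [zeta [z0 rel]] Xg; have [reld relo] := rel g g Xg Xg.
have pV i := @pm_V_projective _ _ _ _ C g i Xg.
have d0 i := @mdim_neq0 _ _ _ _ C g i Xg.
pose S' i j := Sprime (C := C) (g := g) i j.
pose N (j k : pm_I C g) := scalar_of (Phi (dual (pm_V j)) (pm_V k)).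
have key i j k : pm_trace _ (Phi (pm_V (p := C) (g := g) k) (pm_V i ⊗ dual (pm_V j)))
    = N j k * (S' i k * mdim (pm_V k)).
  rewrite trace_PhiC //; last exact: proj_tensR.
  rewrite (@trace_Phi_tens _ _ _ (N j k)) //; last exact: pm_V_scalar.
  by congr (_ * _); apply: trace_simple; exact: pm_V_scalar.
have sum_ij i j : \sum_k mdim (pm_V k) * (N j k * (S' i k * mdim (pm_V k))) =
    zeta *+ (i == j).
  apply: (mulfI (d0 i)).
  have -> : mdim (pm_V i) *
      \sum_k mdim (pm_V k) * (N j k * (S' i k * mdim (pm_V k))) =
      pm_trace _ (mdim (pm_V i) *: \sum_(k : pm_I C g)
        mdim (pm_V k) *: Phi (pm_V k) (pm_V i ⊗ dual (pm_V j))).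
    by rewrite traceZ trace_sum; congr (_ * _); apply: eq_bigr => k _; rewrite traceZ key.
  have [<-|ij] := eqVneq i j; last by rewrite relo // trace0 mulr0n mulr0.
  by rewrite reld traceZ trace_coevr_evl // mulr1n mulrC.
pose M : 'M[K]_#|pm_I C g| := \matrix_(k, j)
  (mdim (pm_V (enum_val k)) * N (enum_val j) (enum_val k)).
have SM : Smatrix C g *m M = zeta%:M.
  apply/matrixP => i j; rewrite !mxE.
  have -> : (i == j) = (enum_val i == enum_val j).
    by rewrite (inj_eq enum_val_inj).
  rewrite -sum_ij [RHS](reindex_onto enum_val enum_rank) /=; last first.
    by move=> k _; rewrite enum_rankK.
  apply: eq_big => [k|k _]; first by rewrite enum_valK eqxx.
  by rewrite !mxE -mulrA; congr (_ * _); rewrite mulrA mulrC.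
have := mulmx1_unit (A := Smatrix C g) (B := zeta^-1 *: M).
rewrite -scalemxAr SM scale_scalar_mx mulVf //.
by case/(_ erefl).
Qed.

End PartOne.

(** * Sliding a strand across a Kirby-coloured loop *)

Section Coupons.
Variables (K : fieldType) (C : ribbonCat K).
Implicit Types A B U V W X : C.

(** Two coupons exchanging the strands X, U for W, with y between them: bending
    the strand U exhibits the composite as y closed on its left, up to the
    endomorphism obtained from the two coupons. *)
Lemma bend_coupon X U V W (s : Hom (X ⊗ U) W) (io : Hom W (X ⊗ U))
    (y : Hom (U ⊗ V) (U ⊗ V)) :
  b21 s V ∘ ((X ◃ y) ∘ b12 io V) =
  (W ◃ b20 (evr U) V) ∘ ((W ◃ dual U ◃ y) ∘
    (b22 (curry (coevr U) s ∘ uncurry (evl U) io) (U ⊗ V) ∘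
      (W ◃ b02 (coevl U) V))).
Proof.
rewrite -{1}(curryK (@snakeL _ _ U) s) uncurryT.
rewrite -{1}(uncurryK (@snakelL _ _ U) io) (curryT (coevl U)).
by rewrite b22_split1 -?compA (ra (b12_nat _ _)).
Qed.

Lemma shift_coupon S X U V W W' (u : Hom (S ⊗ W) W') (u' : Hom W' (S ⊗ W))
   (s : Hom (X ⊗ U) W) (io : Hom W (X ⊗ U)) (y : Hom (U ⊗ V) (U ⊗ V)) :
  b21 (u ∘ ((S ◃ s) ∘ assoc S X U)) V ∘ (((S ⊗ X) ◃ y) ∘
    b12 (assocV S X U ∘ ((S ◃ io) ∘ u')) V) =
  (u ▹ V) ∘ (assocV S W V ∘
    ((S ◃ (b21 s V ∘ ((X ◃ y) ∘ b12 io V))) ∘ (assoc S W V ∘ (u' ▹ V)))).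
Proof.
rewrite !b21E !b12E !whR !whL -?compA (ra (pentagonC _ _ _ _)) -?compA.
rewrite (ra (esym (assocV_nat _ _ _))) (ra (pentagonD _ _ _ _)) -?compA.
rewrite (ra (esym (assocV_natR _ _ _))) (ra0 (assocVK _ _ _)).
by rewrite (ra (assoc_nat _ _ _)).
Qed.

End Coupons.

Section Slide.
Variables (K : fieldType) (G Z : zmodType) (X : set G).
Variable C : premodular K Z X.
Implicit Types A B P U V W : C.

Let free := pm_free C.

(** The character psi is additive in the degree, so it is trivial in degree 0. *)
Lemma sigma_transparent V k : pm_deg 0 V -> cc (sigma C k) V = idm _.
Proof.
move=> dV; have [psi [p0 pD _ pE]] := pm_compat C.
have e0 : psi 0 k = 1 by apply: (mulfI (p0 0 k)); rewrite -pD addr0 mulr1.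
have := pE 0 k V dV; rewrite e0 scale1r -ccE => eV.
apply: (iso_epi (braid_iso V (sigma C k))).
by rewrite -cc_swap eV compmI compIm.
Qed.

Lemma qdimE (V : C) : evr V ∘ coevl V = qdim V.
Proof. by rewrite /qdim /evl /coevl -?compA (ra (braid_nat _ _)). Qed.

(** The left partial trace of a strand sigma k is its quantum dimension. *)
Lemma sigma_sign k : exists q : K, q * q = 1 /\
  forall W (f : Hom W W), is_projective W ->
    pm_trace (sigma C k ⊗ W) (sigma C k ◃ f) = q * pm_trace W f.
Proof.
have [q [qq eq]] : exists q : K, q * q = 1 /\ qdim (sigma C k) = q *: idm one.
  have [->|->] := sigma_qdim free k; first by exists 1; rewrite mulr1 scale1r.
  by exists (-1); rewrite mulrNN mulr1 scaleN1r.
exists q; split=> // W f pW; rewrite trace_trL // -[_ ◃ f]compmI trL_compl.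
by rewrite (@trL_id _ _ _ _ _ _ _ q) ?qdimE // compZr compmI traceZ.
Qed.

(** The Kirby colour of degree g, closed around V. *)
Definition kirby g V : Hom V V := \sum_(k : pm_I C g) mdim (pm_V k) *: Phi (pm_V k) V.

Lemma kirby_nat g V V' (f : Hom V V') : f ∘ kirby g V = kirby g V' ∘ f.
Proof.
rewrite comp_sumr comp_suml; apply: eq_bigr => k _.
by rewrite compZr compZl Phi_nat.
Qed.

(** The loop A becomes one more closed strand to the left of U and V, by the left
    partial trace; A and U then wind around V together. *)
Lemma trace_encircle2 A U V (y : Hom (U ⊗ V) (U ⊗ V)) : is_projective V ->
  pm_trace (U ⊗ V) (y ∘ (cc U V ∘ (U ◃ Phi A V))) =
  pm_trace (A ⊗ (U ⊗ V))
    ((A ◃ y) ∘ (assoc A U V ∘ (cc (A ⊗ U) V ∘ assocV A U V))).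
Proof.
move=> pV; have pUV := @proj_tensL _ _ V U pV; have pVU := @proj_tensR _ _ V U pV.
have pAUV := @proj_tensL _ _ _ A pUV; have pAVU := @proj_tensL _ _ _ A pVU.
rewrite cc_tensl; apply/esym.
pose y' := (A ◃ (braid U V ∘ (y ∘ braid V U))) ∘ b22 (cc A V) U.
rewrite (trace_conj (y := y') pAUV (whL_iso A (braid_iso U V))); last first.
  by rewrite /y' !whL -?compA.
have trLb : trL (evr A) (coevl A) (b22 (cc A V) U) = Phi A V ▹ U.
  by rewrite -trL_cc trL_tail.
rewrite /y' trace_trL // trL_compl trLb.
pose y'' := cc U V ∘ (y ∘ (U ◃ Phi A V)).
rewrite (trace_conj (y := y'') pVU (braid_iso V U)); last first.
  by rewrite /y'' ccE -?compA braid_nat.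
rewrite /y'' trace_cyc // -?compA; congr (pm_trace _ _).
by rewrite cc_natr.
Qed.

(** Shifting a coupon by an invertible object changes the closed diagram by the
    sign of that object only, since V of degree 0 does not see it. *)
Lemma trace_shift k V W W' (u : Hom (sigma C k ⊗ W) W') (u' : Hom W' (sigma C k ⊗ W))
    (M : Hom (W ⊗ V) (W ⊗ V)) q :
  pm_deg 0 V -> is_projective V -> u' ∘ u = idm _ -> u ∘ u' = idm _ ->
  (forall W (f : Hom W W), is_projective W ->
    pm_trace (sigma C k ⊗ W) (sigma C k ◃ f) = q * pm_trace W f) ->
  pm_trace (W' ⊗ V) (cc W' V ∘ ((u ▹ V) ∘ (assocV _ W V ∘
    ((sigma C k ◃ M) ∘ (assoc _ W V ∘ (u' ▹ V)))))) =
  q * pm_trace (W ⊗ V) (cc W V ∘ M).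
Proof.
move=> dV pV u'u uu' qE; set S := sigma C k in u u' u'u uu' qE *.
have pWV := @proj_tensL _ _ V W pV; have pSWV := @proj_tensL _ _ _ S pWV.
rewrite -qE //; apply/esym.
have iu : is_iso ((u ▹ V) ∘ assocV S W V).
  by apply: iso_comp (assocV_iso _ _ _); apply: whR_iso; exists u'.
apply: (trace_conj pSWV iu).
have e : (S ◃ cc W V) ∘ assoc S W V = assoc S W V ∘ cc (S ⊗ W) V.
  rewrite -[RHS]compmI -(assocK S W V) -?compA.
  have := cc_tensl S W V; rewrite sigma_transparent // b22_id compIm -whL -ccE.
  by move=> <-; rewrite -?compA.
rewrite -?compA (ra1 (esym (whR _ _ _))) u'u whI compIm assocVK compmI.
rewrite (ra (cc_natl _ _)) whL; congr (_ ∘ _).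
have e' : cc (S ⊗ W) V ∘ assocV S W V = assocV S W V ∘ (S ◃ cc W V).
  apply: (iso_mono (assoc_iso S W V)).
  by rewrite (ra0 (assocVK _ _ _)) compA -e -compA assocVK compmI.
by rewrite (ra e').
Qed.

(** Each summand r carries maps through V_l shifted by hd_m r for every l in I_h,
    most of them zero: then l can be summed before the index k of the objects
    that are decomposed. *)
Record homogeneous_dec h A := HomogeneousDec {
  hd_n : nat;
  hd_m : 'I_hd_n -> Z;
  hd_s : forall r (l : pm_I C h), Hom A (simpleW (l, hd_m r));
  hd_i : forall r (l : pm_I C h), Hom (simpleW (l, hd_m r)) A;
  hd_id : idm A = \sum_r \sum_l (hd_i r l ∘ hd_s r l) }.

Lemma homogeneous_dec_exists h A : ~ X h -> pm_deg h A ->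
  exists _ : homogeneous_dec h A, True.
Proof.
move=> Xh dA; have [n [x [s [i e]]]] := simpleW_dom Xh dA.
have sp r : exists (s' : forall l : pm_I C h, Hom A (simpleW (l, (x r).2)))
    (i' : forall l : pm_I C h, Hom (simpleW (l, (x r).2)) A),
    i r ∘ s r = \sum_l (i' l ∘ s' l).
  move: (s r) (i r); case: (x r) => l0 m /= s0 i0.
  pose cast (F : pm_I C h -> lmodType K) (v : F l0) l : F l :=
    if l0 =P l is ReflectT e then ecast z (F z) e v else 0.
  exists (cast (fun l : pm_I C h => Hom A (simpleW (l, m))) s0).
  exists (cast (fun l : pm_I C h => Hom (simpleW (l, m)) A) i0).
  rewrite (bigD1 l0) //= big1 ?addr0 => [|l ll0]; last first.
    rewrite /cast; case: eqP => [e0|_]; first by rewrite e0 eqxx in ll0.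
    by rewrite comp0r.
  by rewrite /cast; case: eqP => // e0; rewrite (eq_axiomK e0).
pose s' r := sval (cid (sp r)); pose i' r := sval (cid (svalP (cid (sp r)))).
have e' r : i r ∘ s r = \sum_l (i' r l ∘ s' r l).
  exact: (svalP (cid (svalP (cid (sp r))))).
by exists (HomogeneousDec (etrans e (eq_bigr _ (fun r _ => e' r)))).
Qed.

End Slide.

Section MonoidalExtra.
Variables (K : fieldType) (C : monCat K).

Lemma b22_sum (A B A' B' : C) (I : Type) (r : seq I) (P : pred I)
    (F : I -> Hom (A ⊗ B) (A' ⊗ B')) T :
  b22 (\sum_(i <- r | P i) F i) T = \sum_(i <- r | P i) b22 (F i) T.
Proof.
rewrite b22E tens_suml comp_suml comp_sumr.
by apply: eq_bigr => i _; rewrite b22E.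
Qed.

Lemma b22Z (A B A' B' : C) a (f : Hom (A ⊗ B) (A' ⊗ B')) T :
  b22 (a *: f) T = a *: b22 f T.
Proof. by rewrite !b22E tensZl compZl compZr. Qed.

Lemma unit_cancel (A B D : C) : A ⊗ B = one ->
  exists (u : Hom (A ⊗ (B ⊗ D)) D) (u' : Hom D (A ⊗ (B ⊗ D))),
    u' ∘ u = idm _ /\ u ∘ u' = idm _.
Proof.
move=> e; have [f [f' [f'f ff']]] : exists (f : Hom ((A ⊗ B) ⊗ D) D)
    (f' : Hom D ((A ⊗ B) ⊗ D)), f' ∘ f = idm _ /\ f ∘ f' = idm _.
  by rewrite e; exists (lunit D), (lunitV D); rewrite lunitK lunitVK.
exists (f ∘ assocV A B D), (assoc A B D ∘ f').
by rewrite -?compA (ra0 f'f) assocVK (ra0 (assocK _ _ _)).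
Qed.

End MonoidalExtra.

Section KirbySlide.
Variables (K : fieldType) (G Z : zmodType) (X : set G).
Variable C : premodular K Z X.
Implicit Types A B P U V W : C.

Let grad := pm_grading C.
Let free := pm_free C.

Lemma sigma_oppK m : sigma C (- m) ⊗ sigma C m = one.
Proof. by rewrite (sigmaD free) addNr (sigma0 free). Qed.

Lemma simpleW_shift0 h n (l l' : pm_I C h) m
    (f : Hom (sigma C n ⊗ simpleW (l', m)) (pm_V l)) :
  ~ X h -> (l' != l) || (m != - n) -> f = 0.
Proof.
move=> Xh ne.
have [u [u' [u'u uu']]] : exists (u : Hom (sigma C n ⊗ simpleW (l', m)) (simpleW (l', n + m)))
    (u' : Hom (simpleW (l', n + m)) (sigma C n ⊗ simpleW (l', m))),
    u' ∘ u = idm _ /\ u ∘ u' = idm _.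
  rewrite /simpleW /= -(sigmaD free).
  by exists (assocV _ _ _), (assoc _ _ _); rewrite assocK assocVK.
have [v [v' [v'v vv']]] := sigma0_iso l.
rewrite -[f]compIm -v'v -compA -[f]compmI -u'u [f ∘ _]compA [v ∘ _]compA.
rewrite [v ∘ _](simpleW_hom0 _ Xh) ?comp0l ?comp0r //.
rewrite xpair_eqE negb_and; case/orP: ne => [->//|ne].
by rewrite addrC addr_eq0 ne orbT.
Qed.

(** The diagram in which V_l runs around V and the strand U, bent away, has been
    closed by y around the endomorphism Q. *)
Definition bent (A U V : C) (y : Hom (U ⊗ V) (U ⊗ V)) (Q : Hom (A ⊗ dual U) (A ⊗ dual U)) :
    Hom (A ⊗ V) (A ⊗ V) :=
  (A ◃ b20 (evr U) V) ∘ ((A ◃ dual U ◃ y) ∘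
    (b22 Q (U ⊗ V) ∘ (A ◃ b02 (coevl U) V))).

Lemma bent_sum A U V y (I : Type) (r : seq I) (P : pred I)
    (F : I -> Hom (A ⊗ dual U) (A ⊗ dual U)) :
  bent (V := V) y (\sum_(i <- r | P i) F i) = \sum_(i <- r | P i) bent y (F i).
Proof. by rewrite /bent b22_sum !(comp_suml, comp_sumr). Qed.

Lemma bentZ A U V y a (Q : Hom (A ⊗ dual U) (A ⊗ dual U)) :
  bent (V := V) y (a *: Q) = a *: bent y Q.
Proof. by rewrite /bent b22Z !(compZl, compZr). Qed.

Lemma bent_id A U V (y : Hom (U ⊗ V) (U ⊗ V)) :
  bent y (idm (A ⊗ dual U)) = A ◃ trL (evr U) (coevl U) y.
Proof. by rewrite /bent b22_id compIm /trL !whL. Qed.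

Lemma mdim_sigma k V q : is_projective V ->
  (forall W (f : Hom W W), is_projective W ->
    pm_trace (sigma C k ⊗ W) (sigma C k ◃ f) = q * pm_trace W f) ->
  mdim (sigma C k ⊗ V) = q * mdim V.
Proof. by move=> pV qE; rewrite /mdim -whI qE. Qed.

(** A summand sigma m ⊗ B of A ⊗ U is a summand B of (sigma (- m) ⊗ A) ⊗ U. The
    shift multiplies the modified dimension and the closed diagram by the same
    sign, so the weighted diagrams agree. *)
Lemma shift_pair A U V B m (s : Hom (A ⊗ U) (sigma C m ⊗ B))
    (io : Hom (sigma C m ⊗ B) (A ⊗ U)) :
  is_projective A -> is_projective V -> pm_deg 0 V ->
  exists (s' : Hom ((sigma C (- m) ⊗ A) ⊗ U) B)
         (io' : Hom B ((sigma C (- m) ⊗ A) ⊗ U)),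
    io' ∘ s' = assocV _ A U ∘ ((sigma C (- m) ◃ (io ∘ s)) ∘ assoc _ A U) /\
    (forall y : Hom (U ⊗ V) (U ⊗ V),
     mdim A * pm_trace _ (cc (sigma C m ⊗ B) V ∘ (b21 s V ∘ ((A ◃ y) ∘ b12 io V))) =
     mdim (sigma C (- m) ⊗ A) * pm_trace _ (cc B V ∘
       bent y (curry (coevr U) s' ∘ uncurry (evl U) io'))).
Proof.
move=> pA pV dV; have [u [u' [u'u uu']]] := unit_cancel B (sigma_oppK m).
set S := sigma C (- m) in u u' u'u uu' *.
exists (u ∘ ((S ◃ s) ∘ assoc S A U)), (assocV S A U ∘ ((S ◃ io) ∘ u')); split.
  by rewrite -?compA (ra0 u'u) whL -?compA.
move=> y; have [q [qq qE]] := sigma_sign C (- m).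
rewrite /bent -bend_coupon shift_coupon (trace_shift _ dV pV u'u uu' qE).
by rewrite (mdim_sigma pA qE) mulrACA qq mul1r.
Qed.

Section FixedSlide.
Variables (g a : G) (U V : C).
Hypotheses (Xg : ~ X g) (Xh : ~ X (g + a)) (dU : pm_deg a U) (dV : pm_deg 0 V).
Hypothesis pV : is_projective V.
Let h := g + a.

Let pX (k : pm_I C g) := @pm_V_projective _ _ _ _ C g k Xg.

Let dec (k : pm_I C g) : homogeneous_dec h (pm_V k ⊗ U) :=
  sval (cid (homogeneous_dec_exists Xh (grading_tens grad (pm_V_deg k Xg) dU))).

Let n k := hd_n (dec k).
Let m k (r : 'I_(n k)) : Z := @hd_m _ _ _ _ _ _ _ (dec k) r.
Let s k (r : 'I_(n k)) l := @hd_s _ _ _ _ _ _ _ (dec k) r l.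
Let io k (r : 'I_(n k)) l := @hd_i _ _ _ _ _ _ _ (dec k) r l.

Let sp k (r : 'I_(n k)) l := cid (@shift_pair (pm_V k) U V (pm_V l) (m r) (s r l) (io r l) (@pX k) pV dV).
Let s' k (r : 'I_(n k)) l : Hom (simpleW (k, - m r) ⊗ U) (pm_V l) := sval (sp r l).
Let io' k (r : 'I_(n k)) l : Hom (pm_V l) (simpleW (k, - m r) ⊗ U) := sval (cid (svalP (sp r l))).

Let ios' k (r : 'I_(n k)) l : io' r l ∘ s' r l =
  assocV _ (pm_V k) U ∘ ((sigma C (- m r) ◃ (io r l ∘ s r l)) ∘ assoc _ (pm_V k) U).
Proof. exact: (svalP (cid (svalP (sp r l)))).1. Qed.

Let shiftE k (r : 'I_(n k)) l (y : Hom (U ⊗ V) (U ⊗ V)) :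
  mdim (pm_V k) * pm_trace _ (cc (simpleW (l, m r)) V ∘
     (b21 (s r l) V ∘ ((pm_V k ◃ y) ∘ b12 (io r l) V))) =
  mdim (simpleW (k, - m r)) * pm_trace _ (cc (pm_V l) V ∘
       bent y (curry (coevr U) (s' r l) ∘ uncurry (evl U) (io' r l))).
Proof. exact: (svalP (cid (svalP (sp r l)))).2. Qed.

Let Q l : Hom (pm_V l ⊗ dual U) (pm_V l ⊗ dual U) :=
  \sum_(k : pm_I C g) \sum_(r < n k) mdim (simpleW (k, - m r)) *:
     (curry (coevr U) (s' r l) ∘ uncurry (evl U) (io' r l)).

(** The transposed coupons again form dual bases, up to modified dimensions: the
    same closed diagram, read on sigma m0 ⊗ V_k0 and on V_l, computes the scalar
    of a composite of transposes and that of the composite it came from. *)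
Let Q_simple (l : pm_I C h) z (j : Hom (simpleW (z : pm_I C g * Z)) (pm_V l ⊗ dual U)) :
  Q l ∘ j = mdim (pm_V l) *: j.
Proof.
pose J := uncurry (evr U) j.
have jE : j = curry (coevr U) J by rewrite /J (uncurryK (@snakeR _ _ U)).
case: z j J jE => k0 m0 j J jE.
have pW := @simpleW_projective _ _ _ _ C g (k0, m0) Xg.
have pWU := @proj_tensR _ _ _ U pW.
have pL := @pm_V_projective _ _ _ _ C h l Xh.
have term (r : 'I_(n k0)) :
    (mdim (simpleW (k0, - m r)) *:
      (curry (coevr U) (s' r l) ∘ uncurry (evl U) (io' r l))) ∘ j =
    mdim (pm_V l) *: (if m0 == - m r then curry (coevr U) (J ∘ (assocV _ (pm_V k0) U ∘
       ((sigma C m0 ◃ (io r l ∘ s r l)) ∘ assoc _ (pm_V k0) U))) else 0).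
  (* Only the summands whose shift matches that of the source of j survive. *)
  have [mr|mr] := eqVneq m0 (- m r); last first.
    rewrite compZl -compA (simpleW_hom0 (uncurry _ _ ∘ j)) ?comp0r ?scaler0 //.
    by rewrite xpair_eqE eqxx.
  move: (s' r l) (io' r l) (ios' r l); rewrite -mr => s1 io1 e1.
  rewrite -e1 jE compZl -compA -ptr_bend.
  set c := ptr _; have cE := coefWE c Xg.
  (* The closed diagram, read once on each of the two simple objects. *)
  have dc : mdim (simpleW (k0, m0)) * coefW c = mdim (pm_V l) * scalar_of (J ∘ io1).
    have -> : mdim (simpleW (k0, m0)) * coefW c = pm_trace _ c.
      by rewrite {2}cE traceZ mulrC.
    rewrite /c -trace_ptr // trace_cyc //.
    by rewrite (trace_simple (pm_V_scalar _ Xh)) mulrC.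
  rewrite cE compZr compmI scalerA dc -scalerA; congr (_ *: _).
  by rewrite compA [in RHS](pm_V_scalar (J ∘ io1) Xh) compZl compIm curryZ.
rewrite /Q comp_suml (bigD1 k0) //= [X in _ + X]big1 ?addr0; last first.
  move=> k kk0; rewrite comp_suml big1 // => r _.
  rewrite compZl -compA (simpleW_hom0 (uncurry _ _ ∘ j)) ?comp0r ?scaler0 //.
  by rewrite xpair_eqE negb_and eq_sym kk0.
rewrite comp_suml (eq_bigr _ (fun r _ => term r)) -scaler_sumr; congr (_ *: _).
rewrite [RHS]jE -[J in RHS]compmI.
have -> : idm (simpleW (k0, m0) ⊗ U) = \sum_(r < n k0) \sum_l
   (assocV _ (pm_V k0) U ∘ ((sigma C m0 ◃ (io r l ∘ s r l)) ∘ assoc _ (pm_V k0) U)).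
  have -> : idm (simpleW (k0, m0) ⊗ U) =
      assocV _ (pm_V k0) U ∘ ((sigma C m0 ◃ idm _) ∘ assoc _ _ _).
    by rewrite whI compIm assocK.
  rewrite (hd_id (dec k0)) tens_sumr comp_suml comp_sumr; apply: eq_bigr => r _.
  by rewrite tens_sumr comp_suml comp_sumr.
rewrite comp_sumr curry_sum; apply: eq_bigr => r _.
have zero l' : (l' != l) || (m r != - m0) ->
    J ∘ (assocV _ (pm_V k0) U ∘ ((sigma C m0 ◃ (io r l' ∘ s r l')) ∘
      assoc _ (pm_V k0) U)) = 0.
  move=> ne; have -> : J ∘ (assocV _ (pm_V k0) U ∘
      ((sigma C m0 ◃ (io r l' ∘ s r l')) ∘ assoc _ (pm_V k0) U)) =
      (J ∘ (assocV _ _ _ ∘ (sigma C m0 ◃ io r l'))) ∘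
        ((sigma C m0 ◃ s r l') ∘ assoc _ _ _).
    by rewrite whL -?compA.
  by rewrite [J ∘ _](@simpleW_shift0 h m0 l l' (m r) _ Xh ne) comp0l.
rewrite comp_sumr (bigD1 l) //= big1 ?addr0; last by move=> l' ne; rewrite zero ?ne.
by case: eqVneq => // ne; rewrite zero ?curry0 // -eqr_oppLR eq_sym ne orbT.
Qed.

(** V_l ⊗ U^* has degree g, so it is enough to know Q on simple objects. *)
Let Q_id l : Q l = mdim (pm_V l) *: idm _.
Proof.
have dlU : pm_deg g (pm_V l ⊗ dual U).
  have := grading_tens grad (pm_V_deg l Xh) (grading_dual grad dU).
  by rewrite /h addrK.
have [N [z [p [j e]]]] := simpleW_dom Xg dlU.
rewrite -[LHS]compmI [X in _ ∘ X]e [X in _ = _ *: X]e comp_sumr scaler_sumr.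
by apply: eq_bigr => q _; rewrite compA Q_simple compZl.
Qed.

(** Both sides are tested against an endomorphism y of U ⊗ V. On the left, the
    decompositions of the objects V_k ⊗ U produce simple objects V_l of degree
    g + a that wind around V and carry the coupons, which bending U collects
    into the endomorphisms Q; since Q is a scalar, the coupons disappear. *)
Lemma kirby_slide : cc U V ∘ (U ◃ kirby g V) = U ◃ kirby h V.
Proof.
have pUV := @proj_tensL _ _ V U pV.
apply: trace_nondeg_eq => // y.
rewrite tens_sumr !comp_sumr trace_sum.
have per k : pm_trace _ (y ∘ (cc U V ∘ (U ◃ (mdim (pm_V k) *: Phi (pm_V k) V)))) =
    \sum_(r < n k) \sum_l mdim (simpleW (k, - m r)) * pm_trace _ (cc (pm_V l) V ∘
       bent y (curry (coevr U) (s' r l) ∘ uncurry (evl U) (io' r l))).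
  rewrite tensZr !compZr traceZ trace_encircle2 //; set A := pm_V k.
  have -> : cc (A ⊗ U) V = \sum_(r < n k) \sum_l
      ((io r l ▹ V) ∘ (cc (simpleW (l, m r)) V ∘ (s r l ▹ V))).
    rewrite -[LHS]compmI -whI (hd_id (dec k)) tens_suml comp_sumr.
    apply: eq_bigr => r _; rewrite tens_suml comp_sumr; apply: eq_bigr => l _.
    by rewrite whR compA cc_natl -compA.
  rewrite comp_suml !comp_sumr trace_sum mulr_sumr; apply: eq_bigr => r _.
  rewrite comp_suml !comp_sumr trace_sum mulr_sumr; apply: eq_bigr => l _.
  have pWV := @proj_tensL _ _ V (simpleW (l, m r)) pV.
  have pAUV := @proj_tensL _ _ _ A pUV.
  rewrite -shiftE; congr (_ * _).
  set M := b21 (s r l) V ∘ _.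
  have -> : pm_trace _ (cc (simpleW (l, m r)) V ∘ M) =
      pm_trace _ (M ∘ cc (simpleW (l, m r)) V) := trace_cyc _ _ pWV pWV.
  have -> : M ∘ cc (simpleW (l, m r)) V =
      b21 (s r l) V ∘ ((A ◃ y) ∘ (b12 (io r l) V ∘ cc (simpleW (l, m r)) V)).
    by rewrite /M -?compA.
  rewrite [RHS](trace_cyc _ _ pAUV pWV); congr (pm_trace _ _).
  by rewrite b12E b21E -?compA.
rewrite (eq_bigr _ (fun k _ => per k)).
transitivity (\sum_l pm_trace _ (cc (pm_V l) V ∘ bent y (Q l))).
  rewrite /Q; under eq_bigr do rewrite exchange_big /=.
  rewrite exchange_big /=; apply: eq_bigr => l _.
  rewrite bent_sum comp_sumr trace_sum; apply: eq_bigr => k _.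
  rewrite bent_sum comp_sumr trace_sum; apply: eq_bigr => r _.
  by rewrite bentZ compZr traceZ.
under eq_bigr do rewrite Q_id bentZ bent_id compZr traceZ.
rewrite trace_trL // trL_compr comp_sumr trace_sum; apply: eq_bigr => l _.
rewrite compZr traceZ; congr (_ * _).
by rewrite cc_natr trace_encircle.
Qed.

End FixedSlide.
End KirbySlide.

(** * Transparency of the Kirby morphism *)

Section Images.
Variables (K : fieldType) (C : linCat K).

Lemma kernel_mono (A B N : C) (f : Hom A B) (k : Hom N A) : is_kernel f k -> is_mono k.
Proof.
move=> [fk uni] T x y e.
have [|u [_ uu]] := uni T (k ∘ y); first by rewrite compA fk comp0l.
by rewrite -(uu x e) -(uu y erefl).
Qed.

(** The image m is the kernel of the cokernel of f. If w kills e and k is the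
    kernel of w, then f factors through the monomorphism m k, which is a kernel
    of some p; so p factors through the cokernel of f and kills m, and k is
    invertible. *)
Lemma image_factor (A B : C) (f : Hom A B) : is_abelian C ->
  exists (I : C) (e : Hom A I) (m : Hom I B), [/\ is_epi e, is_mono m & f = m ∘ e].
Proof.
move=> ab; have [Q [q [qf uq]]] := ab_cokernel ab f.
have [I [m km]] := ab_kernel ab q; have mm := kernel_mono km.
case: km => qm um; have [e [me _]] := um _ _ qf.
exists I, e, m; split=> // T u v uv; apply/eqP; rewrite -subr_eq0; apply/eqP.
set w := u - v; have we : w ∘ e = 0.
  by rewrite /w -scaleN1r compDl compZl uv scaleN1r subrr.
have [N [k kk]] := ab_kernel ab w; have mk := kernel_mono kk.
case: kk => wk uk; have [e' [ke' _]] := uk _ _ we.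
have mmk : is_mono (m ∘ k) by apply: mono_comp.
have [R [p [pmk up]]] := ab_mono ab mmk.
have pf : p ∘ f = 0 by rewrite -me -ke' [m ∘ _]compA compA pmk comp0l.
have [p' [p'q _]] := uq _ _ pf.
have pm : p ∘ m = 0 by rewrite -p'q -compA qm comp0r.
have [x [mkx _]] := up _ _ pm.
have kx : k ∘ x = idm I by apply: mm; rewrite compmI compA.
by rewrite -[w]compmI -kx compA wk comp0l.
Qed.

End Images.

Section Transparency.
Variables (K : fieldType) (G Z : zmodType) (X : set G).
Variable C : premodular K Z X.
Implicit Types A B P U V W : C.

Let grad := pm_grading C.
Let free := pm_free C.

(** The image is covered by A, so its summands of degree other than g are zero. *)
Lemma image_homogeneous g A B (f : Hom A B) : is_abelian C ->
  pm_deg g A -> f = 0 \/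
  exists (W : C) (e : Hom A W) (m : Hom W B),
    [/\ pm_deg g W, is_epi e, is_mono m & f = m ∘ e].
Proof.
move=> ab dA; have [I [e [m [epi_e mono_m fE]]]] := image_factor f ab.
have [n [d [W [inj_d dW [i [p [pi pi0 sumI]]]]]]] := grading_decomp grad I.
have p0 a : d a != g -> p a = 0.
  move=> ne; apply: epi_e; rewrite comp0l; apply: contrapT => ne0.
  case/eqP: ne; apply/esym; apply: (grading_hom grad dA (dW a)).
  by exists (p a ∘ e).
have [[a da]|no] := pselect (exists a, d a = g); last first.
  left; rewrite fE -[m]compmI -sumI big1 ?comp0r ?comp0l // => a _.
  by rewrite p0 ?comp0r //; apply/eqP => e0; apply: no; exists a.
right; have ip : i a ∘ p a = idm I.
  rewrite -sumI (bigD1 a) //= big1 ?addr0 // => b ba.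
  by rewrite p0 ?comp0r // -da; apply: contraNneq ba => /inj_d ->.
exists (W a), (p a ∘ e), (m ∘ i a); split.
- by rewrite -da; apply: dW.
- by apply: epi_comp epi_e; apply: iso_epi; exists (i a); rewrite ip pi.
- by apply: mono_comp => //; apply: iso_mono; exists (p a); rewrite ip pi.
- by rewrite fE -?compA (ra0 ip).
Qed.

(** By the slide, any strand U of degree 0 can be pulled across kirby h V, hence
    across its image, which therefore lies in the Mueger center. *)
Lemma kirby_sigma h V : is_abelian C -> Z_trivial_muger_center0 C ->
  ~ X h -> pm_deg 0 V -> is_projective V ->
  exists (n : nat) (k : 'I_n -> Z) (p : forall a, Hom V (sigma C (k a)))
    (i : forall a, Hom (sigma C (k a)) V), kirby h V = \sum_a (i a ∘ p a).
Proof.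
move=> ab mug Xh dV pV.
have [->|[W [e [m [dW epi_e mono_m kE]]]]] := image_homogeneous (kirby h V) ab dV.
  exists 0%N, (fun=> 0), (fun=> 0), (fun=> 0); by rewrite big_ord0.
have [|n [T [orbT [i [p [_ _ sumW]]]]]] := mug W.
  split=> // U dU; rewrite -ccE; apply: (whL_epiR (U := U) epi_e).
  apply: (whL_monoR (U := U) mono_m); rewrite compIm -whL -kE compA -cc_natr.
  rewrite -compA -whL -kE -{2}[h]addr0.
  by apply: kirby_slide; rewrite ?addr0.
pose k a := sval (cid (orbT a)).
have isoT a : isomorphic (T a) (sigma C (k a)).
  have := svalP (cid (orbT a)); rewrite -/(k a); move: (k a) => z.
  have -> // : one ⊗ sigma C z = sigma C z.
  by rewrite -{1}(sigma0 free) (sigmaD free) add0r.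
pose f a := sval (cid (isoT a)); pose f' a := sval (cid (svalP (cid (isoT a)))).
have f'f a : f' a ∘ f a = idm _ := (svalP (cid (svalP (cid (isoT a))))).1.
exists n, k, (fun a => f a ∘ (p a ∘ e)), (fun a => m ∘ (i a ∘ f' a)).
rewrite kE -[m in LHS]compmI -sumW comp_sumr comp_suml; apply: eq_bigr => a _.
by rewrite -?compA (ra0 (f'f a)).
Qed.

Lemma coevr_evl_neq0 g (i : pm_I C g) : ~ X g ->
  coevr (pm_V i) ∘ evl (pm_V i) <> 0.
Proof.
move=> Xg e0; have := @trace_coevr_evl _ _ _ _ C _ (@pm_V_projective _ _ _ _ C g i Xg).
by rewrite e0 trace0 => /esym /eqP; apply/negP/(mdim_neq0 i Xg).
Qed.

(** Such a map transposes to a map from V_i to sigma k ⊗ V_j. *)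
Lemma hom_to_sigma0 g (i j : pm_I C g) k (f : Hom (pm_V i ⊗ dual (pm_V j)) (sigma C k)) :
  ~ X g -> (i != j) || (k != 0) -> f = 0.
Proof.
move=> Xg ne; apply: (@curry_inj _ _ _ _ _ _ (@snakelR _ _ (pm_V j))).
rewrite curry0; have [v [v' [v'v vv']]] := sigma0_iso i.
rewrite -[curry _ _]compmI -v'v compA.
rewrite (@simpleW_hom0 _ _ _ _ C g (i, 0) (j, k) (curry (coevl (pm_V j)) f ∘ v') Xg) ?comp0l //.
by rewrite xpair_eqE negb_and [0 == _]eq_sym.
Qed.

(** Maps between V_i ⊗ V_i^* and 1, in either direction, transpose to endomorphisms
    of the simple object V_i. *)
Lemma hom_to_one g (i : pm_I C g) (f : Hom (pm_V i ⊗ dual (pm_V i)) one) :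
  ~ X g -> exists a, f = a *: evl (pm_V i).
Proof.
move=> Xg; set V := pm_V i in f *.
have inj := @curry_inj _ _ _ _ _ _ (@snakelR _ _ V).
have lin (x : Hom (V ⊗ dual V) one) : exists a, curry (coevl V) x = a *: lunitV V.
  exists (scalar_of (lunit V ∘ curry (coevl V) x)).
  rewrite -[LHS]compIm -lunitK -compA.
  by rewrite [lunit V ∘ _ in LHS](pm_V_scalar _ Xg) compZr compmI.
have [a fE] := lin f; have [b eE] := lin (evl V).
have b0 : b != 0.
  apply/eqP => b0; case: (@coevr_evl_neq0 g i Xg).
  by rewrite -/V [evl V](inj _ _ _ 0) ?comp0r // eE b0 scale0r curry0.
by exists (a / b); apply: inj; rewrite curryZ fE eE scalerA mulfVK.
Qed.

Lemma hom_from_one g (i : pm_I C g) (f : Hom one (pm_V i ⊗ dual (pm_V i))) :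
  ~ X g -> exists a, f = a *: coevr (pm_V i).
Proof.
move=> Xg; set V := pm_V i in f *.
have lin (x : Hom one (V ⊗ dual V)) : exists a, x = a *: curry (coevr V) (lunit V).
  exists (scalar_of (uncurry (evr V) x ∘ lunitV V)).
  rewrite -curryZ -[LHS](uncurryK (@snakeR _ _ V)); congr curry.
  rewrite -[LHS]compmI -lunitK compA.
  by rewrite [_ ∘ lunitV V in LHS](pm_V_scalar _ Xg) compZl compIm.
have [a fE] := lin f; have [b eE] := lin (coevr V).
set x0 := curry _ _ in fE eE.
have b0 : b != 0.
  apply/eqP => b0; case: (@coevr_evl_neq0 g i Xg).
  by rewrite -/V eE b0 scale0r comp0l.
by exists (a / b); rewrite fE eE scalerA mulfVK.
Qed.

Lemma deg_pair g (i j : pm_I C g) : ~ X g -> pm_deg 0 (pm_V i ⊗ dual (pm_V j)).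
Proof.
move=> Xg; rewrite -(addrN g); apply: (grading_tens grad); first exact: pm_V_deg.
by apply: (grading_dual grad); apply: pm_V_deg.
Qed.

Section Pairs.
Hypotheses (ab : is_abelian C) (mug : Z_trivial_muger_center0 C).

Lemma kirby_pair0 g h (i j : pm_I C g) : ~ X g -> ~ X h -> i != j ->
  kirby h (pm_V i ⊗ dual (pm_V j)) = 0.
Proof.
move=> Xg Xh ij.
have [||n [k [p [q ->]]]] := @kirby_sigma h (pm_V i ⊗ dual (pm_V j)) ab mug Xh.
- exact: deg_pair.
- exact: (@proj_tensR _ _ _ _ (@pm_V_projective _ _ _ _ C g i Xg)).
- by rewrite big1 // => a _; rewrite (hom_to_sigma0 (p a)) ?comp0r ?ij.
Qed.

Lemma kirby_pair1 g h (i : pm_I C g) : ~ X g -> ~ X h ->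
  exists a, kirby h (pm_V i ⊗ dual (pm_V i)) = a *: (coevr (pm_V i) ∘ evl (pm_V i)).
Proof.
move=> Xg Xh; set V := pm_V i.
have [||n [k [p [q ->]]]] := @kirby_sigma h (V ⊗ dual V) ab mug Xh.
- exact: deg_pair.
- exact: (@proj_tensR _ _ _ _ (@pm_V_projective _ _ _ _ C g i Xg)).
have term a : exists b, q a ∘ p a = b *: (coevr V ∘ evl V).
  have [ka|ka] := eqVneq (k a) 0; last first.
    by exists 0; rewrite (hom_to_sigma0 (p a)) ?ka ?orbT // comp0r scale0r.
  move: (p a) (q a); rewrite ka (sigma0 free) => x y.
  have [b ->] := hom_to_one x Xg; have [c ->] := hom_from_one y Xg.
  by exists (c * b); rewrite compZl compZr scalerA.
exists (\sum_a sval (cid (term a))); rewrite scaler_suml; apply: eq_bigr => a _.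
exact: svalP (cid (term a)).
Qed.

End Pairs.
End Transparency.

(** * The scalar of the Kirby morphism *)

Section KirbyScalar.
Variables (K : fieldType) (G Z : zmodType) (X : set G).
Variable C : premodular K Z X.
Implicit Types A B P U V W : C.

Let grad := pm_grading C.

Lemma cc_one U : cc U one = idm (U ⊗ one).
Proof.
apply: (iso_mono (runit_iso U)).
by rewrite ccE compA braid_one_l braid_one_r compmI.
Qed.

Lemma pm_V_evl_epi g (i : pm_I C g) : ~ X g -> is_epi (evl (pm_V i)).
Proof. by move=> Xg; apply: evl_epi; apply: (@pm_V_regular _ _ _ _ C g i Xg). Qed.

Lemma pair_projective g (i j : pm_I C g) : ~ X g ->
  is_projective (pm_V i ⊗ dual (pm_V j)).
Proof. by move=> Xg; exact: (@proj_tensR _ _ _ _ (@pm_V_projective _ _ _ _ C g i Xg)). Qed.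

(** The evaluation of V lifts through the epimorphism evl W to a map f, and f sends
    coevr V to a multiple c of coevr W. Naturality of the Kirby morphism along f
    gives b = a c, and cyclicity of the modified trace gives d(V) = c d(W). *)
Lemma kirby_scalar_colour h g g' (i : pm_I C g) (j : pm_I C g') a b :
  ~ X g -> ~ X g' ->
  kirby h (pm_V i ⊗ dual (pm_V i)) = a *: (coevr (pm_V i) ∘ evl (pm_V i)) ->
  kirby h (pm_V j ⊗ dual (pm_V j)) = b *: (coevr (pm_V j) ∘ evl (pm_V j)) ->
  mdim (pm_V i) * a = mdim (pm_V j) * b.
Proof.
move=> Xg Xg' ka kb; set V := pm_V i in ka *; set W := pm_V j in kb *.
have pV := @pair_projective g i i Xg; have pW := @pair_projective g' j j Xg'.
have eV := @pm_V_evl_epi g i Xg.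
have [f fE] := pV _ _ _ (evl V) (@pm_V_evl_epi g' j Xg').
have [c cE] := hom_from_one (f ∘ coevr V) Xg'.
have bE : b = a * c.
  have := kirby_nat h f; rewrite ka kb compZr compZl compA cE -compA fE.
  rewrite compZl scalerA => /eqP; rewrite -subr_eq0 -scalerBl => /eqP e0.
  have [/eqP|ne] := eqVneq (a * c - b) 0; first by rewrite subr_eq0 => /eqP.
  have : coevr W = 0.
    apply: eV; rewrite comp0l; apply: (can_inj (scalerK ne)).
    by rewrite e0 scaler0.
  by move=> cW0; case: (@coevr_evl_neq0 _ _ _ _ C g' j Xg'); rewrite -/W cW0 comp0l.
have dE : mdim V = c * mdim W.
  rewrite -trace_coevr_evl; last exact: pm_V_projective.
  rewrite -[evl V]fE compA trace_cyc // compA cE compZl traceZ.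
  by rewrite trace_coevr_evl //; exact: pm_V_projective.
by rewrite bE dE mulrC [c * _]mulrC mulrCA.
Qed.

(** If it were zero, then so would be U ◃ coevr, hence by the snake identity the
    object U ⊗ V ⊗ V^*, of which U is a quotient. *)
Lemma whL_coevr_evl_neq0 g (i : pm_I C g) U : ~ X g -> idm U <> 0 ->
  U ◃ (coevr (pm_V i) ∘ evl (pm_V i)) <> 0.
Proof.
move=> Xg U0 e0; apply: U0; set V := pm_V i in e0.
have eV := whL_epiR (U := U) (@pm_V_evl_epi g i Xg).
have c0 : U ◃ coevr V = 0 by apply: eV; rewrite -whL e0 comp0l.
have id0 : idm (U ⊗ (V ⊗ dual V)) = 0.
  rewrite -whI -snakeL whL b02E [U ◃ (assoc _ _ _ ∘ _)]whL [U ◃ ((coevr V ▹ _) ∘ _)]whL.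
  by rewrite -b22_whL c0 b22E tens0l !(comp0l, comp0r).
have id1 : idm (U ⊗ one) = 0.
  by apply: eV; rewrite comp0l compIm -[LHS]compmI id0 comp0r.
by rewrite -runitVK -[runitV U]compIm id1 comp0l comp0r.
Qed.

(** Slide an object of degree h' - h: it passes through the unit between ev and
    coev without effect. *)
Lemma kirby_scalar_degree g h h' (i : pm_I C g) a b :
  ~ X g -> ~ X h -> ~ X h' ->
  kirby h (pm_V i ⊗ dual (pm_V i)) = a *: (coevr (pm_V i) ∘ evl (pm_V i)) ->
  kirby h' (pm_V i ⊗ dual (pm_V i)) = b *: (coevr (pm_V i) ∘ evl (pm_V i)) ->
  a = b.
Proof.
move=> Xg Xh Xh' ka kb; have [U [dU U0]] := grading_nonzero grad (h' - h).
have hE : h + (h' - h) = h' by rewrite addrC subrK.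
have := @kirby_slide _ _ _ _ C h (h' - h) U _ Xh _ dU (@deg_pair _ _ _ _ C g i i Xg)
  (@pair_projective g i i Xg).
rewrite hE ka kb !tensZr compZr [U ◃ _]whL compA cc_natr cc_one compmI -whL.
move=> /(_ Xh') /eqP; rewrite -subr_eq0 -scalerBl => /eqP e0.
apply/eqP; rewrite -subr_eq0; apply/eqP; apply: contrapT => /eqP ne.
apply: (@whL_coevr_evl_neq0 g i U Xg U0).
by apply: (can_inj (scalerK ne)); rewrite e0 scaler0.
Qed.

(** The strands V_l and sigma k wind around each other with scalar psi. *)
Lemma kirby_sigma_tens g k A : ~ X g -> exists q : K,
  kirby g (sigma C k ⊗ A) = q *: (sigma C k ◃ kirby g A).
Proof.
move=> Xg; have [psi [_ _ _ pE]] := pm_compat C; exists (psi g k).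
rewrite /kirby tens_sumr scaler_sumr; apply: eq_bigr => l _.
rewrite tensZr scalerA mulrC -scalerA; congr (_ *: _).
set V := pm_V l; set S := sigma C k.
have qE : cc S V = psi g k *: idm _.
  apply: (iso_epi (braid_iso V S)); rewrite -cc_swap ccE (pE g); last exact: pm_V_deg.
  by rewrite compZl compZr compIm compmI.
rewrite !PhiE -ptr_whL -ptrZ; congr ptr.
have := cc_tensl S A V; rewrite qE b22Z b22_id compZl compZr compIm -whL -ccE => e.
rewrite -[LHS]compmI -(assocK S A V) -[LHS]compIm -(assocK S A V) -?compA.
by rewrite [cc _ _ ∘ (_ ∘ _)]compA [assoc S A V ∘ (_ ∘ _)]compA e compZl compZr.
Qed.

(** The Kirby morphism is natural, B ⊗ V ⊗ V^* covers B, and B ⊗ V decomposes into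
    the objects sigma k ⊗ V_i of degree g. *)
Lemma kirby_vanish g : ~ X g ->
  (forall i j : pm_I C g, kirby g (pm_V i ⊗ dual (pm_V j)) = 0) ->
  forall B, pm_deg 0 B -> kirby g B = 0.
Proof.
move=> Xg k0 B dB; have [j _] := @generic_index _ _ _ _ C g Xg; set V := pm_V j.
have dBV : pm_deg g (B ⊗ V).
  by rewrite -[g]add0r; apply: (grading_tens grad) => //; apply: pm_V_deg.
have [n [x [s [i e]]]] := simpleW_dom Xg dBV.
have piece r : kirby g (simpleW (x r) ⊗ dual V) = 0.
  rewrite /simpleW; apply: (iso_mono (assoc_iso _ _ _)).
  rewrite kirby_nat; have [q ->] := @kirby_sigma_tens g (x r).2 (pm_V (x r).1 ⊗ dual V) Xg.
  by rewrite k0 tens0r scaler0 comp0l comp0r.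
have kBV : kirby g ((B ⊗ V) ⊗ dual V) = 0.
  rewrite -[LHS]compmI -whI e tens_suml comp_sumr big1 // => r _.
  by rewrite whR compA -kirby_nat piece comp0r comp0l.
have ep : is_epi (runit B ∘ ((B ◃ evl V) ∘ assoc B V (dual V))).
  apply: epi_comp (iso_epi (runit_iso _)) (epi_comp _ (iso_epi (assoc_iso _ _ _))).
  by apply: whL_epiR; apply: pm_V_evl_epi.
by apply: ep; rewrite -kirby_nat kBV comp0r comp0l.
Qed.

End KirbyScalar.

(** * The scalar does not vanish *)

Section PowersFree.
Variables (K : fieldType) (C : linCat K).

(** The maps x and y play the part of a closure f |-> y f x. In a linear relation
    between powers of a, the constant coefficient is detected by closing the
    relation or, if the identity has closure 0, by closing its quotient by a;
    afterwards the relation can be divided by a. *)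
Lemma powers_free (E W F : C) (x : Hom E W) (y : Hom W F) (a a' : Hom W W)
    (pw : nat -> Hom W W) :
  a' ∘ a = idm W -> pw 0%N = idm W -> (forall n, pw n.+1 = a ∘ pw n) ->
  (forall n, y ∘ (pw n.+1 ∘ x) = 0) -> y ∘ (a' ∘ x) <> 0 ->
  forall N (c : nat -> K), \sum_(t < N) c t *: pw t = 0 ->
  forall t, (t < N)%N -> c t = 0.
Proof.
move=> a'a pw0 pwS y0 ya; elim=> [|N IH] c; first by [].
rewrite big_ord_recl /= => e.
have zero b (z : Hom E F) : z <> 0 -> b *: z = 0 -> b = 0.
  move=> z0 bz; have [//|b0] := eqVneq b 0; case: z0.
  by apply: (can_inj (scalerK b0)); rewrite bz scaler0.
have e' : c 0%N *: a' + \sum_(t < N) c t.+1 *: pw t = 0.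
  have := congr1 (fun f => a' ∘ f) e.
  rewrite comp0r compDr compZr pw0 compmI comp_sumr => h; rewrite -[RHS]h.
  congr (_ + _).
  by apply: eq_bigr => t _; rewrite /= compZr pwS (ra0 a'a).
have c0 : c 0%N = 0.
  have [yx|/zero] := pselect (y ∘ x = 0); last first.
    apply; have := congr1 (fun f => y ∘ (f ∘ x)) e.
    rewrite comp0l comp0r compDl compDr compZl compZr pw0 compIm.
    rewrite comp_suml comp_sumr big1 ?addr0 // => t _.
    by rewrite compZl compZr y0 scaler0.
  apply: (zero _ _ ya); have := congr1 (fun f => y ∘ (f ∘ x)) e'.
  rewrite comp0l comp0r compDl compDr compZl compZr.
  rewrite comp_suml comp_sumr big1 ?addr0 // => -[[|t] ht] _ /=.
    by rewrite compZl compZr pw0 compIm yx scaler0.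
  by rewrite compZl compZr y0 scaler0.
move: e'; rewrite c0 scale0r add0r => e' [//|t].
exact: (IH (fun t => c t.+1) e').
Qed.

End PowersFree.

Section Nonzero.
Variables (K : fieldType) (G Z : zmodType) (X : set G).
Variable C : premodular K Z X.
Implicit Types A B P U V W : C.

Let grad := pm_grading C.

Lemma simpleW_hom_line g (x y : pm_I C g * Z) : ~ X g ->
  exists b : Hom (simpleW x) (simpleW y), forall f, exists a : K, f = a *: b.
Proof.
move=> Xg; have [<-|ne] := eqVneq x y.
  by exists (idm _) => f; apply: simpleW_end.
by exists 0 => f; exists 0; rewrite scaler0; apply: simpleW_hom0.
Qed.

(** Through a decomposition of A into simple objects, endomorphisms of A embed into
    n by n matrices. *)
Lemma End_dependence g A : ~ X g -> pm_deg g A -> exists N, forall f : nat -> Hom A A,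
  exists2 c : nat -> K, \sum_(t < N) c t *: f t = 0 & exists2 t, (t < N)%N & c t != 0.
Proof.
move=> Xg dA; have [n [x [s [i e]]]] := simpleW_dom Xg dA; exists (n * n).+1 => f.
pose b q r := sval (cid (@simpleW_hom_line g (x q) (x r) Xg)).
pose l q r h := sval (cid (svalP (cid (@simpleW_hom_line g (x q) (x r) Xg)) h)).
have lE q r h : h = l q r h *: b q r.
  exact: svalP (cid (svalP (cid (@simpleW_hom_line g (x q) (x r) Xg)) h)).
pose M := \matrix_(t < (n * n).+1)
  mxvec (\matrix_(q, r) l q r (s r ∘ (f t ∘ i q)) : 'M[K]_n).
have : kermx M != 0.
  rewrite -mxrank_eq0 mxrank_ker subn_eq0 -ltnNge ltnS.
  exact: rank_leq_col.
case/rowV0Pn => v /sub_kermxP vM v0.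
exists (fun t => if insub t is Some o then v 0 o else 0); last first.
  case/rV0Pn: v0 => o vo; exists o; first exact: ltn_ord.
  by rewrite valK.
under eq_bigr do rewrite valK.
set S := \sum_t _.
have SE q r : s r ∘ (S ∘ i q) = 0.
  rewrite /S comp_suml comp_sumr.
  under eq_bigr => t _ do
    rewrite compZl compZr [s r ∘ _](lE q r) scalerA.
  rewrite -scaler_suml.
  have -> : \sum_t v 0 t * l q r (s r ∘ (f t ∘ i q)) = (v *m M) 0 (mxvec_index q r).
    by rewrite mxE; apply: eq_bigr => t _; rewrite mxE mxvecE mxE.
  by rewrite vM mxE scale0r.
rewrite -[S]compIm e comp_suml big1 // => r _.
rewrite -compA -[S]compmI e !comp_sumr big1 // => q _.
by rewrite [S ∘ _]compA [s r ∘ _]compA SE comp0l comp0r.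
Qed.

(** The degree and the projectivity of the turning strand are recorded: in degree
    0 the sum over all colours of the strand T can be replaced by kirby g. *)
Definition turning d Y (u : forall T : C, Hom (Y ⊗ T) T) :=
  exists (V B : C) (al : Hom Y (V ⊗ B)) (be : Hom (V ⊗ B) one),
    [/\ pm_deg d B, is_projective B & forall T, u T = turn al be T].

Lemma turning_prod d1 d2 Y1 Y2 Y u1 u2 (ga : Hom Y (Y1 ⊗ Y2)) :
  turning d1 u1 -> turning d2 u2 ->
  turning (d1 + d2) (fun T => u1 T ∘ ((Y1 ◃ u2 T) ∘ b12 ga T)).
Proof.
move=> [V1 [B1 [al1 [be1 [dB1 pB1 u1E]]]]] [V2 [B2 [al2 [be2 [dB2 pB2 u2E]]]]].
exists (V1 ⊗ V2), (B1 ⊗ B2), (turn2_al al1 al2 ga), (turn2_be be1 be2); split.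
- exact: (grading_tens grad).
- exact: (@proj_tensR _ _ _ _ pB1).
- by move=> T; rewrite u1E u2E turn2E.
Qed.

Lemma turning_prec d Y Y' u (ga : Hom Y' Y) :
  turning d u -> turning d (fun T => u T ∘ (ga ▹ T)).
Proof.
move=> [V [B [al [be [dB pB uE]]]]]; exists V, B, (al ∘ ga), be.
by split=> // T; rewrite uE turn_prec.
Qed.

(** Turning diagrams that are closed off on the left, as natural endomorphisms. *)
Definition encircling d (v : forall T : C, Hom T T) :=
  exists2 u, @turning d one u & forall T, v T = u T ∘ lunitV T.

Lemma encircling_prod d1 d2 v1 v2 : encircling d1 v1 -> encircling d2 v2 ->
  encircling (d1 + d2) (fun T => v1 T ∘ v2 T).
Proof.
move=> [u1 t1 e1] [u2 t2 e2].
exists (fun T => u1 T ∘ ((one ◃ u2 T) ∘ b12 (lunitV one) T)).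
  exact: turning_prod.
move=> T; rewrite e1 e2 b12E -lunitV_tail -?compA; congr (_ ∘ _).
by rewrite compA lunitV_nat -?compA.
Qed.

Lemma encircling_loop d V : pm_deg d V -> is_projective V -> encircling d (Phi V).
Proof.
move=> dV pV; exists (turn (coevl V) (evr V)).
  by exists (dual V), V, (coevl V), (evr V).
by move=> T; rewrite turn_loop.
Qed.

Lemma turning_wind d V n : pm_deg d V -> is_projective (dual V) ->
  turning (- (d *+ n.+1)) (fun T => wind V T n.+1).
Proof.
move=> dV pV; have t1 : turning (- d) (fun T => wind V T 1).
  exists V, (dual V), (idm _), (evl V); split=> //; first exact: (grading_dual grad).
  by move=> T; rewrite wind1.
elim: n => [|n IH]; first by rewrite mulr1n.
rewrite mulrS opprD.
have [U [B [al [be [dB pB E]]]]] := turning_prod (wind_split V) t1 IH.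
exists U, B, al, be; split=> // T.
by rewrite -E windS wind1.
Qed.

Definition wound V n T : Hom T T := trL (evl V) (coevr V) (cc_pow (dual V) T n).

Lemma encircling_wound d V n : pm_deg d V -> is_projective (dual V) ->
  encircling (- (d *+ n.+1)) (wound V n.+1).
Proof.
move=> dV pV; exists (fun T => wind V T n.+1 ∘ (coevr V ▹ T)).
  by apply: turning_prec; apply: turning_wind.
by move=> T; rewrite /wound /trL /wind b02E -?compA.
Qed.

(** Seen from the strand B, it is the closed strand T that encircles B. *)
Lemma trace_encircling B V T (al : Hom one (V ⊗ B)) (be : Hom (V ⊗ B) one) :
  is_projective B -> is_projective T ->
  pm_trace T (turn al be T ∘ lunitV T) =
  pm_trace (V ⊗ B) ((V ◃ Phi T B) ∘ (al ∘ be)).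
Proof.
move=> pB pT; have pVB := @proj_tensL _ _ _ V pB.
have pVBT := @proj_tensL _ _ _ V (@proj_tensL _ _ _ B pT).
have -> : turn al be T ∘ lunitV T = b20 be T ∘ ((V ◃ cc B T) ∘ b02 al T).
  by rewrite /turn b02E b12E -?compA.
rewrite trace_cyc // -compA -b22_split0.
have -> : (V ◃ cc B T) ∘ b22 (al ∘ be) T =
    assoc V B T ∘ (((assocV V B T ∘ ((V ◃ cc B T) ∘ assoc V B T)) ∘ ((al ∘ be) ▹ T))
      ∘ assocV V B T).
  by rewrite b22E -?compA (ra0 (assocVK _ _ _)).
have pVBT' := @proj_tensL _ _ _ (V ⊗ B) pT.
rewrite trace_cyc // -compA assocK compmI trace_ptr //.
by rewrite ptr_compr ptr_whL PhiE.
Qed.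

Section Vanishing.
Variable g : G.
Hypothesis Xg : ~ X g.
Hypothesis Snd : S_nondegenerate C g.
Hypothesis k0 : forall B, pm_deg 0 B -> kirby g B = 0.
Implicit Types i j k : pm_I C g.

(** The colours V_k, weighted by d(V_k), assemble to the Kirby morphism of the
    encircling strand. *)
Lemma encircling_sum v : encircling 0 v ->
  \sum_(k : pm_I C g) mdim (pm_V k) * pm_trace (pm_V k) (v (pm_V k)) = 0.
Proof.
move=> [u [V [B [al [be [dB pB uE]]]]] vE].
have -> : \sum_(k : pm_I C g) mdim (pm_V k) * pm_trace (pm_V k) (v (pm_V k)) =
   pm_trace (V ⊗ B) ((V ◃ kirby g B) ∘ (al ∘ be)).
  rewrite /kirby tens_sumr comp_suml trace_sum; apply: eq_bigr => k _.
  rewrite tensZr compZl traceZ vE uE trace_encircling //.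
  exact: pm_V_projective.
by rewrite k0 // tens0r comp0l trace0.
Qed.

Lemma S_separates (x : pm_I C g -> K) :
  (forall j, \sum_k mdim (pm_V k) * Sprime j k * x k = 0) -> forall k, x k = 0.
Proof.
move=> e k; pose y : 'cV[K]_#|pm_I C g| := \col_a x (enum_val a).
have Sy : Smatrix C g *m y = 0.
  apply/matrixP => a b; rewrite !mxE -[RHS](e (enum_val a)).
  rewrite [RHS](reindex (fun c : 'I_#|pm_I C g| => enum_val c)) /=; last first.
    exact/onW_bij/enum_val_bij.
  by apply: eq_bigr => c _; rewrite !mxE.
have y0 : y = 0 by rewrite -(mulKmx Snd y) Sy mulmx0.
by have := congr1 (fun z : 'cV_ _ => z (enum_rank k) 0) y0; rewrite !mxE enum_rankK.
Qed.

Lemma S_column k : exists j, Sprime j k != 0.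
Proof.
apply: contrapT => no; suff /eqP : (1 : K) = 0 by rewrite oner_eq0.
have := @S_separates (fun l => (l == k)%:R) _ k; rewrite eqxx; apply=> j.
rewrite big1 // => l _.
have [->|] := eqVneq l k; last by rewrite mulr0.
have [->|ne] := eqVneq (Sprime j k) 0; first by rewrite mulr0 mul0r.
by case: no; exists j.
Qed.

(** To n + 1 windings of degree - g add n loops of colour j0 and one of arbitrary
    colour j: the total degree is 0. The resulting sums over k vanish, and as j
    varies the invertibility of S_g separates their terms. Choosing j0 with
    nonzero scalar on V_k leaves the windings alone. *)
Lemma wound0 i k n : wound (pm_V i) n.+1 (pm_V k) = 0.
Proof.
pose T n i k := scalar_of (wound (pm_V i) n.+1 (pm_V k)).
have TE l : wound (pm_V i) n.+1 (pm_V l) = T n i l *: idm _ := pm_V_scalar _ Xg.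
have PE j l : Phi (pm_V j) (pm_V l) = Sprime j l *: idm _ := pm_V_scalar _ Xg.
have [j0 jk] := S_column k; rewrite TE.
suff /(_ k) /eqP : forall l, T n i l * Sprime j0 l ^+ n * mdim (pm_V l) = 0.
  rewrite !mulf_eq0 expf_eq0 (negPf jk) (negPf (mdim_neq0 k Xg)) andbF !orbF.
  by move/eqP->; rewrite scale0r.
apply: S_separates => j.
pose loops m U := iter m (fun f => Phi (pm_V j0) U ∘ f) (Phi (pm_V j) U).
have loops_enc m : encircling (g *+ m.+1) (loops m).
  have Phi_enc j' : encircling g (Phi (pm_V j')).
    by apply: encircling_loop; [apply: pm_V_deg | apply: pm_V_projective].
  elim: m => [|m IH]; first by rewrite mulr1n; apply: Phi_enc.
  by rewrite mulrS; apply: encircling_prod.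
have loopsE m l : loops m (pm_V l) = (Sprime j0 l ^+ m * Sprime j l) *: idm _.
  elim: m => [|m IH]; first by rewrite expr0 mul1r [LHS]PE.
  by rewrite [LHS]/= -/(loops m _) IH PE compZl compZr compIm scalerA exprS mulrA.
have pd : is_projective (dual (pm_V i)).
  by apply: (@generic_projective _ _ _ _ C (- g)); [exact: (generic_opp C Xg) | exact: (grading_dual grad (pm_V_deg i Xg))].
have := encircling_prod (encircling_wound n (pm_V_deg i Xg) pd) (loops_enc n).
rewrite addNr => /encircling_sum e; rewrite -[RHS]e; apply: eq_bigr => l _.
rewrite (@trace_simple _ _ _ _ C g l _ (T n i l * (Sprime j0 l ^+ n * Sprime j l))).
  by rewrite -!mulrA; congr (_ * _); rewrite mulrCA; congr (_ * _); rewrite mulrCA.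
by rewrite TE loopsE compZl compZr compIm scalerA.
Qed.

(** The inverse power of the double braiding closes to Phi, the positive powers
    close to 0; so if Phi were nonzero the powers would be independent. *)
Lemma Phi0 i k : Phi (pm_V i) (pm_V k) = 0.
Proof.
apply: contrapT; set V := pm_V i; set U := pm_V k => PVU.
have dA : pm_deg g (V ⊗ (dual V ⊗ U)).
  have := grading_tens grad (pm_V_deg i Xg)
    (grading_tens grad (grading_dual grad (pm_V_deg i Xg)) (pm_V_deg k Xg)).
  by rewrite addNr addr0.
have [N dep] := End_dependence Xg dA.
have [c ce [t tN]] := dep (fun n => V ◃ cc_pow (dual V) U n).
case/eqP; move: t tN; move: N c ce {dep}.
apply: (@powers_free _ _ _ _ _ (b02 (coevr V) U) (b20 (evl V) U) (V ◃ cc (dual V) U)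
  (V ◃ (braidV (dual V) U ∘ braidV U (dual V)))
  (fun n => V ◃ cc_pow (dual V) U n)).
- rewrite -whL ccE -compA (ra0 (braidK _ _)) braidK; exact: whI.
- exact: whI.
- by move=> n; rewrite -whL.
- by move=> n; apply: (@wound0 i k n).
- by rewrite -/(trL _ _ _) trL_ccV.
Qed.

Lemma nondegenerate_kirby_contra : False.
Proof.
have [k _] := @generic_index _ _ _ _ C g Xg; have [j /eqP] := S_column k; case.
by apply: (pm_V_scalar_uniq Xg); rewrite Phi0 scale0r.
Qed.

End Vanishing.
End Nonzero.

(** * From a nondegenerate S-matrix to relative modularity *)

Section PartTwo.
Variables (K : fieldType) (G Z : zmodType) (X : set G).
Variable C : premodular K Z X.

Lemma nondegenerate_relative_modular g :
  is_abelian C -> Z_trivial_muger_center0 C -> ~ X g -> S_nondegenerate C g ->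
  relative_modular C.
Proof.
move=> ab mug Xg Sg; have [i0 _] := @generic_index _ _ _ _ C g Xg.
have [a aE] := @kirby_pair1 _ _ _ _ C ab mug g g i0 Xg Xg.
have kE g' h (i : pm_I C g') : ~ X g' -> ~ X h ->
    mdim (pm_V i) *: kirby h (pm_V i ⊗ dual (pm_V i)) =
    (mdim (pm_V i0) * a) *: (coevr (pm_V i) ∘ evl (pm_V i)).
  move=> Xg' Xh.
  have [b bE] := @kirby_pair1 _ _ _ _ C ab mug g' g i Xg' Xg.
  have [c cE] := @kirby_pair1 _ _ _ _ C ab mug g' h i Xg' Xh.
  rewrite (kirby_scalar_colour Xg Xg' aE bE) cE scalerA.
  by rewrite (kirby_scalar_degree Xg' Xg Xh bE cE).
exists (mdim (pm_V i0) * a); split.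
  apply/eqP => z0; apply: (@nondegenerate_kirby_contra _ _ _ _ C g Xg Sg).
  apply: kirby_vanish => // i j; have [<-|ij] := eqVneq i j; last exact: kirby_pair0.
  apply: (can_inj (scalerK (mdim_neq0 i Xg))).
  by rewrite kE // z0 scale0r scaler0.
move=> g' h Xg' Xh; split=> [i|i j ij]; first exact: kE.
have := @kirby_pair0 _ _ _ _ C ab mug g' h i j Xg' Xh ij.
by rewrite /kirby => ->; rewrite scaler0.
Qed.

End PartTwo.

Theorem theorem1p2 (K : fieldType) (G Z : zmodType) (X : set G)
    (C : premodular K Z X) :
  (relative_modular C -> exists g : G, ~ X g /\ S_nondegenerate C g) /\
  (is_unimodular C -> (exists g : G, ~ X g /\ S_nondegenerate C g) ->
   Z_trivial_muger_center0 C -> relative_modular C).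
Proof.
split=> [mod|[ab _] [g [Xg Sg]] mug].
  have [g Xg] := generic_exists C; exists g; split=> //.
  exact: relative_modular_nondegenerate.
exact: (nondegenerate_relative_modular ab mug Xg Sg).
Qed.
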